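(* Let $k\geq 1$ and $n\geq k$ be integers and let $L(k)$ be either $L_k$ or $\mathcal{L}_k$. (1) For any $\tau(k)$-monomial $e_{(I;J)}\in C^*_{(n)}(L(k))$ (where $(I;J)$ is any distinguished $k$-partition of degree $n$) there are expansions $$e_{(I;J)}=\sum_{(I';J')\trianglelefteq (I;J)}\alpha_{(I';J')}\,e_{(I';J')}=\sum_{(I';J')\trianglelefteq (I;J)}\beta_{(I';J')}\,\xi_{(I';J')}$$ with rational coefficients, where in both sums the distinguished $k$-partitions $(I';J')$ are nonsingular. (2) The set of nonsingular $\tau(k)$-monomials of degree $n$ is a basis of $C^*_{(n)}(L(k))$. (3) The set of $\xi(k)$-monomials of degree $n$ is a basis of $C^*_{(n)}(L(k))$.
   Context: Algebras. Everything is over $\mathbb{Q}$. $W$ is the Lie algebra with basis $e_i$ ($i\in\mathbb{Z}$) and bracket $[e_a,e_b]=(b-a)e_{a+b}$; $\widetilde{sl}_2$ is the Lie algebra with basis $e_i$ ($i\in\mathbb{Z}$) and bracket $[e_a,e_b]=\varepsilon_{b-a}e_{a+b}$, where $\varepsilon_z\in\{-1,0,1\}$, $\varepsilon_z\equiv z\bmod 3$. $L_k\subset W$ and $\mathcal{L}_k\subset\widetilde{sl}_2$ are the subalgebras spanned by $e_i$, $i\geq k$; $L(k)$ denotes either one. Put $\mu(z)=z$ if $L(k)=L_k$ and $\mu(z)=\varepsilon_z$ if $L(k)=\mathcal{L}_k$. Complex. $C_q(L(k))=\bigwedge^q L(k)$ has the basis of $k$-monomials $e_{i_1}\wedge\dots\wedge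 e_{i_q}$, $k\leq i_1<\dots<i_q$, of degree $i_1+\dots+i_q$. The inner product making this basis orthonormal identifies chains with cochains $C^*(L(k))=\bigoplus_n C^*_{(n)}(L(k))$, where $C^*_{(n)}(L(k))$ is the span of $k$-monomials of degree $n$. The coboundary operator is the antiderivation $\delta_k$ with $\delta_k(e_i)=\sum_{a+b=i,\ k\leq a<b}\mu(b-a)\,e_a\wedge e_b$ and $\delta_k(e_{i_1}\wedge\dots\wedge e_{i_q})=\sum_{s}(-1)^{s-1}e_{i_1}\wedge\dots\wedge\delta_k(e_{i_s})\wedge\dots\wedge e_{i_q}$. Partitions. A $k$-partition is an integer vector $I=(i_1,\dots,i_q)$ with $k\leq i_1\leq\dots\leq i_q$; $\dim I=q$, degree $|I|=\sum i_r$; $I$ is strict if $i_1<\dots<i_q$. The union of partitions is the partition whose parts are all the parts of both (with multiplicity). $I$ is nonsingular if $i_{r+1}-i_r\geq 3$ for all $r$, singular otherwise. A nonsingular $k$-partition is a main $k$-partition if $i_q\leq 2k+3(q-1)$ when $i_1>k$, and $i_q<2k+3(q-1)$ when $i_1=k$; the empty partition is also main. A $k$-partition is dense if $i_1>2k$ and $i_{r+1}-i_r=3$ for all $r$. The normal form of a nonsingular $k$-partition $I$ is its unique representation $I=I_0\cup I_1\cup\dots\cup I_m$ with $I_0$ main and $I_1,\dots,I_m$ dense, each of maximal possible dimension (i.e. $I_0$ is the longest initial segment of $I$ that is main, and $I_1,\dots,I_m$ are the maximal blocks of consecutive remaining parts with successive differences exactly $3$). The leading parts of $I$ are the minimal parts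 $I_a(1)$ of $I_a$, $a\geq 1$. Distinguished partitions. A distinguished $k$-partition is a pair $(I;J)$, $I$ a $k$-partition and $J\subset I$ a sub-multiset such that $I\setminus J$ is strict; parts in $J$ are called distinguished. Its degree is $|I|$, its dimension is $\dim(I)+\dim(J)$. A strict $I$ is identified with $(I;\emptyset)$. $(I;J)$ is nonsingular if $I$ is nonsingular and $J$ is a subset of the leading parts of $I$. $D(k,n)$ is the set of distinguished $k$-partitions of degree $n$. Order. For two parts $i_a,i_b$ ($a<b$) of $I$ that are not distinguished, $S_{a,b}(I;J)$ is obtained by removing $i_a,i_b$ from $I$ and adding the part $i_a+i_b$ both to $I$ and to $J$. On elements of $D(k,n)$ of equal dimension, $\triangleleft$ is the partial order generated (by transitivity) by the relations $(I';J')\triangleleft(I;J)$ in the cases: (i) $I=I'$ and $J'$ is smaller than $J$ in lexicographic order (as nondecreasing sequences); (ii) $I\neq I'$, $\dim I=\dim I'=q$, and $i'_1+\dots+i'_r\leq i_1+\dots+i_r$ for $r=1,\dots,q-1$; (iii) $\dim I'<\dim I$ and $(I';J')$ is obtained from $(I;J)$ by a finite sequence of operations $S_{a,b}$. $\trianglelefteq$ means $\triangleleft$ or equal. Monomials. For $(I;J)$ distinguished with $I=(i_1,\dots,i_q)$, the $\tau(k)$-monomial is $e_{(I;J)}=\tau_{i_1}\wedge\dots\wedge\tau_{i_q}$, $\tau_{i_r}=e_{i_r}$ if the part $i_r$ is not distinguished, $\tau_{i_r}=\delta_k(e_{i_r})$ if it is; it is nonsingular if $(I;J)$ is. For a nonsingular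 $(I;J)$ with normal form $I=I_0\cup\dots\cup I_m$, the $\xi(k)$-monomial is $\xi_{(I;J)}=\xi_{I_0}\wedge\xi_{I_1}\wedge\dots\wedge\xi_{I_m}$, where $\xi_{I_0}=e_{I_0}$ and, for $a\geq1$, $\xi_{I_a}=e_{I_a}$ if $I_a(1)\notin J$, $\xi_{I_a}=\delta_k(e_{I_a})$ if $I_a(1)\in J$; here $e_{I}=e_{i_1}\wedge\dots\wedge e_{i_q}$ for a strict $I=(i_1,\dots,i_q)$. The degree of a monomial is the degree of $(I;J)$. *)

(* Defs.v *)
From Stdlib Require Import Relation_Operators.
From HB Require Import structures.
From mathcomp Require Import all_boot all_order all_algebra.
From mathcomp Require Import finmap.
From mathcomp.multinomials Require Import monalg.

Set Implicit Arguments.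
Unset Strict Implicit.
Unset Printing Implicit Defensive.

Import Order.TTheory GRing.Theory.

Local Open Scope ring_scope.

Section Families.
Variables (V : lmodType rat) (T : choiceType).

Definition lspan (P : T -> Prop) (f : T -> V) (x : V) : Prop :=
  exists (s : {fset T}) (c : T -> rat),
    (forall t, t \in s -> P t) /\ x = \sum_(t <- s) c t *: f t.

Definition lin_indep (P : T -> Prop) (f : T -> V) : Prop :=
  forall (s : {fset T}) (c : T -> rat),
    (forall t, t \in s -> P t) -> \sum_(t <- s) c t *: f t = 0 ->
    forall t, t \in s -> c t = 0.

(* The family (f t), t ranging over P, is a basis of the subspace S; in
   particular f is injective on P. *)
Definition is_basis (P : T -> Prop) (f : T -> V) (S : V -> Prop) : Prop :=
  [/\ forall t, P t -> S (f t),
      lin_indep P f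
    & forall x, S x -> lspan P f x].

End Families.

(* The two Lie algebras, with basis e_i and [e_a, e_b] = mu (b - a) e_(a + b);
   L(k) is the span of the e_i with i >= k. *)
Inductive lie_algebra := W | sl2_tilde.

Definition eps (z : int) : int :=
  if (z %% 3)%Z == 2 then -1 else (z %% 3)%Z.

Definition mu (L : lie_algebra) (z : int) : rat :=
  match L with
  | W => z%:~R
  | sl2_tilde => (eps z)%:~R
  end.

(* The exterior algebra on the e_i, i : nat, as the free module on finite sets
   of indices: A stands for the wedge of the e_i, i \in A, taken in increasing
   order of i. As k >= 1, natural indices suffice for all L(k). *)
Notation chain := {malg rat[{fset nat}]}.

Definition wedge_set (A B : {fset nat}) : chain :=
  if [disjoint A & B]%fset then
    (-1) ^+ (\sum_(a <- A) count (fun b => b < a)%N B)%N *: << (A `|` B)%fset >>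
  else 0.

Definition wedge (x y : chain) : chain :=
  \sum_(A <- msupp x) \sum_(B <- msupp y) (x@_A * y@_B) *: wedge_set A B.

Definition wedge_seq (xs : seq chain) : chain :=
  foldr wedge << fset0 >> xs.

Definition e_ (i : nat) : chain := << [fset i]%fset >>.

Definition e_mon (I : seq nat) : chain := wedge_seq [seq e_ i | i <- I].

Definition delta_gen (L : lie_algebra) (k i : nat) : chain :=
  \sum_(k <= a < i.+1) \sum_(k <= b < i.+1 | (a < b)%N && (a + b == i)%N)
    mu L (b%:Z - a%:Z) *: wedge (e_ a) (e_ b).

Definition delta_mon (L : lie_algebra) (k : nat) (I : seq nat) : chain :=
  \sum_(0 <= s < size I)
    (-1) ^+ s *: wedge_seq [:: e_mon (take s I);
                               delta_gen L k (nth 0%N I s);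
                               e_mon (drop s.+1 I)].

Definition delta (L : lie_algebra) (k : nat) (x : chain) : chain :=
  \sum_(A <- msupp x) x@_A *: delta_mon L k (sort leq A).

Local Open Scope nat_scope.

Definition k_partition (k : nat) (I : seq nat) : bool :=
  sorted leq I && all (leq k) I.

Definition strict (I : seq nat) : bool := sorted ltn I.

Definition cochain_deg (k n : nat) : chain -> Prop :=
  lspan (fun I : seq nat => [&& k_partition k I, strict I & sumn I == n]) e_mon.

Definition nonsingular_part (k : nat) (I : seq nat) : bool :=
  k_partition k I && sorted (fun a b => a + 3 <= b) I.

Definition main_part (k : nat) (I : seq nat) : bool :=
  nonsingular_part k I &&
  match I with
  | [::] => true
  | i1 :: _ =>
      let q := size I in
      let iq := last i1 I in
      if i1 == k then iq < 2 * k + 3 * (q - 1)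
      else iq <= 2 * k + 3 * (q - 1)
  end.

Definition dense_part (k : nat) (I : seq nat) : bool :=
  match I with
  | [::] => false
  | i1 :: I' => (2 * k < i1) && path (fun a b => b == a + 3) i1 I'
  end.

(* Dimension of the longest initial segment of I that is main. *)
Definition main_dim (k : nat) (I : seq nat) : nat :=
  \max_(r < (size I).+1 | main_part k (take r I)) r.

(* The maximal blocks of consecutive parts with successive differences 3. *)
Fixpoint blocks (I : seq nat) : seq (seq nat) :=
  match I with
  | [::] => [::]
  | i :: I' =>
      match blocks I' with
      | (j :: b) :: bs =>
          if j == i + 3 then (i :: j :: b) :: bs else [:: i] :: (j :: b) :: bs
      | bs => [:: i] :: bs
      end
  end.

Definition normal_form (k : nat) (I : seq nat) : seq nat * seq (seq nat) :=
  (take (main_dim k I) I, blocks (drop (main_dim k I) I)).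

Lemma flatten_blocks I : flatten (blocks I) = I.
Proof.
elim: I => //= i I; case: (blocks I) => [|[|j b] bs] /= <- //.
by case: ifP.
Qed.

Lemma blocks_dense k I :
  all (fun i => 2 * k < i) I -> all (dense_part k) (blocks I).
Proof.
elim: I => //= i I IH /andP[ki /IH]; case: (blocks I) => [|[|j b] bs] //=.
  by rewrite ki.
by case: ifP => [/eqP ->|_] /= /andP[/andP[kj ->] ->]; rewrite ?eqxx ki ?kj.
Qed.

Lemma blocks_maximal I :
  sorted (fun b c => last 0 b + 3 != head 0 c) (blocks I).
Proof.
elim: I => //= i I; case: (blocks I) => [|[|j b] bs] //=.
  by rewrite addn3.
by case: ifP => [_|/negbT] /=; [case: bs | rewrite eq_sym => ->].
Qed.

Lemma main_dim_leq k I : main_dim k I <= size I.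
Proof. by apply/bigmax_leqP => r _; rewrite -ltnS. Qed.

Lemma main_dimP k I : main_part k (take (main_dim k I) I).
Proof.
have := @eq_bigmax_cond _ (fun r : 'I_(size I).+1 => main_part k (take r I))
  (fun r => nat_of_ord r).
case; first by apply/card_gt0P; exists ord0; rewrite unfold_in /= take0.
by move=> r mr; rewrite /main_dim => ->.
Qed.

Lemma main_dim_max k I r :
  r <= size I -> main_part k (take r I) -> r <= main_dim k I.
Proof.
rewrite -ltnS => lt_r mr.
exact: (@leq_bigmax_cond _ (fun r : 'I_(size I).+1 => main_part k (take r I))
  (fun r => nat_of_ord r) (Ordinal lt_r)).
Qed.

Lemma main_dim_gt k I :
  0 < k -> nonsingular_part k I ->
  all (fun i => 2 * k < i) (drop (main_dim k I) I).
Proof.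
move=> k_gt0 nsI; have /andP[/andP[sI kI] gI] := nsI.
set m := main_dim k I; have [le_Im|lt_mI] := leqP (size I) m.
  by rewrite drop_oversize.
have nsT: nonsingular_part k (take m.+1 I).
  rewrite /nonsingular_part /k_partition !take_sorted //=.
  by rewrite andbT; apply/allP => i /mem_take; exact: (allP kI).
have kx: 2 * k < nth 0 I m.
  have: ~~ main_part k (take m.+1 I).
    by apply/negP => /(main_dim_max lt_mI); rewrite ltnn.
  rewrite /main_part nsT /= (take_nth 0 lt_mI).
  case def_t: (rcons _ _) => [|i t]; first by case: (take m I) def_t.
  rewrite -def_t last_rcons size_rcons size_takel ?(ltnW lt_mI) // subn1 /=.
  case: eqP => [ik|_]; rewrite -?leqNgt -?ltnNge; last first.
    by apply: leq_ltn_trans; rewrite leq_addr.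
  have [m0|m_gt0] := posnP m.
    have -> : nth 0 I m = k by move: def_t; rewrite m0 take0 => -[-> _].
    by rewrite m0 addn0 mul2n -addnn -[leqRHS]addn0 leq_add2l leqNgt k_gt0.
  by apply: leq_trans; rewrite -addn1 leq_add2l muln_gt0.
rewrite (drop_nth 0 lt_mI) /= kx.
have: sorted leq (drop m I) by exact: drop_sorted.
rewrite (drop_nth 0 lt_mI) /= (path_sortedE leq_trans) => /andP[/allP le_x _].
by apply/allP => i /le_x; apply: leq_trans.
Qed.

(* normal_form is the representation of I as a union of a main part and of
   dense parts of maximal dimensions. *)
Lemma normal_formP k I :
  0 < k -> nonsingular_part k I ->
  let: (I0, Is) := normal_form k I in
  [/\ I = I0 ++ flatten Is,
      main_part k I0,
      forall r, r <= size I -> main_part k (take r I) -> r <= size I0,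
      all (dense_part k) Is
    & sorted (fun b c => last 0 b + 3 != head 0 c) Is].
Proof.
move=> k_gt0 nsI; split.
- by rewrite flatten_blocks cat_take_drop.
- exact: main_dimP.
- by move=> r; rewrite size_takel ?main_dim_leq //; exact: main_dim_max.
- by apply: blocks_dense; exact: main_dim_gt.
- exact: blocks_maximal.
Qed.

Definition leading_parts (k : nat) (I : seq nat) : seq nat :=
  [seq head 0 b | b <- (normal_form k I).2].

(* Multisets are represented by nondecreasing sequences, so that J is a
   sub-multiset of I iff it is a subsequence of I. *)
Definition mdiff (I J : seq nat) : seq nat := foldl (fun s x => rem x s) I J.

Notation dpart := (seq nat * seq nat)%type.

Definition distinguished (k : nat) (d : dpart) : bool :=
  [&& k_partition k d.1, sorted leq d.2, subseq d.2 d.1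
    & strict (mdiff d.1 d.2)].

Definition ddim (d : dpart) : nat := size d.1 + size d.2.

(* D k n d means that d belongs to D(k, n). *)
Definition D (k n : nat) (d : dpart) : bool :=
  distinguished k d && (sumn d.1 == n).

Definition nonsingular (k : nat) (d : dpart) : bool :=
  [&& distinguished k d, nonsingular_part k d.1
    & all (mem (leading_parts k d.1)) d.2].

(* d' is one of the S_(a,b)(d). Parts that are not distinguished are those of
   mdiff d.1 d.2, and they are pairwise distinct. *)
Definition merge_step (d d' : dpart) : Prop :=
  exists x y : nat,
    [/\ x \in mdiff d.1 d.2, y \in mdiff d.1 d.2, x < y
      & d' = (sort leq (x + y :: rem y (rem x d.1)),
              sort leq (x + y :: d.2))].

Definition order_gen (k n : nat) (d' d : dpart) : Prop :=
  [/\ D k n d', D k n d, ddim d' = ddim d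
    & [\/ d'.1 = d.1 /\ ((d'.2 : seqlexi nat) < d.2)%O,
          [/\ d'.1 <> d.1, size d'.1 = size d.1
            & forall r, 1 <= r <= size d.1 - 1 ->
                sumn (take r d'.1) <= sumn (take r d.1)]
        | size d'.1 < size d.1 /\ clos_refl_trans _ merge_step d d']].

Definition dlt (k n : nat) : dpart -> dpart -> Prop :=
  clos_trans _ (order_gen k n).

Definition dle (k n : nat) (d' d : dpart) : Prop := dlt k n d' d \/ d' = d.

Local Open Scope ring_scope.

(* Among equal parts of I, the distinguished ones are put first: the choice is
   irrelevant, because delta_k(e_i) has even degree. *)
Fixpoint tau_factors (L : lie_algebra) (k : nat) (I J : seq nat) : seq chain :=
  match I with
  | [::] => [::]
  | i :: I' =>
      if i \in J then delta L k (e_ i) :: tau_factors L k I' (rem i J)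
      else e_ i :: tau_factors L k I' J
  end.

Definition tau_mon (L : lie_algebra) (k : nat) (d : dpart) : chain :=
  wedge_seq (tau_factors L k d.1 d.2).

Definition xi_mon (L : lie_algebra) (k : nat) (d : dpart) : chain :=
  let: (I0, Is) := normal_form k d.1 in
  wedge_seq (e_mon I0 ::
    [seq if head 0%N b \in d.2 then delta L k (e_mon b) else e_mon b
    | b <- Is]).

(* Main.v *)
(* Spanning is a straightening argument. If [(I; J)] is singular, then one of the
   following lowers it: two ordinary parts at distance at most 2 are merged by
   solving delta(e_m) = sum mu(b - a) e_a e_b for one term; an ordinary and a
   distinguished part, or two distinguished parts, that are too close are removed
   by a relation sum p(a) e_a delta(e_(m-a)) = 0, resp.
   sum q(a) delta(e_a) delta(e_(m-a)) = 0, where p or q vanishes at the unwanted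
   indices near m/2; and if the first distinguished part b lies in the main
   initial segment, after ordinary parts a_1 < ... < a_N, then e_a delta(e_b)
   lies in the span of the lower e_a' delta(e_b'). The last claim is proved after
   an injective Jacobi-Trudi map e_s |-> sum_pi sgn(pi) S[s_i - k - pi(i)] to
   symmetric arrays: it sends e_a delta(e_b) to Ef terms with a single leading
   one, and a determinant of the row relations sum_j rho(n, j) Ef(j, n - j, ...) = 0
   expresses that leading term by lower ones because its diagonal is nonzero.

   On a dense block, e_x delta(e_(x+3)) is a negative multiple of
   e_(x+3) delta(e_x) up to lower terms, so that delta(e_block) is a positive
   multiple of delta(e_lead) e_rest up to lower terms; hence the xi-monomials are
   triangular in the tau-monomials.

   Independence follows from spanning by counting: nonsingular distinguished
   partitions of n inject into the strict partitions of n. *)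

From Stdlib Require Import Relation_Operators Classical.
Require Import Defs.
From HB Require Import structures.
From mathcomp Require Import all_boot all_order all_algebra all_fingroup.
From mathcomp Require Import finmap zify ring lra.
From mathcomp.multinomials Require Import monalg.

Set Implicit Arguments.
Unset Strict Implicit.
Unset Printing Implicit Defensive.

Import Order.TTheory GRing.Theory Num.Theory.

Local Open Scope ring_scope.

(** * Linear spans and the wedge product *)

(** Both algebras are handled by one argument: the properties of [mu] that it uses are oddness, the
    values at 1 and 2, the addition formula [mu_chi], and the existence of weights p, q, rho with a
    cyclic identity. Only these are checked case by case, by polynomial identities for [W] and
    residue by residue for [sl2_tilde].

    The obstacle is the bound 2k + 3(q - 1) on main partitions, which relations between two parts
    cannot see. For N ordinary parts a, put m_i = a_i - i - k (i from 0) and t = b - 2k - 2N - 1.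
    The leading term of e_a delta(e_b) is then Ef(t, m), and the determinant that removes it has t +
    1 rows, so it fits into m exactly when b <= 2k + 3N. Its diagonal entries rho(M, l), with M the
    entry of m in row l plus l, are nonzero once 3l < 2M. Gaps of at least 3 give m_i >= a_0 - k +
    2i, so this fails only if l = 0, t = N - 1 and a_0 = k: the exceptional case in the definition
    of a main partition. *)

Section Span.
Variables (V : lmodType rat) (T : choiceType).
Implicit Types (P Q : T -> Prop) (f : T -> V) (x y : V).

Lemma lspan_gen P f t : P t -> lspan P f (f t).
Proof.
move=> Pt; exists [fset t]%fset, (fun=> 1); split; last by rewrite big_seq_fset1 scale1r.
by move=> u; rewrite inE => /eqP ->.
Qed.

Lemma lspan0 P f : lspan P f 0.
Proof. by exists fset0, (fun=> 0); split=> [t|]; rewrite ?inE // big_seq_fset0. Qed.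

Lemma lspanZ P f a x : lspan P f x -> lspan P f (a *: x).
Proof.
case=> s [c [Ps ->]]; exists s, (fun t => a * c t); split=> //.
by rewrite scaler_sumr; apply: eq_bigr => t _; rewrite scalerA.
Qed.

Lemma lspanD P f x y : lspan P f x -> lspan P f y -> lspan P f (x + y).
Proof.
case=> s [c [Ps ->]] [s' [c' [Ps' ->]]].
exists (s `|` s')%fset, (fun t => c t *+ (t \in s) + c' t *+ (t \in s')); split.
  by move=> t /fsetUP[/Ps|/Ps'].
under [RHS]eq_bigr do rewrite scalerDl.
rewrite big_split /=; congr (_ + _).
  rewrite -(big_fset_incl _ (fsubsetUl s s')); last first.
    by move=> t _ /negbTE ->; rewrite mulr0n scale0r.
  by apply: eq_big_seq => t ts; rewrite ts.
rewrite -(big_fset_incl _ (fsubsetUr s s')); last first.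
  by move=> t _ /negbTE ->; rewrite mulr0n scale0r.
by apply: eq_big_seq => t ts; rewrite ts.
Qed.

Lemma lspanN P f x : lspan P f x -> lspan P f (- x).
Proof. by rewrite -scaleN1r; apply: lspanZ. Qed.

Lemma lspan_sum P f (I : Type) (r : seq I) (C : pred I) (F : I -> V) :
  (forall i, C i -> lspan P f (F i)) -> lspan P f (\sum_(i <- r | C i) F i).
Proof. by move=> PF; apply: (big_ind _ (lspan0 P f) (@lspanD P f) PF). Qed.

End Span.

Lemma lspan_trans (V : lmodType rat) (T T' : choiceType) (P : T -> Prop) (f : T -> V)
    (Q : T' -> Prop) (g : T' -> V) x :
  (forall t, P t -> lspan Q g (f t)) -> lspan P f x -> lspan Q g x.
Proof.
move=> PQ [s [c [Ps ->]]]; rewrite big_seq; apply: lspan_sum => t ts.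
by apply/lspanZ/PQ/Ps.
Qed.

Lemma lspan_sub (V : lmodType rat) (T : choiceType) (P Q : T -> Prop) (f : T -> V) x : (forall t, P t -> Q t) -> lspan P f x -> lspan Q f x.
Proof. by move=> PQ; apply: lspan_trans => t /PQ; apply: lspan_gen. Qed.

Lemma lspan_map (V W : lmodType rat) (T T' : choiceType) (h : {linear V -> W})
    (P : T -> Prop) (f : T -> V) (Q : T' -> Prop) (g : T' -> W) x :
  (forall t, P t -> lspan Q g (h (f t))) -> lspan P f x -> lspan Q g (h x).
Proof.
move=> PQ [s [c [Ps ->]]]; rewrite linear_sum big_seq.
by apply: lspan_sum => t ts; rewrite linearZ; apply/lspanZ/PQ/Ps.
Qed.

Section LinearExtension.
Variables (K : choiceType) (V : lmodType rat) (F : K -> V).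

Definition lin_ext (x : {malg rat[K]}) : V := \sum_(A <- msupp x) x@_A *: F A.

Lemma lin_extw (s : {fset K}) x :
  (msupp x `<=` s)%fset -> lin_ext x = \sum_(A <- s) x@_A *: F A.
Proof.
move=> xs; rewrite /lin_ext (big_fset_incl _ xs) // => A _ Ax.
by rewrite mcoeff_outdom // scale0r.
Qed.

Lemma lin_ext_is_linear : linear lin_ext.
Proof.
move=> a x y; set s := (msupp x `|` msupp y)%fset.
have sx : (msupp x `<=` s)%fset by apply: fsubsetUl.
have sy : (msupp y `<=` s)%fset by apply: fsubsetUr.
rewrite (@lin_extw s (a *: x + y)) ?(lin_extw sx) ?(lin_extw sy); last first.
  apply: (fsubset_trans (msuppD_le _ _)); rewrite fsubUset sy andbT.
  exact: (fsubset_trans (msuppZ_le _ _)).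
rewrite scaler_sumr -big_split /=; apply: eq_bigr => A _.
by rewrite mcoeffD mcoeffZ scalerDl scalerA.
Qed.

HB.instance Definition _ :=
  GRing.isLinear.Build rat {malg rat[K]} V _ lin_ext lin_ext_is_linear.

Lemma lin_extU A : lin_ext << A >> = F A.
Proof. by rewrite /lin_ext msuppU oner_eq0 big_seq_fset1 mcoeffUU scale1r. Qed.

End LinearExtension.

Lemma malgEZ (K : choiceType) (x : {malg rat[K]}) :
  x = \sum_(A <- msupp x) x@_A *: << A >>.
Proof.
rewrite {1}[x]monalgE; apply: eq_bigr => A _; apply/malgP => B.
by rewrite mcoeffZ !mcoeffU; case: (A == B); rewrite ?mulr1 ?mulr0.
Qed.

Lemma malg_ind (K : choiceType) (P : {malg rat[K]} -> Prop) :
  P 0 -> (forall x y, P x -> P y -> P (x + y)) ->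
  (forall a x, P x -> P (a *: x)) -> (forall A, P << A >>) -> forall x, P x.
Proof.
move=> P0 PD PZ PU x; rewrite [x]malgEZ.
by apply: (big_ind P P0 PD) => A _; apply: PZ.
Qed.

Section Wedge.

Definition wedgel (y x : chain) : chain := lin_ext (fun A => lin_ext (wedge_set A) y) x.
Definition wedger (x y : chain) : chain := lin_ext (fun B => lin_ext (wedge_set^~ B) x) y.

HB.instance Definition _ y :=
  GRing.isLinear.Build rat chain chain _ (wedgel y) (lin_ext_is_linear _).
HB.instance Definition _ x :=
  GRing.isLinear.Build rat chain chain _ (wedger x) (lin_ext_is_linear _).

(* Sealed, so that unification does not unfold it into a double sum. *)
Definition wprod : chain -> chain -> chain := locked wedge.

Lemma wprodE : wedge = wprod.
Proof. by rewrite /wprod -lock. Qed.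

Lemma wedgelE y x : wprod x y = wedgel y x.
Proof.
rewrite -wprodE /wedge /wedgel /lin_ext; apply: eq_bigr => A _.
by rewrite scaler_sumr; apply: eq_bigr => B _; rewrite scalerA.
Qed.

Lemma wedgerE x y : wprod x y = wedger x y.
Proof.
rewrite -wprodE /wedge /wedger /lin_ext exchange_big; apply: eq_bigr => A _.
by rewrite scaler_sumr; apply: eq_bigr => B _; rewrite scalerA mulrC.
Qed.

Lemma wedgeDl x y z : wprod (x + y) z = wprod x z + wprod y z.
Proof. by rewrite !wedgelE linearD. Qed.
Lemma wedgeDr x y z : wprod x (y + z) = wprod x y + wprod x z.
Proof. by rewrite !wedgerE linearD. Qed.
Lemma wedgeZl a x y : wprod (a *: x) y = a *: wprod x y.
Proof. by rewrite !wedgelE linearZ. Qed.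
Lemma wedgeZr a x y : wprod x (a *: y) = a *: wprod x y.
Proof. by rewrite !wedgerE linearZ. Qed.
Lemma wedgeNl x y : wprod (- x) y = - wprod x y.
Proof. by rewrite !wedgelE linearN. Qed.
Lemma wedgeNr x y : wprod x (- y) = - wprod x y.
Proof. by rewrite !wedgerE linearN. Qed.
Lemma wedge0l y : wprod 0 y = 0.
Proof. by rewrite wedgelE linear0. Qed.
Lemma wedge0r x : wprod x 0 = 0.
Proof. by rewrite wedgerE linear0. Qed.
Lemma wedge_sumr (I : Type) (r : seq I) (C : pred I) (F : I -> chain) x :
  wprod x (\sum_(i <- r | C i) F i) = \sum_(i <- r | C i) wprod x (F i).
Proof. by rewrite wedgerE linear_sum; apply: eq_bigr => i _; rewrite wedgerE. Qed.

Lemma wedgeUU A B : wprod << A >> << B >> = wedge_set A B.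
Proof. by rewrite wedgelE /wedgel !lin_extU. Qed.

Definition inversions (A B : {fset nat}) : nat :=
  (\sum_(a <- A) \sum_(b <- B) (b < a))%N.

Lemma wedge_setE A B : wedge_set A B =
  if [disjoint A & B]%fset then (-1) ^+ inversions A B *: << (A `|` B)%fset >> else 0.
Proof.
rewrite /wedge_set; suff -> : (\sum_(a <- A) count (fun b => b < a)%N B)%N = inversions A B by [].
by apply: eq_bigr => a _; rewrite -sum1_count big_mkcond; apply: eq_bigr => b _; case: ltnP.
Qed.

Lemma big_fsetU_disj (F : nat -> nat) (A B : {fset nat}) : [disjoint A & B]%fset ->
  (\sum_(i <- (A `|` B)%fset) F i = \sum_(i <- A) F i + \sum_(i <- B) F i)%N.
Proof.
move=> /fdisjointP dAB; rewrite -big_cat; apply: perm_big; apply: uniq_perm => [||i].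
- exact: fset_uniq.
- rewrite cat_uniq !fset_uniq andbT /=; apply/hasPn => i iB.
  by apply/negP => /dAB; rewrite iB.
- by rewrite mem_cat in_fsetU.
Qed.

Lemma inversionsUl A B C : [disjoint A & B]%fset ->
  inversions (A `|` B)%fset C = (inversions A C + inversions B C)%N.
Proof. by move=> dAB; rewrite /inversions big_fsetU_disj. Qed.

Lemma inversionsUr A B C : [disjoint B & C]%fset ->
  inversions A (B `|` C)%fset = (inversions A B + inversions A C)%N.
Proof.
by move=> dBC; rewrite /inversions -big_split /=; apply: eq_bigr => a _; rewrite big_fsetU_disj.
Qed.

Lemma scale_if (V : lmodType rat) (a c : rat) (b : bool) (x : V) :
  a *: (if b then c *: x else 0) = if b then (a * c) *: x else 0.
Proof. by case: b; rewrite ?scalerA ?scaler0. Qed.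

Lemma eq_if (X : Type) (b : bool) (x y z : X) :
  (b -> x = y) -> (if b then x else z) = (if b then y else z).
Proof. by case: b => // ->. Qed.

Lemma wedgeUA A B C :
  wprod << A >> (wprod << B >> << C >>) = wprod (wprod << A >> << B >>) << C >>.
Proof.
have -> : wprod << A >> (wprod << B >> << C >>) =
  if [&& [disjoint A & B]%fset, [disjoint A & C]%fset & [disjoint B & C]%fset]
  then (-1) ^+ (inversions B C + inversions A (B `|` C)%fset) *: << (A `|` (B `|` C))%fset >>
  else 0.
  rewrite (wedgeUU B) wedge_setE andbA andbC; case: [disjoint B & C]%fset; last exact: wedge0r.
  by rewrite wedgeZr wedgeUU wedge_setE scale_if fdisjointXU exprD.
have -> : wprod (wprod << A >> << B >>) << C >> =
  if [&& [disjoint A & B]%fset, [disjoint A & C]%fset & [disjoint B & C]%fset]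
  then (-1) ^+ (inversions A B + inversions (A `|` B)%fset C) *: << (A `|` B `|` C)%fset >>
  else 0.
  rewrite (wedgeUU A) wedge_setE; case: [disjoint A & B]%fset; last exact: wedge0l.
  by rewrite wedgeZl wedgeUU wedge_setE scale_if fdisjointUX exprD.
apply: eq_if => /and3P[dAB dAC dBC].
have -> : (inversions B C + inversions A (B `|` C)%fset =
          inversions A B + inversions (A `|` B)%fset C)%N.
  by rewrite (inversionsUl _ dAB) (inversionsUr _ dBC) addnC -addnA.
rewrite fsetUA; exact: erefl.
Qed.

Lemma wedgeA x y z : wprod x (wprod y z) = wprod (wprod x y) z.
Proof.
elim/malg_ind: x => [|x x' IH IH'|a x IH|A]; rewrite ?wedge0l ?wedgeDl ?IH ?IH' ?wedgeZl ?IH //.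
elim/malg_ind: y => [|x x' IH IH'|a x IH|B];
  rewrite ?(wedge0l, wedge0r) ?(wedgeDl, wedgeDr) ?IH ?IH' ?(wedgeZl, wedgeZr) ?IH //.
elim/malg_ind: z => [|x x' IH IH'|a x IH|C];
  rewrite ?(wedge0l, wedge0r) ?(wedgeDl, wedgeDr) ?IH ?IH' ?(wedgeZl, wedgeZr) ?IH //.
exact: wedgeUA.
Qed.

Definition vac : chain := << fset0 >>.

Lemma wedge1l x : wprod vac x = x.
Proof.
elim/malg_ind: x => [|x y IHx IHy|a x IH|A]; rewrite ?wedge0r ?wedgeDr ?IHx ?IHy ?wedgeZr ?IH //.
by rewrite wedgeUU wedge_setE fdisjoint0X fset0U /inversions big_seq_fset0 scale1r.
Qed.

Lemma wedge1r x : wprod x vac = x.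
Proof.
elim/malg_ind: x => [|x y IHx IHy|a x IH|A]; rewrite ?wedge0l ?wedgeDl ?IHx ?IHy ?wedgeZl ?IH //.
rewrite wedgeUU wedge_setE fdisjointX0 fsetU0 /inversions.
by rewrite big1 ?scale1r // => a _; rewrite big_seq_fset0.
Qed.

Lemma wedge_ee x : wprod (e_ x) (e_ x) = 0.
Proof. by rewrite wedgeUU wedge_setE fdisjoint1X inE eqxx. Qed.

Lemma wedge_eC x y : wprod (e_ x) (e_ y) = - wprod (e_ y) (e_ x).
Proof.
have [->|xy] := eqVneq x y; first by rewrite wedge_ee oppr0.
rewrite !wedgeUU !wedge_setE !fdisjoint1X !inE [y == x]eq_sym xy fsetUC.
rewrite -scaleNr.
have -> : inversions [fset x]%fset [fset y]%fset = (y < x)%N :> nat by rewrite /inversions !big_seq_fset1.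
have -> : inversions [fset y]%fset [fset x]%fset = (x < y)%N :> nat by rewrite /inversions !big_seq_fset1.
suff -> : (-1) ^+ (y < x)%N = - (-1) ^+ (x < y)%N :> rat by [].
by case: ltngtP xy.
Qed.

Lemma wedge_seq_cons x xs : wedge_seq (x :: xs) = wprod x (wedge_seq xs).
Proof. by rewrite -wprodE. Qed.

Lemma wedge_seq_nil : wedge_seq [::] = vac.
Proof. by []. Qed.

Lemma wedge_seq_cat xs ys : wedge_seq (xs ++ ys) = wprod (wedge_seq xs) (wedge_seq ys).
Proof. elim: xs => [|x xs IH]; first by rewrite cat0s wedge1l.
by rewrite cat_cons !wedge_seq_cons IH wedgeA. Qed.

Lemma e_mon_cons x s : e_mon (x :: s) = wprod (e_ x) (e_mon s).
Proof. exact: wedge_seq_cons. Qed.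

Lemma e_mon_cat s t : e_mon (s ++ t) = wprod (e_mon s) (e_mon t).
Proof. by rewrite /e_mon map_cat wedge_seq_cat. Qed.

Lemma e_mon1 x : e_mon [:: x] = e_ x.
Proof. by rewrite e_mon_cons wedge1r. Qed.

Lemma e_mon_strict s : sorted ltn s -> e_mon s = << [fset x in s]%fset >>.
Proof.
elim: s => [|x s IH] /=.
  by move=> _; suff -> : [fset x in [::]]%fset = fset0 :> {fset nat} by []; apply/fsetP => y; rewrite !inE.
rewrite path_sortedE; last exact: ltn_trans.
case/andP=> /allP xs /IH; rewrite e_mon_cons => ->.
have xNs : x \notin s by apply/negP => /xs; rewrite /= ltnn.
rewrite wedgeUU wedge_setE fdisjoint1X in_fset xNs.
have -> : inversions [fset x]%fset [fset x in s]%fset = 0%N.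
  rewrite /inversions big_seq_fset1 big1_seq // => y; rewrite in_fset /= => /xs /= xy.
  by rewrite ltnNge ltnW.
rewrite expr0 scale1r.
suff -> : ([fset x] `|` [fset y in s] = [fset y in x :: s])%fset by [].
by apply/fsetP => y; rewrite !inE.
Qed.

End Wedge.

(** * Structure constants *)

(** Factoring [eps] through ['F_3] turns identities on it into finite checks by [F3_ind]. *)
Definition eps3 (u : 'F_3) : int := if u == 2%:R then -1 else (nat_of_ord u)%:Z.

Lemma eps_F3 (z : int) : eps z = eps3 z%:~R.
Proof.
rewrite /eps /eps3; have {3 4}-> := divz_eq z 3.
have -> : ((z %/ 3)%Z * 3 + (z %% 3)%Z)%:~R = (z %% 3)%Z%:~R :> 'F_3.
  by rewrite rmorphD rmorphM /= [X in _ * X](_ : _ = 0) ?mulr0 ?add0r //; apply/val_inj.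
have : 0 <= (z %% 3)%Z by rewrite modz_ge0.
have : (z %% 3)%Z < 3 by rewrite ltz_pmod.
by case: (z %% 3)%Z => [[|[|[|n]]]|n].
Qed.

Lemma F3_ind (P : 'F_3 -> Prop) : P 0 -> P 1 -> P 2%:R -> forall u, P u.
Proof.
move=> P0 P1 P2 [[|[|[|n]]] lt_n3] //.
- by rewrite (_ : Ordinal _ = 0) //; apply/val_inj.
- by rewrite (_ : Ordinal _ = 1) //; apply/val_inj.
- by rewrite (_ : Ordinal _ = 2%:R) //; apply/val_inj.
Qed.

Lemma eqF3 (a b : nat) : (a == b %[mod 3]) = (a%:R == b%:R :> 'F_3).
Proof. by rewrite -val_eqE /= !val_Fp_nat. Qed.

Ltac eps3_compute :=
  repeat match goal with |- context [eps3 ?u] =>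
    first [ rewrite (_ : eps3 u = 0); last by []
          | rewrite (_ : eps3 u = 1); last by []
          | rewrite (_ : eps3 u = -1); last by [] ]
  end.

Section StructureConstants.
Variable L : lie_algebra.

Lemma muN z : mu L (- z) = - mu L z.
Proof.
case: L => /=; first by rewrite mulrNz.
rewrite !eps_F3 rmorphN /=; elim/F3_ind: (z%:~R); by [].
Qed.

Lemma mu0 : mu L 0 = 0. Proof. by case: L. Qed.

(** Twice a cosine, if [mu] is read as a sine: for [sl2_tilde], mu(z) = 2 sin(2 pi z / 3) / sqrt 3
    and chi(z) = 2 cos(2 pi z / 3); for [W] the degenerate case mu(z) = z, chi(z) = 2. [mu_chi] is
    the addition formula. *)
Definition chi (z : int) : rat := mu L (z + 1) - mu L (z - 1).

Lemma mu_chi z g : mu L (z + g) + mu L (g - z) = mu L g * chi z.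
Proof.
rewrite /chi; case: L => /=; first by rewrite !(rmorphD, rmorphN) /=; ring.
rewrite !eps_F3 !(rmorphD, rmorphN) /=.
by elim/F3_ind: (z%:~R); elim/F3_ind: (g%:~R).
Qed.

(* By antisymmetry, this is what the sum of [p a *: e_a * delta e_(m - a)] needs
   in order to vanish. *)
Definition cyclic_ed m (p : nat -> rat) : Prop := forall a x y, (a + x + y)%N = m ->
  p a * mu L (y%:Z - x%:Z) + p x * mu L (a%:Z - y%:Z) + p y * mu L (x%:Z - a%:Z) = 0.

(** For [W], constant and linear p satisfy the identity, while a^2 and a^3 give the Vandermonde
    product of a, x, y, the latter times m; so a monic cubic works when its roots add up to m. For
    [sl2_tilde] with m prime to 3, exactly two of the residues of a, x, y agree, and any function of
    the residue works. If 3 divides m, the residues are all equal, and [mu] vanishes, or all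
    distinct, and the identity reads p(a) + p(x) + p(y) = 0; hence a - s(a mod 3), where the three
    values of s add up to m. *)
Lemma cyclic_ed_ex m s0 s1 s2 : (s0 + s1 + s2 != m)%N ->
  s0 != s1 %[mod 3] -> s0 != s2 %[mod 3] -> s1 != s2 %[mod 3] ->
  exists p, [/\ cyclic_ed m p, p s0 != 0, p s1 = 0 & p s2 = 0].
Proof.
rewrite !eqF3 => m_s s01 s02 s12.
have m_s' : s0%:R + s1%:R + s2%:R - m%:R != 0 :> rat by rewrite subr_eq0 -!natrD eqr_nat.
rewrite /cyclic_ed; case: L => /=.
  exists (fun a => (a%:R - s1%:R) * (a%:R - s2%:R) * (a%:R - (m%:R - s1%:R - s2%:R))).
  split; try ring.
    move=> a x y <-; rewrite !(rmorphD, rmorphN, natrD) /= -!pmulrn; ring.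
  rewrite !mulf_neq0 ?subr_eq0 //.
  - by apply: contra s01 => /eqP/eqP; rewrite eqr_nat => /eqP ->.
  - by apply: contra s02 => /eqP/eqP; rewrite eqr_nat => /eqP ->.
  - by rewrite -subr_eq0; apply: contra m_s' => /eqP <-; apply/eqP; ring.
have [m0|m_n0] := eqVneq (m%:R : 'F_3) 0.
  pose s (u : 'F_3) : rat := if u == s1%:R then s1%:R else if u == s2%:R then s2%:R
                             else m%:R - s1%:R - s2%:R.
  exists (fun a => a%:R - s a%:R); rewrite /s eqxx (negbTE s01) (negbTE s02).
  rewrite [s2%:R == _]eq_sym (negbTE s12) eqxx; split; try ring.
    move=> a x y axy; have ry : (y%:R : 'F_3) = - a%:R - x%:R.
      by apply/eqP; rewrite -subr_eq0 -m0 -axy !natrD; apply/eqP; ring.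
    have rm : (m%:R : rat) = a%:R + x%:R + y%:R by rewrite -axy !natrD.
    rewrite !eps_F3 !(rmorphD, rmorphN) /= -!pmulrn ry.
    move: s12; elim/F3_ind: (s1%:R : 'F_3); elim/F3_ind: (s2%:R : 'F_3) => //= _;
    elim/F3_ind: (a%:R : 'F_3); elim/F3_ind: (x%:R : 'F_3) => /=; rewrite ?rm; eps3_compute; ring.
  by apply: contra m_s' => /eqP E; apply/eqP; rewrite -[RHS]E; ring.
exists (fun a => (a%:R == s0%:R :> 'F_3)%:R).
rewrite eqxx [s1%:R == _]eq_sym (negbTE s01) [s2%:R == _]eq_sym (negbTE s02).
split=> // a x y axy; rewrite !eps_F3 !(rmorphD, rmorphN) /= -!pmulrn.
have -> : (y%:R : 'F_3) = m%:R - a%:R - x%:R by rewrite -axy !natrD; ring.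
by move: m_n0; elim/F3_ind: (m%:R : 'F_3); elim/F3_ind: (s0%:R : 'F_3) => //= _;
    elim/F3_ind: (a%:R : 'F_3); elim/F3_ind: (x%:R : 'F_3).
Qed.

(** These are the weights of [cyclic_ed_ex] for the zeros c and c + 1; as m = 2c + 1, the third
    root, or third value of s, is 0. Equal signs at c - 1 and c + 2 are the source of the negative
    multiple in [tri_pair]. *)
Lemma cyclic_ed_block c : (1 < c)%N -> exists p,
  [/\ cyclic_ed c.*2.+1 p, p c = 0, p c.+1 = 0, 0 < p c.-1 & 0 < p c.+2].
Proof.
case: c => // c c_gt0; rewrite /cyclic_ed; set m := c.+1.*2.+1.
have rmE : m%:R = 2%:R * c%:R + 3%:R :> rat by rewrite /m -natrM -natrD; congr (_%:R); lia.
have c_gt0' : 0 < c%:R :> rat by rewrite ltr0n; lia.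
case: L => /=.
  exists (fun a => (a%:R - c.+1%:R) * (a%:R - c.+2%:R) * a%:R).
  rewrite -!natr1; split; try ring; try nra.
  move=> a x y axy; rewrite !(rmorphD, rmorphN) /= -!pmulrn.
  have -> : (y%:R : rat) = 2%:R * c%:R + 3%:R - a%:R - x%:R.
    by rewrite -rmE -axy !natrD; ring.
  ring.
have [m0|m_n0] := eqVneq (m%:R : 'F_3) 0.
  have c0 : c%:R = 0 :> 'F_3.
    move: m0; rewrite (_ : m%:R = 2%:R * c%:R) //; last first.
      rewrite /m (_ : c.+1.*2.+1 = 2 * c + 3)%N; last lia.
      by rewrite natrD natrM [3%:R](_ : _ = 0) ?addr0 //; apply/val_inj.
    by elim/F3_ind: (c%:R).
  pose s (u : 'F_3) : rat := if u == 1 then c.+1%:R else if u == 2%:R then c.+2%:R else 0.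
  exists (fun a => a%:R - s a%:R).
  have -> : (c.+1%:R = 1 :> 'F_3) by rewrite -natr1 c0 add0r.
  have -> : (c.+2%:R = 2%:R :> 'F_3) by rewrite -!natr1 c0 add0r.
  have -> : (c.+3%:R = 0 :> 'F_3) by rewrite -!natr1 c0; apply/val_inj.
  rewrite /= c0 /s /= -!natr1; split; try ring; try lra.
  move=> a x y axy; have ry : (y%:R : 'F_3) = - a%:R - x%:R.
    by apply/eqP; rewrite -subr_eq0 -m0 -axy !natrD; apply/eqP; ring.
  have ryr : (y%:R : rat) = 2%:R * c%:R + 3%:R - a%:R - x%:R.
    by rewrite -rmE -axy !natrD; ring.
  rewrite !eps_F3 !(rmorphD, rmorphN) /= -!pmulrn ry ryr.
  by elim/F3_ind: (a%:R : 'F_3); elim/F3_ind: (x%:R : 'F_3) => /=; eps3_compute; ring.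
exists (fun a => (a%:R == c%:R :> 'F_3)%:R).
have -> : (c.+1%:R == c%:R :> 'F_3) = false by rewrite -natr1; elim/F3_ind: (c%:R).
have -> : (c.+2%:R == c%:R :> 'F_3) = false by rewrite -!natr1; elim/F3_ind: (c%:R).
have -> : (c.+3%:R == c%:R :> 'F_3) by rewrite -!natr1; elim/F3_ind: (c%:R).
rewrite eqxx; split=> // a x y axy; rewrite !eps_F3 !(rmorphD, rmorphN) /= -!pmulrn.
have -> : (y%:R : 'F_3) = m%:R - a%:R - x%:R by rewrite -axy !natrD; ring.
by move: m_n0; elim/F3_ind: (m%:R : 'F_3); elim/F3_ind: (c%:R : 'F_3) => //= _;
    elim/F3_ind: (a%:R : 'F_3); elim/F3_ind: (x%:R : 'F_3).
Qed.

Definition cyclic_dd m (q : nat -> rat) : Prop := forall x y u v, (x + y + u + v)%N = m ->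
  q (x + y)%N * mu L (y%:Z - x%:Z) * mu L (v%:Z - u%:Z) +
  q (x + u)%N * mu L (u%:Z - x%:Z) * mu L (y%:Z - v%:Z) +
  q (x + v)%N * mu L (v%:Z - x%:Z) * mu L (u%:Z - y%:Z) = 0.

(* The relation is meant for the sum of [q a *: delta e_a * delta e_b], a + b = m,
   whose terms (s, t) and (t, s) are equal, hence the two non-vanishing values. *)
Lemma cyclic_dd_ex m s t s' t' : (s + t)%N = m -> (s' + t')%N = m -> s' != s -> s' != t ->
  s != s' %[mod 3] -> t != s' %[mod 3] ->
  exists q, [/\ cyclic_dd m q, q s != 0, q t = q s & q s' = 0 /\ q t' = 0].
Proof.
rewrite !eqF3 => st s't' ss' ts' s3 t3; rewrite /cyclic_dd.
have [rt rt'] : t%:R = m%:R - s%:R :> rat /\ t'%:R = m%:R - s'%:R :> rat.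
  by rewrite -{1}st -s't' !natrD; split; ring.
case: L => /=.
  (* The identity holds for all combinations of 1, where it is the Pluecker relation, and a(m - a);
     this one has the roots s' and t'. *)
  exists (fun a => (a%:R - s'%:R) * (m%:R - a%:R - s'%:R)); split.
  - move=> x y u v <-; rewrite !(rmorphD, rmorphN, natrD) /= -!pmulrn; ring.
  - rewrite mulf_neq0 ?subr_eq0 ?eqr_nat 1?eq_sym //.
    by rewrite -rt eqr_nat.
  - rewrite rt; ring.
  - rewrite rt'; split; ring.
exists (fun a => ((a%:R == s%:R :> 'F_3) || (a%:R == t%:R :> 'F_3))%:R).
have rm : (t%:R : 'F_3) = m%:R - s%:R by rewrite -st natrD; ring.
have rm' : (t'%:R : 'F_3) = m%:R - s'%:R by rewrite -s't' natrD; ring.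
rewrite !eqxx orbT; split=> //.
  move=> x y u v xyuv; rewrite !eps_F3 !(rmorphD, rmorphN) /= -!pmulrn rm.
  rewrite -xyuv !natrD.
  elim/F3_ind: (x%:R : 'F_3); elim/F3_ind: (y%:R : 'F_3); elim/F3_ind: (u%:R : 'F_3);
  elim/F3_ind: (v%:R : 'F_3); elim/F3_ind: (s%:R : 'F_3) => /=; by [].
move: s3 t3; rewrite rm rm'; elim/F3_ind: (m%:R); elim/F3_ind: (s%:R); elim/F3_ind: (s'%:R) => //=.
Qed.

End StructureConstants.

(** * Exterior algebras by generators and relations *)

Section Alternating.

Definition alternating (V : lmodType rat) (h : seq nat -> V) : Prop :=
  forall u x y v, h (u ++ x :: y :: v) = - h (u ++ y :: x :: v).

Lemma alternating_cons (V : lmodType rat) (h : seq nat -> V) x :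
  alternating h -> alternating (fun s => h (x :: s)).
Proof. by move=> ah u y z v; rewrite -!cat_cons ah. Qed.

Lemma alternating_sort_cons x t : sorted leq t ->
  exists b : bool, forall (V : lmodType rat) (h : seq nat -> V), alternating h ->
    h (x :: t) = (-1) ^+ b *: h (sort leq (x :: t)).
Proof.
elim: t x => [|y t IH] x st; first by exists false => V h _; rewrite scale1r.
have [xy|yx] := leqP x y.
  exists false => V h _; rewrite scale1r sorted_sort //=; first exact: leq_trans.
  by rewrite xy.
have [|b hb] := IH x; first exact: path_sorted st.
exists (~~ b) => V h ah; rewrite (ah [::]) /= (hb _ _ (alternating_cons y ah)).
have -> : sort leq [:: x, y & t] = y :: sort leq (x :: t).
  apply: (sorted_eq leq_trans anti_leq).
  - exact: (sort_sorted leq_total).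
  - have pe : perm_eq (sort leq (x :: t)) (x :: t) by rewrite perm_sort.
    rewrite /= path_sortedE; last exact: leq_trans.
    rewrite (sort_sorted leq_total) andbT (perm_all _ pe) /= ltnW //=.
    by move: st; rewrite /= path_sortedE; [case/andP | exact: leq_trans].
  - rewrite perm_sort perm_sym.
    apply: (perm_trans (y := y :: x :: t)); first by rewrite perm_cons perm_sort.
    exact: (permEl (perm_catCA [:: y] [:: x] t)).
by rewrite -scaleNr; case: b {hb}; rewrite ?expr0 ?expr1 ?opprK.
Qed.

(** The sign is chosen before [V] and [h], so that two alternating functions can be compared on the
    same sequence, as in [chain_univ]. *)
Lemma alternating_sort s : exists b : bool,
  forall (V : lmodType rat) (h : seq nat -> V), alternating h ->
    h s = (-1) ^+ b *: h (sort leq s).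
Proof.
elim: s => [|x s [b hb]]; first by exists false => V h _; rewrite scale1r.
have [b' hb'] := alternating_sort_cons x (sort_sorted leq_total s).
exists (b (+) b') => V h ah.
rewrite (hb _ _ (alternating_cons x ah)) (hb' _ _ ah) scalerA signr_addb.
suff -> : sort leq (x :: sort leq s) = sort leq (x :: s) by [].
by apply/(perm_sortP leq_total leq_trans anti_leq); rewrite perm_cons perm_sort.
Qed.

Lemma alternating_swap (V : lmodType rat) (h : seq nat -> V) s t :
  alternating h -> perm_eq s t -> exists b : bool, h s = (-1) ^+ b *: h t.
Proof.
move=> ah st; have [b hb] := alternating_sort s; have [b' hb'] := alternating_sort t.
exists (b (+) b'); rewrite (hb _ _ ah) (hb' _ _ ah) scalerA signr_addb -mulrA.
have -> : sort leq s = sort leq t by apply/(perm_sortP leq_total leq_trans anti_leq).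
by rewrite -expr2 sqrr_sign mulr1.
Qed.

Lemma alternating_dup (V : lmodType rat) (h : seq nat -> V) u x v :
  alternating h -> h (u ++ x :: x :: v) = 0.
Proof.
move=> ah; have := ah u x x v => /eqP; rewrite -subr_eq0 opprK -mulr2n -scaler_nat.
by rewrite scaler_eq0 => /orP[] // /eqP.
Qed.

Lemma alternating_nuniq (V : lmodType rat) (h : seq nat -> V) s :
  alternating h -> ~~ uniq s -> h s = 0.
Proof.
move=> ah; elim: s h ah => // x s IH h ah /=; rewrite negb_and negbK => /orP[xs|nu].
  have /perm_to_rem ps := xs.
  have pe : perm_eq (x :: s) ([::] ++ x :: x :: rem x s) by rewrite /= perm_cons.
  by have [b ->] := alternating_swap ah pe; rewrite alternating_dup // scaler0.
exact: (IH _ (alternating_cons x ah) nu).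
Qed.

End Alternating.

Section FiniteSums.
Variable A : lmodType rat.
Implicit Types (a i m : nat).

Lemma big_nat_support k' i M (F : nat -> A) : (i < M)%N ->
  (forall a, (a < k')%N || (i < a)%N -> F a = 0) ->
  \sum_(0 <= a < M) F a = \sum_(k' <= a < i.+1) F a.
Proof.
move=> iM F0; have [ki|ik] := leqP k' i.+1; last first.
  rewrite [RHS]big_geq ?(ltnW ik) // big_nat big1 // => a /andP[_ aM]; apply: F0.
  by have [//|ka] := ltnP a k'; rewrite (leq_trans (ltnW ik) ka) ?orbT.
rewrite (@big_cat_nat _ _ _ k') //=; last exact: leq_trans ki _.
rewrite (@big_cat_nat _ _ _ i.+1 k') //= big_nat big1 ?add0r; last first.
  by move=> a /andP[_ ak]; apply: F0; rewrite ak.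
by rewrite [X in _ + X]big_nat [X in _ + X]big1 ?addr0 // => a /andP[ia _]; apply: F0; rewrite ia orbT.
Qed.

Lemma rot3_sum (M : nat) (F : nat -> nat -> nat -> A) :
  \sum_(0 <= x < M) \sum_(0 <= y < M) \sum_(0 <= z < M) F x y z =
  \sum_(0 <= x < M) \sum_(0 <= y < M) \sum_(0 <= z < M) F y z x.
Proof.
rewrite [RHS]exchange_big_nat; apply: eq_bigr => x _.
by rewrite [RHS]exchange_big_nat.
Qed.

(** Rotating the indices preserves the box and the constraint, so three times the sum is the sum of
    G against the cyclic sums of c, all of which vanish. *)
Lemma cyclic_sum0 (m M : nat) (c : nat -> nat -> nat -> rat) (G : nat -> nat -> nat -> A) :
  (forall x y z, G x y z = G y z x) ->
  (forall x y z, (x + y + z)%N = m -> c x y z + c y z x + c z x y = 0) ->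
  \sum_(0 <= x < M) \sum_(0 <= y < M) \sum_(0 <= z < M)
    (if (x + y + z == m)%N then c x y z *: G x y z else 0) = 0.
Proof.
move=> Gr c0; pose F x y z := if (x + y + z == m)%N then c x y z *: G x y z else 0.
pose S (H : nat -> nat -> nat -> A) :=
  \sum_(0 <= x < M) \sum_(0 <= y < M) \sum_(0 <= z < M) H x y z.
have e1 : S F = S (fun x y z => F y z x) by apply: rot3_sum.
have e2 : S F = S (fun x y z => F z x y) by rewrite e1 [LHS]rot3_sum.
rewrite -/(S F); suff : 3%:R *: S F = 0 by move/eqP; rewrite scaler_eq0 => /orP[] // /eqP.
rewrite (_ : 3%:R *: S F = S F + S F + S F); last by rewrite scaler_nat 2!mulrSr mulr1n.
rewrite {2}e1 {2}e2 /S -!big_split /=; apply: big1 => x _.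
rewrite -!big_split; apply: big1 => y _; rewrite -!big_split; apply: big1 => z _ /=.
have e3 : (y + z + x = x + y + z)%N by rewrite addnC addnA.
have e4 : (z + x + y = x + y + z)%N by rewrite -addnA addnC.
rewrite /F e3 e4.
case: eqP => [xyz|_]; last by rewrite !addr0.
by rewrite -[G z x y]Gr -[G y z x]Gr -!scalerDl c0 ?scale0r.
Qed.

End FiniteSums.

(** The straightening relies only on these axioms; they are instantiated once, by [chain_ext]. The
    universal property is what produces the Jacobi-Trudi map in [rel_main]. *)
Record exterior := Exterior {
  ext_sort :> lmodType rat;
  ext_mul : ext_sort -> ext_sort -> ext_sort;
  ext_one : ext_sort;
  ext_gen : nat -> ext_sort;
  ext_linl : forall y, linear (ext_mul^~ y);
  ext_linr : forall x, linear (ext_mul x);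
  ext_mulA : forall x y z, ext_mul x (ext_mul y z) = ext_mul (ext_mul x y) z;
  ext_mul1 : forall x, ext_mul ext_one x = x;
  ext_1mul : forall x, ext_mul x ext_one = x;
  ext_genC : forall i j,
    ext_mul (ext_gen i) (ext_gen j) = - ext_mul (ext_gen j) (ext_gen i);
  ext_univ : forall (V : lmodType rat) (h : seq nat -> V), alternating h ->
    exists f : {linear ext_sort -> V},
      forall s, f (foldr ext_mul ext_one [seq ext_gen i | i <- s]) = h s }.

Section Exterior.
Variables (A : exterior) (L : lie_algebra) (k : nat).
Implicit Types (a b d i j m : nat) (I K J : seq nat).

Local Notation "x ** y" := (@ext_mul A x y) (at level 40, left associativity).
Local Notation one := (ext_one A).
Local Notation gen := (@ext_gen A).

Definition mull (y : A) : A -> A := fun x => x ** y.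
Definition mulr (x : A) : A -> A := ext_mul x.

HB.instance Definition _ y := GRing.isLinear.Build rat A A _ (mull y) (ext_linl y).
HB.instance Definition _ x := GRing.isLinear.Build rat A A _ (mulr x) (ext_linr x).

Lemma emulDl (x y z : A) : (x + y) ** z = x ** z + y ** z. Proof. exact: (linearD (mull z)). Qed.
Lemma emulDr (x y z : A) : x ** (y + z) = x ** y + x ** z. Proof. exact: (linearD (mulr x)). Qed.
Lemma emulZl (c : rat) (x y : A) : (c *: x) ** y = c *: (x ** y). Proof. exact: (linearZ_LR (mull y)). Qed.
Lemma emulZr (c : rat) (x y : A) : x ** (c *: y) = c *: (x ** y). Proof. exact: (linearZ_LR (mulr x)). Qed.
Lemma emulNl (x y : A) : (- x) ** y = - (x ** y). Proof. exact: (linearN (mull y)). Qed.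
Lemma emulNr (x y : A) : x ** (- y) = - (x ** y). Proof. exact: (linearN (mulr x)). Qed.
Lemma emul0l (x : A) : 0 ** x = 0. Proof. exact: (linear0 (mull x)). Qed.
Lemma emul0r (x : A) : x ** 0 = 0. Proof. exact: (linear0 (mulr x)). Qed.
Lemma emul_suml (X : Type) (r : seq X) (C : pred X) (F : X -> A) (y : A) :
  (\sum_(i <- r | C i) F i) ** y = \sum_(i <- r | C i) F i ** y.
Proof. exact: (linear_sum (mull y)). Qed.
Lemma emul_sumr (X : Type) (r : seq X) (C : pred X) (F : X -> A) (y : A) :
  y ** (\sum_(i <- r | C i) F i) = \sum_(i <- r | C i) y ** F i.
Proof. exact: (linear_sum (mulr y)). Qed.

Definition eprod (s : seq A) : A := foldr (@ext_mul A) one s.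
Definition emon I : A := eprod [seq gen i | i <- I].

Lemma eprod_cat s t : eprod (s ++ t) = eprod s ** eprod t.
Proof. by elim: s => [|x s IH] /=; rewrite ?ext_mul1 // IH ext_mulA. Qed.

Lemma emon_cat I J : emon (I ++ J) = emon I ** emon J.
Proof. by rewrite /emon map_cat eprod_cat. Qed.

Lemma emon_cons i I : emon (i :: I) = gen i ** emon I. Proof. by []. Qed.
Lemma emon1 i : emon [:: i] = gen i. Proof. by rewrite emon_cons ext_1mul. Qed.

Lemma emon_alternating : alternating emon.
Proof.
move=> u x y v; rewrite !emon_cat !emon_cons !ext_mulA -[_ ** gen x ** _]ext_mulA.
by rewrite ext_genC emulNr emulNl !ext_mulA.
Qed.

(** Killing the generators below k lets the sums for delta run over full boxes from 0, which are
    stable under rotation of the indices. *)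
Definition gen_ge a : A := if (k <= a)%N then gen a else 0.

Definition dgen i : A :=
  \sum_(k <= a < i.+1) \sum_(k <= b < i.+1 | (a < b)%N && (a + b == i)%N)
    mu L (b%:Z - a%:Z) *: (gen a ** gen b).

Lemma gen_geC a b : gen_ge a ** gen_ge b = - (gen_ge b ** gen_ge a).
Proof.
rewrite /gen_ge; case: ifP; case: ifP => _ _; rewrite ?emul0l ?emul0r ?oppr0 //.
exact: ext_genC.
Qed.

Lemma gen_ge2C a b (x : A) : gen_ge a ** (gen_ge b ** x) = - (gen_ge b ** (gen_ge a ** x)).
Proof. by rewrite !ext_mulA gen_geC emulNl. Qed.

(** Both [mu] and the product change sign when a and b are exchanged, and the diagonal vanishes, so
    the ordered pairs count each term of [dgen] twice. *)
Lemma dgenE i M : (i < M)%N -> dgen i = 2%:R^-1 *: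
  \sum_(0 <= a < M) \sum_(0 <= b < M | (a + b == i)%N)
     mu L (b%:Z - a%:Z) *: (gen_ge a ** gen_ge b).
Proof.
move=> iM; pose F a b := mu L (b%:Z - a%:Z) *: (gen_ge a ** gen_ge b).
have FC a b : F a b = F b a.
  by rewrite /F gen_geC scalerN -scaleNr -muN opprB.
pose S (P : rel nat) := \sum_(0 <= a < M) \sum_(0 <= b < M) if P a b && (a + b == i)%N then F a b else 0.
have -> : dgen i = S ltn.
  rewrite /S (@big_nat_support _ k i) //; last first.
    move=> a ka; apply: big1 => b _; case: ifP => // /andP[_ abi]; rewrite /F /gen_ge.
    case/orP: ka => ka; first by rewrite leqNgt ka emul0l scaler0.
    by move: abi ka => /eqP <-; rewrite ltnNge leq_addr.
  rewrite /dgen big_nat [RHS]big_nat; apply: eq_bigr => a /andP[ka _].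
  rewrite big_mkcond [RHS](@big_nat_support _ k i) //; last first.
    move=> b kb; case: ifP => // /andP[_ abi]; rewrite /F /gen_ge.
    case/orP: kb => kb; first by rewrite (leqNgt k b) kb emul0r scaler0.
    by move: abi kb => /eqP <-; rewrite ltnNge leq_addl.
  by rewrite big_nat [RHS]big_nat; apply: eq_bigr => b /andP[kb _]; rewrite /F /gen_ge ka kb.
have SC : S ltn = S gtn.
  rewrite /S exchange_big_nat; apply: eq_bigr => a _; apply: eq_bigr => b _.
  by rewrite addnC FC.
apply: (scalerI (_ : 2%:R != 0 :> rat)) => //.
rewrite scalerA mulfV // scale1r scaler_nat mulr2n {2}SC /S -big_split /=.
apply: eq_bigr => a _; rewrite -big_split [RHS]big_mkcond /=; apply: eq_bigr => b _.
case: ltngtP => [ab|ba|ab] /=; rewrite ?addr0 ?add0r //.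
by rewrite ab subrr mu0 scale0r; case: ifP.
Qed.

Lemma rel_ed m (p : nat -> rat) : cyclic_ed L m p ->
  \sum_(0 <= a < m.+1) p a *: (gen_ge a ** dgen (m - a)) = 0.
Proof.
move=> cp.
pose c a x y := p a * mu L (y%:Z - x%:Z).
pose G a x y := gen_ge a ** (gen_ge x ** gen_ge y).
have Gr x y z : G x y z = G y z x.
  by rewrite /G (gen_ge2C x y) (gen_geC x z) emulNr opprK.
suff -> : \sum_(0 <= a < m.+1) p a *: (gen_ge a ** dgen (m - a)) = 2%:R^-1 *:
   \sum_(0 <= a < m.+1) \sum_(0 <= x < m.+1) \sum_(0 <= y < m.+1)
    (if (a + x + y == m)%N then c a x y *: G a x y else 0).
  by rewrite cyclic_sum0 ?scaler0 // => a x y axy; apply: cp.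
rewrite scaler_sumr big_nat [RHS]big_nat; apply: eq_bigr => a /andP[_ am].
rewrite (@dgenE (m - a) m.+1) ?ltnS ?leq_subr // emulZr scalerA mulrC -scalerA; congr (_ *: _).
rewrite emul_sumr scaler_sumr; apply: eq_bigr => x _.
rewrite emul_sumr scaler_sumr big_mkcond; apply: eq_bigr => y _ /=.
rewrite (_ : (x + y == m - a)%N = (a + x + y == m)%N); last by lia.
by case: ifP => // _; rewrite emulZr scalerA.
Qed.

Lemma rel_dd m (q : nat -> rat) : cyclic_dd L m q ->
  \sum_(0 <= a < m.+1) q a *: (dgen a ** dgen (m - a)) = 0.
Proof.
move=> cq; pose M := m.+1.
pose c x y u v := q (x + y)%N * mu L (y%:Z - x%:Z) * mu L (v%:Z - u%:Z).
(* With x kept fixed, the rotation of y, u, v is an even permutation, so [cyclic_sum0] applies to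
   the three inner sums. *)
pose G x y u v := gen_ge x ** (gen_ge y ** (gen_ge u ** gen_ge v)).
have Gr x y u v : G x y u v = G x u v y.
  by rewrite /G (gen_ge2C y u) (gen_geC y v) !emulNr opprK.
pose S := \sum_(0 <= x < M) \sum_(0 <= y < M) \sum_(0 <= u < M) \sum_(0 <= v < M)
    (if (y + u + v == m - x)%N && (x <= m)%N then c x y u v *: G x y u v else 0).
have S0 : S = 0.
  apply: big1_seq => x; rewrite mem_index_iota => /andP[_ /andP[_ xM]].
  rewrite -[RHS](@cyclic_sum0 _ (m - x) M (c x) (G x) (Gr x)) //; last first.
    by move=> y u v yuv; apply: cq; lia.
  apply: eq_bigr => y _; apply: eq_bigr => u _; apply: eq_bigr => v _.
  by rewrite -ltnS xM andbT.
suff -> : \sum_(0 <= a < m.+1) q a *: (dgen a ** dgen (m - a)) = (2%:R^-1 * 2%:R^-1) *: S.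
  by rewrite S0 scaler0.
pose F a x y u v := if (x + y == a)%N && (u + v == m - a)%N then c x y u v *: G x y u v else 0.
transitivity ((2%:R^-1 * 2%:R^-1) *: \sum_(0 <= a < M) \sum_(0 <= x < M) \sum_(0 <= y < M)
    \sum_(0 <= u < M) \sum_(0 <= v < M) F a x y u v).
  rewrite scaler_sumr big_nat [RHS]big_nat; apply: eq_bigr => a /andP[_ am].
  rewrite (@dgenE (m - a) M) ?ltnS ?leq_subr // (@dgenE a M) // emulZr emulZl !scalerA.
  rewrite -mulrA mulrC -[LHS]scalerA; congr (_ *: _).
  rewrite emul_suml scaler_sumr; apply: eq_bigr => x _.
  rewrite emul_suml scaler_sumr big_mkcond; apply: eq_bigr => y _ /=; rewrite /F.
  case: eqP => [xy|_]; last by rewrite big1 // => u _; rewrite big1.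
  rewrite emul_sumr scaler_sumr; apply: eq_bigr => u _.
  rewrite emul_sumr scaler_sumr big_mkcond; apply: eq_bigr => v _ /=.
  case: ifP => // _; rewrite emulZr emulZl !scalerA /c xy /G -!ext_mulA.
  by congr (_ *: _); ring.
congr (_ *: _); rewrite exchange_big_nat; apply: eq_bigr => x _ /=.
rewrite exchange_big_nat; apply: eq_bigr => y _ /=.
rewrite exchange_big_nat; apply: eq_bigr => u _ /=.
rewrite exchange_big_nat; apply: eq_bigr => v _ /=.
have [xyM|xyM] := ltnP (x + y) M; last first.
  rewrite big_nat big1 /F; last first.
    by move=> a /andP[_ aM]; case: eqP => // xya; move: aM; rewrite -xya ltnNge xyM.
  by case: ifP => // /andP[/eqP h1 h2]; move: xyM; rewrite /M; lia.
rewrite (bigD1_seq (x + y)%N) ?mem_index_iota ?iota_uniq //= big1 ?addr0; last first.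
  by move=> a /negbTE ax; rewrite /F eq_sym ax.
by rewrite /F eqxx /=; congr (if _ then _ else _); move: xyM; rewrite /M; lia.
Qed.

End Exterior.

Local Open Scope nat_scope.

(** * Dominance order *)

Section Dominance.
Implicit Types (s t u a b : seq nat) (th l x y : nat).

(* The partial sums of the sorted sequence s are the Legendre transform of
   [th |-> wsum th s], which is additive in the multiset s. *)
Definition wsum th s : nat := \sum_(x <- s) (th - x).

(** Here s is the lower sequence: smaller partial sums mean larger values of [wsum]. For sorted
    sequences of equal size this agrees with [pdom], but it needs no sorting and passes to
    unions. *)
Definition wdom s t : Prop := forall th, wsum th t <= wsum th s.

Lemma wsum_cat th s t : wsum th (s ++ t) = wsum th s + wsum th t.
Proof. exact: big_cat. Qed.

Lemma wsum_take_drop th s l : wsum th s = wsum th (take l s) + wsum th (drop l s).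
Proof. by rewrite -wsum_cat cat_take_drop. Qed.

Lemma wsum_cons th x s : wsum th (x :: s) = (th - x) + wsum th s.
Proof. exact: big_cons. Qed.

Lemma perm_wsum th s t : perm_eq s t -> wsum th s = wsum th t.
Proof. exact: perm_big. Qed.

Lemma wdom_refl s : wdom s s. Proof. by []. Qed.

Lemma wdom_trans s t u : wdom s t -> wdom t u -> wdom s u.
Proof. by move=> st tu th; apply: leq_trans (st th). Qed.

Lemma perm_wdom s s' t t' : perm_eq s s' -> perm_eq t t' -> wdom s t -> wdom s' t'.
Proof. by move=> ss tt st th; rewrite -(perm_wsum th ss) -(perm_wsum th tt). Qed.

Lemma wdom_catr u s t : wdom s t -> wdom (s ++ u) (t ++ u).
Proof. by move=> st th; rewrite !wsum_cat leq_add2r. Qed.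

Lemma wdom_pair x y x' y' : x' + y' = x + y -> x' <= x -> x' <= y ->
  wdom [:: x'; y'] [:: x; y].
Proof. by move=> e ex ey th; rewrite /wsum !big_cons big_nil; lia. Qed.

Lemma wsum_take_leq th s l : l <= size s -> l * th <= wsum th s + sumn (take l s).
Proof.
move=> ls; rewrite (wsum_take_drop th s l) addnAC; apply: (leq_trans _ (leq_addr _ _)).
rewrite -[l in l * _](size_takel ls).
by elim: (take l s) => // x t IH; rewrite /= wsum_cons mulSn; lia.
Qed.

Lemma wsum_take_eq th s l : l <= size s -> all (leq^~ th) (take l s) ->
  all (leq th) (drop l s) -> wsum th s + sumn (take l s) = l * th.
Proof.
move=> ls le ge; rewrite (wsum_take_drop th s l).
have -> : wsum th (drop l s) = 0.
  by rewrite /wsum big1_seq // => x /(allP ge) /eqP.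
rewrite addn0 -[l in RHS](size_takel ls); elim: (take l s) le => [|x t IH] /=; first by rewrite /wsum big_nil.
by case/andP=> xth /IH; rewrite wsum_cons mulSn; lia.
Qed.

Lemma sorted_take_leq s l x : sorted leq s -> l < size s -> x \in take l s -> x <= nth 0 s l.
Proof.
move=> ss ls /(nthP 0)[i]; rewrite size_takel ?(ltnW ls) // => il <-; rewrite nth_take //.
by apply: (sorted_leq_nth leq_trans leqnn) => //; rewrite ?inE ?(ltn_trans il ls) // ltnW.
Qed.

Lemma sorted_drop_geq s l x : sorted leq s -> x \in drop l s -> nth 0 s l <= x.
Proof.
move=> ss /(nthP 0)[i]; rewrite size_drop => il <-; rewrite nth_drop.
by apply: (sorted_leq_nth leq_trans leqnn) => //; rewrite ?leq_addr // unfold_in /=; move: il; rewrite ltn_subRL => il; rewrite ?(leq_ltn_trans (leq_addr i l) il).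
Qed.

Definition pdom s t : Prop := forall l, sumn (take l s) <= sumn (take l t).

(** At the threshold th = s_l, the inequality of [wsum_take_leq] for the first l + 1 entries is an
    equality for the sorted s. *)
Lemma wdom_pdom s t : sorted leq s -> size s = size t -> wdom s t -> pdom s t.
Proof.
move=> ss st dst l; wlog ls : l / l <= size s.
  move=> W; have [/W //|ls] := leqP l (size s).
  by rewrite (take_oversize (ltnW ls)) take_oversize -?st ?(ltnW ls) //
     -(take_size s) -(take_size t) -st W.
case: l ls => [|l] ls; first by rewrite !take0.
have hs : all (leq^~ (nth 0 s l)) (take l.+1 s).
  apply/allP => x; rewrite (take_nth 0) // mem_rcons inE => /predU1P[->//|].
  exact: sorted_take_leq.
have gs : all (leq (nth 0 s l)) (drop l.+1 s).
  apply/allP => x xd; apply: (sorted_drop_geq ss).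
  by rewrite (drop_nth 0) // inE xd orbT.
have e1 := wsum_take_eq ls hs gs.
have := @wsum_take_leq (nth 0 s l) t l.+1; rewrite -st => /(_ ls).
by move: (dst (nth 0 s l)); lia.
Qed.

Lemma pdom_wdom s t : sorted leq t -> size s = size t -> pdom s t -> wdom s t.
Proof.
move=> tt st dst th; pose l := find (leq th) t.
have lt : l <= size t by apply: find_size.
have e : wsum th t + sumn (take l t) = l * th.
  apply: wsum_take_eq => //; apply/allP => x.
    move=> /(nthP 0)[i]; rewrite size_takel // => il <-; rewrite nth_take //.
    by have /negbT := before_find 0 il; rewrite -ltnNge => /ltnW.
  have [lts|] := ltnP l (size t); last by move=> ge; rewrite drop_oversize.
  move=> /(sorted_drop_geq tt); apply: leq_trans.
  by apply: nth_find; rewrite has_find.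
have := @wsum_take_leq th s l; rewrite st => /(_ lt).
by move: (dst l); lia.
Qed.

Lemma pdom_sort s : pdom (sort leq s) s.
Proof.
apply: wdom_pdom; rewrite ?size_sort ?(sort_sorted leq_total) //.
by apply: perm_wdom (wdom_refl s); rewrite // perm_sym perm_sort.
Qed.

Lemma pdom_refl s : pdom s s. Proof. by []. Qed.

Lemma pdom_trans s t u : pdom s t -> pdom t u -> pdom s u.
Proof. by move=> st tu l; apply: leq_trans (tu l). Qed.

Lemma eq_take_sumn s t : size s = size t ->
  (forall l, l <= size t -> sumn (take l s) = sumn (take l t)) -> s = t.
Proof.
move=> st e; apply: (eq_from_nth (x0 := 0)) => // i si; have ti : i < size t by rewrite -st.
have := e i.+1 ti; rewrite (take_nth 0 si) (take_nth 0 ti) -!cats1 !sumn_cat.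
by rewrite (e i (ltnW ti)) /= !addn0 => /addnI.
Qed.

Lemma pdom_antisym s t : size s = size t -> pdom s t -> pdom t s -> s = t.
Proof.
by move=> st dst dts; apply: eq_take_sumn => // l _; apply/eqP; rewrite eqn_leq dst dts.
Qed.

Definition weight s : nat := \sum_(l < (size s).+1) sumn (take l s).

Lemma pdom_weight s t : size s = size t -> pdom s t -> s <> t -> weight s < weight t.
Proof.
move=> st dst nst; rewrite /weight st ltn_neqAle leq_sum ?andbT; last by move=> l _; apply: dst.
apply/negP => /eqP e; apply: nst; apply: eq_take_sumn => // l; rewrite -ltnS => ls.
have := e; rewrite (bigD1 (Ordinal ls)) //= [X in _ = X -> _](bigD1 (Ordinal ls)) //=.
set S1 := (X in _ + X = _); set S2 := (X in _ = _ + X).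
have S12 : S1 <= S2 by apply: leq_sum => i _; apply: dst.
move=> e'; apply/eqP; rewrite eqn_leq dst /=.
by rewrite -(leq_add2r S1) e' leq_add2l.
Qed.

(** Up to the threshold y, the part y contributes nothing and dominance of s over t decides. Beyond
    y, all parts of y :: t lie below th, so its [wsum] is the least possible for the given size and
    sum. *)
Lemma wdom_cons_max s t (x y : nat) : sorted leq t -> all (leq^~ y) t -> size s = size t ->
  pdom s t -> x + sumn s = y + sumn t -> wdom (x :: s) (y :: t).
Proof.
move=> tt ty st dst e th.
have [thy|yth] := leqP th y.
  rewrite !wsum_cons (_ : th - y = 0); last lia.
  by rewrite add0n (leq_trans (pdom_wdom tt st dst th)) // leq_addl.
have h1 : wsum th (y :: t) + sumn (y :: t) = (size t).+1 * th.
  rewrite -[(size t).+1]/(size (y :: t)) -[X in _ + sumn X]take_size; apply: wsum_take_eq => //.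
    rewrite take_size /= (ltnW yth) /=; apply: sub_all ty => z zy.
    exact: leq_trans zy (ltnW yth).
  by rewrite drop_size.
have h2 := @wsum_take_leq th (x :: s) (size t).+1.
by move: h2; rewrite -[(size t).+1]/(size (y :: t)) /= -st take_size /= => /(_ (leqnn _)); move: h1 => /=; rewrite -st; lia.
Qed.

Lemma sort_insert (x y : nat) t : sorted leq (y :: t) ->
  sort leq (x :: y :: t) = if x <= y then x :: y :: t else y :: sort leq (x :: t).
Proof.
move=> st; have [xy|yx] := leqP x y.
  by rewrite sorted_sort //=; [exact: leq_trans | rewrite xy].
apply: (sorted_eq leq_trans anti_leq).
- exact: (sort_sorted leq_total).
- have pe : perm_eq (sort leq (x :: t)) (x :: t) by rewrite perm_sort.
  rewrite /= path_sortedE; last exact: leq_trans.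
  rewrite (sort_sorted leq_total) andbT (perm_all _ pe) /= ltnW //=.
  by move: st; rewrite /= path_sortedE; [case/andP | exact: leq_trans].
- rewrite perm_sort perm_sym.
  apply: (perm_trans (y := y :: x :: t)); first by rewrite perm_cons perm_sort.
  exact: (permEl (perm_catCA [:: y] [:: x] t)).
Qed.

Lemma lexi_sort_cons (x y : nat) s : x < y ->
  ((sort leq (x :: s) : seqlexi nat) < sort leq (y :: s))%O.
Proof.
move=> xy; have e z : sort leq (z :: s) = sort leq (z :: sort leq s).
  by apply/(perm_sortP leq_total leq_trans anti_leq); rewrite perm_cons perm_sym perm_sort.
rewrite !{}e; elim: (sort leq s) (sort_sorted leq_total s) x xy => [|z t IH] zt x xy.
  by rewrite ltxi_cons !leEnat (ltnW xy) (leqNgt y) xy.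
rewrite !sort_insert //; have st := path_sorted zt.
have [xz|zx] := leqP x z; have [yz|zy] := leqP y z.
- by rewrite ltxi_cons !leEnat (ltnW xy) (leqNgt y) xy.
- rewrite ltxi_cons !leEnat xz /=; apply/implyP => zx.
  have <- : sort leq (z :: t) = z :: t by rewrite sorted_sort //; exact: leq_trans.
  exact: IH.
- by move: (leq_trans (leq_trans zx (ltnW xy)) yz); rewrite ltnn.
- by rewrite ltxi_cons !leEnat leqnn /=; apply: IH.
Qed.

End Dominance.

Local Open Scope ring_scope.

(** * Straightening two adjacent parts *)

Section Straightening.
Variables (A : exterior) (L : lie_algebra) (k : nat).
Implicit Types (a b d i j m : nat) (I K J : seq nat) (p : seq nat * seq nat).

Local Notation "x ** y" := (@ext_mul A x y) (at level 40, left associativity).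
Local Notation gen := (@ext_gen A).
Local Notation dgen := (@dgen A L k).
Local Notation emon := (@emon A).
Local Notation eprod := (@eprod A).

Definition commutes (x : A) : Prop := forall i, x ** gen i = gen i ** x.

Lemma dgen_comm i : commutes (dgen i).
Proof.
move=> j; rewrite /dgen emul_suml emul_sumr; apply: eq_bigr => a _.
rewrite emul_suml emul_sumr; apply: eq_bigr => b _; rewrite emulZl emulZr; congr (_ *: _).
by rewrite -ext_mulA (ext_genC A b) emulNr ext_mulA (ext_genC A a) emulNl opprK -ext_mulA.
Qed.

Lemma comm_emon x I : commutes x -> x ** emon I = emon I ** x.
Proof.
move=> cx; elim: I => [|i I IH]; first by rewrite /emon /= ext_mul1 ext_1mul.
by rewrite emon_cons ext_mulA cx -!ext_mulA IH.
Qed.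

Lemma comm_dgen x i : commutes x -> x ** dgen i = dgen i ** x.
Proof.
move=> cx; rewrite /dgen emul_suml emul_sumr; apply: eq_bigr => a _.
rewrite emul_suml emul_sumr; apply: eq_bigr => b _; rewrite emulZl emulZr; congr (_ *: _).
by rewrite ext_mulA cx -!ext_mulA cx.
Qed.

Definition dprod J : A := eprod [seq dgen j | j <- J].

Lemma dprod_cat I J : dprod (I ++ J) = dprod I ** dprod J.
Proof. by rewrite /dprod map_cat eprod_cat. Qed.

Lemma dprod_cons i J : dprod (i :: J) = dgen i ** dprod J. Proof. by []. Qed.

Lemma dprod_comm J : commutes (dprod J).
Proof.
move=> i; elim: J => [|j J IH]; first by rewrite /dprod /= ext_mul1 ext_1mul.
by rewrite dprod_cons -ext_mulA IH ext_mulA dgen_comm -ext_mulA.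
Qed.

Lemma perm_dprod I J : perm_eq I J -> dprod I = dprod J.
Proof.
elim: I J => [|i I IH] J; first by rewrite perm_sym => /perm_nilP ->.
move=> pe; have iJ : i \in J by rewrite -(perm_mem pe) mem_head.
case/path.splitPr: J / iJ pe => J1 J2 pe.
have pe' : perm_eq I (J1 ++ J2).
  by rewrite -(perm_cons i); apply: (perm_trans pe); rewrite -cat1s perm_catCA cat1s.
rewrite dprod_cons (IH _ pe') !dprod_cat dprod_cons !ext_mulA; congr (_ ** _).
by rewrite comm_dgen //; apply: dprod_comm.
Qed.

(** The factors delta(e_j) are even and commute with everything, so ordinary parts can be gathered
    on the left. A pair (I \ J, J) then matters only up to permutation, at the cost of a sign, which
    spans do not see. *)
Definition tmon p : A := emon p.1 ** dprod p.2.

Lemma tmon_cat K K' J J' : tmon (K ++ K', J ++ J') = tmon (K, J) ** tmon (K', J').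
Proof.
rewrite /tmon /= emon_cat dprod_cat -!ext_mulA; congr (_ ** _).
by rewrite !ext_mulA (comm_emon _ (@dprod_comm J)).
Qed.

Lemma perm_tmon K K' J J' : perm_eq K K' -> perm_eq J J' ->
  exists b : bool, tmon (K, J) = (-1) ^+ b *: tmon (K', J').
Proof.
move=> pK pJ; have [b hb] := alternating_swap (@emon_alternating A) pK.
by exists b; rewrite /tmon /= hb (perm_dprod pJ) emulZl.
Qed.

Lemma tmon_nuniq K J : ~~ uniq K -> tmon (K, J) = 0.
Proof.
by move=> nu; rewrite /tmon /= (alternating_nuniq (@emon_alternating A) nu) emul0l.
Qed.

Lemma lspan_perm_tmon P p K J : perm_eq p.1 K -> perm_eq p.2 J ->
  lspan P tmon (tmon p) -> lspan P tmon (tmon (K, J)).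
Proof.
case: p => K0 J0 /= pK pJ; rewrite perm_sym in pK; rewrite perm_sym in pJ.
by have [b ->] := perm_tmon pK pJ => h; apply: lspanZ.
Qed.

Lemma lspan_tmon_uniq P x :
  lspan P tmon x -> lspan (fun p => P p /\ uniq p.1) tmon x.
Proof.
apply: lspan_trans => -[K J] PKJ.
have [u|nu] := boolP (uniq K); first exact: lspan_gen.
by rewrite tmon_nuniq //; apply: lspan0.
Qed.

Lemma dgen_half m : dgen m =
  \sum_(k <= a < m.+1 | (a < m - a)%N) mu L ((m - a)%:Z - a%:Z) *: (gen a ** gen (m - a)).
Proof.
rewrite /dgen [RHS]big_mkcond; apply: eq_big_nat => a /andP[ka am].
case: ifP => ama.
  rewrite big_mkcond (bigD1_seq (m - a)%N) /= ?iota_uniq //; last first.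
    by rewrite mem_index_iota; lia.
  rewrite ama (_ : a + (m - a) == m)%N; last by lia.
  rewrite big1_seq ?addr0 // => b /andP[bma]; rewrite mem_index_iota => bk.
  by rewrite (_ : (_ && _) = false) //; apply/negP; lia.
rewrite big_mkcond big1_seq // => b; rewrite mem_index_iota => bk.
by rewrite (_ : (_ && _) = false) //; apply/negP; lia.
Qed.

Lemma dgen_eq0 m : (m <= k.*2)%N -> dgen m = 0.
Proof.
by move=> mk; rewrite dgen_half big1_seq // => a; rewrite mem_index_iota; lia.
Qed.

Lemma tmon_small K J d : d \in J -> (d <= k.*2)%N -> tmon (K, J) = 0.
Proof.
move=> dJ dk; rewrite /tmon /= (perm_dprod (perm_to_rem dJ)) dprod_cons dgen_eq0 //.
by rewrite emul0l emul0r.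
Qed.

(* A generating step of the order, read on pairs (I \ J, J) given up to
   permutation; only a special case of lexicographic decrease is needed. *)
Definition plow p' p : Prop :=
  [/\ all (leq k) (p'.1 ++ p'.2), sumn (p'.1 ++ p'.2) = sumn (p.1 ++ p.2) &
    [\/ [/\ size p'.1 = size p.1, size p'.2 = size p.2, wdom (p'.1 ++ p'.2) (p.1 ++ p.2)
          & ~~ perm_eq (p'.1 ++ p'.2) (p.1 ++ p.2)],
        [/\ size p'.1 = size p.1, perm_eq (p'.1 ++ p'.2) (p.1 ++ p.2)
          & exists x y s, [/\ perm_eq p'.2 (x :: s), perm_eq p.2 (y :: s) & (x < y)%N]]
      | exists x y s, [/\ perm_eq p.1 [:: x, y & s], x <> y, perm_eq p'.1 s
          & perm_eq p'.2 ((x + y)%N :: p.2)]]].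

(** The first alternative of [plow] alone. Unlike [plow] it is closed under composition
    ([pdlow_trans]), which products of triangular expansions require. *)
Definition pdlow p' p : Prop :=
  [/\ all (leq k) (p'.1 ++ p'.2), sumn (p'.1 ++ p'.2) = sumn (p.1 ++ p.2),
      size p'.1 = size p.1, size p'.2 = size p.2
    & wdom (p'.1 ++ p'.2) (p.1 ++ p.2) /\ ~~ perm_eq (p'.1 ++ p'.2) (p.1 ++ p.2)].

Lemma pdlow_plow p' p : pdlow p' p -> plow p' p.
Proof. by case=> ? ? ? ? [? ?]; split=> //; constructor 1. Qed.

Lemma perm_merge_parts I J I' J' :
  perm_eq ((I ++ I') ++ (J ++ J')) ((I ++ J) ++ (I' ++ J')).
Proof. by rewrite -!catA perm_cat2l perm_catCA. Qed.

Lemma pdlow_cat K J p' p : all (leq k) (K ++ J) -> pdlow p' p ->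
  pdlow (p'.1 ++ K, p'.2 ++ J) (p.1 ++ K, p.2 ++ J).
Proof.
case: p' p => [K' J'] [K0 J0] /= kKJ [/= kp sp sK sJ [dKJ npe]].
have pe' := perm_merge_parts K' J' K J; have pe := perm_merge_parts K0 J0 K J.
split=> /=; rewrite ?size_cat ?sK ?sJ //.
- by rewrite (perm_all _ pe') all_cat kp.
- by rewrite (perm_sumn pe') (perm_sumn pe) sumn_cat [RHS]sumn_cat sp.
- split; last by rewrite (permPl pe') (permPr pe) perm_cat2r.
  rewrite perm_sym in pe'; rewrite perm_sym in pe.
  by apply: (perm_wdom pe' pe); apply: wdom_catr.
Qed.

Lemma plow_cat K J p' p : all (leq k) (K ++ J) -> plow p' p ->
  plow (p'.1 ++ K, p'.2 ++ J) (p.1 ++ K, p.2 ++ J).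
Proof.
case: p' p => [K' J'] [K0 J0] /= kKJ [/= kp sp pp].
have pe' := perm_merge_parts K' J' K J; have pe := perm_merge_parts K0 J0 K J.
split=> /=.
- by rewrite (perm_all _ pe') all_cat kp.
- by rewrite (perm_sumn pe') (perm_sumn pe) sumn_cat [RHS]sumn_cat sp.
case: pp => [[sK sJ dKJ npe]|[sK peKJ [x [y [s [px py xy]]]]]|[x [y [s [pxy xy ps pm]]]]].
- by case: (@pdlow_cat K J (K', J') (K0, J0) kKJ) => // ? ? ? ? []; constructor 1.
- constructor 2; rewrite /= !size_cat sK; split=> //.
    by rewrite (permPl pe') (permPr pe) perm_cat2r.
  by exists x, y, (s ++ J); rewrite -!cat_cons !perm_cat2r.
- constructor 3; exists x, y, (s ++ K) => /=.
  by rewrite -!cat_cons !perm_cat2r.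
Qed.

Lemma lspan_tmon_cat p K J : all (leq k) (K ++ J) ->
  lspan (plow^~ p) tmon (tmon p) ->
  lspan (plow^~ (p.1 ++ K, p.2 ++ J)) tmon (tmon (p.1 ++ K, p.2 ++ J)).
Proof.
case: p => K0 J0 kKJ h; rewrite tmon_cat /=.
apply: (lspan_map (h := mull (tmon (K, J)))) h => -[K' J'] pl.
rewrite /= /mull -tmon_cat.
by apply: lspan_gen; apply: (plow_cat kKJ pl).
Qed.

Lemma lspan_solve P (M : nat) (c : nat -> rat) (X : nat -> A) s :
  \sum_(0 <= a < M) c a *: X a = 0 -> (s < M)%N -> c s != 0 ->
  (forall a, (a < M)%N -> a != s -> c a != 0 -> lspan P tmon (X a)) ->
  lspan P tmon (X s).
Proof.
move=> S0 sM cs h.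
move: S0; rewrite (bigD1_seq s) ?mem_index_iota ?iota_uniq //= => /eqP.
rewrite addr_eq0 => /eqP e.
rewrite -[X s](scalerK cs) e scalerN -scaleNr; apply: lspanZ.
rewrite big_seq_cond; apply: lspan_sum => a /andP[]; rewrite mem_index_iota => /andP[_ aM] as_.
by have [->|ca] := eqVneq (c a) 0; [rewrite scale0r; apply: lspan0 | apply/lspanZ/h].
Qed.

Lemma pair_pdlow (x y x' y' : nat) K' J' K J :
  (k <= x')%N -> (k <= y')%N -> (x' + y' = x + y)%N ->
  perm_eq (K' ++ J') [:: x'; y'] -> perm_eq (K ++ J) [:: x; y] ->
  size K' = size K -> (minn x' y' < minn x y)%N -> pdlow (K', J') (K, J).
Proof.
move=> kx ky e pe' pe sK lt; split=> //=.
- by rewrite (perm_all _ pe') /= kx ky.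
- by rewrite (perm_sumn pe') (perm_sumn pe) /= !addn0.
- have := perm_size pe'; have := perm_size pe; rewrite !size_cat sK /= => {1}<-.
  by move/addnI.
- split.
    rewrite perm_sym in pe'; rewrite perm_sym in pe; apply: (perm_wdom pe' pe).
    have [xy|yx] := leqP x' y'; first by apply: wdom_pair => //; lia.
    apply: (@perm_wdom [:: y'; x'] _ [:: x; y]) => //; first by rewrite -cat1s perm_catC.
    by apply: wdom_pair; lia.
  rewrite (permPl pe') (permPr pe); apply/negP => pp.
  have := perm_mem pp x'; have := perm_mem pp y'; rewrite !inE !eqxx ?orbT.
  by move=> /esym/orP[]/eqP h1 /esym/orP[]/eqP h2; lia.
Qed.

Lemma pair_plow (x y x' y' : nat) K' J' K J :
  (k <= x')%N -> (k <= y')%N -> (x' + y' = x + y)%N ->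
  perm_eq (K' ++ J') [:: x'; y'] -> perm_eq (K ++ J) [:: x; y] ->
  size K' = size K -> (minn x' y' < minn x y)%N -> plow (K', J') (K, J).
Proof. by move=> kx ky e pe' pe sK lt; apply/pdlow_plow/(pair_pdlow kx ky e pe' pe). Qed.

Lemma mu_neq0 z : (0 < z)%N -> (z < 3)%N -> mu L z != 0.
Proof. by case: z => [|[|[|z]]] // _ _; case: L. Qed.

(** Since y - x is 1 or 2, mu(y - x) is nonzero and e_x e_y is the most central term of
    delta(e_(x+y)): every other term has a smaller least index, and delta(e_(x+y)) itself is the
    merged monomial. *)
Lemma straighten_ee (x y : nat) : (k <= x)%N -> (x < y)%N -> (y <= x + 2)%N ->
  lspan (plow^~ ([:: x; y], [::])) tmon (tmon ([:: x; y], [::])).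
Proof.
move=> kx xy yx; pose m := (x + y)%N.
have tE (a b : nat) : tmon ([:: a; b], [::]) = gen a ** gen b.
  by rewrite /tmon /= ext_1mul emon_cons emon1.
have tm : tmon ([::], [:: m]) = dgen m by rewrite /tmon /= ext_mul1 /dprod /= ext_1mul.
have := dgen_half m; rewrite big_mkcond (bigD1_seq x) ?iota_uniq ?mem_index_iota //=; last by rewrite /m; lia.
rewrite (_ : x < m - x)%N; last by rewrite /m; lia.
rewrite (_ : m - x = y)%N; last by rewrite /m; lia.
have mxy : mu L (y%:Z - x%:Z) != 0.
  by rewrite (_ : y%:Z - x%:Z = (y - x)%N%:Z) ?mu_neq0 //; lia.
move/(canLR (addrK _)) => e.
rewrite tE -[gen x ** gen y](scalerK mxy) -{}e; apply: lspanZ; apply: lspanD.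
  rewrite -tm; apply: lspan_gen; split=> /=; rewrite ?addn0 ?andbT //; first by rewrite /m; lia.
  by constructor 3; exists x, y, [::]; split=> //; lia.
apply: lspanN; rewrite big_seq_cond; apply: lspan_sum => a /andP[].
rewrite mem_index_iota => /andP[ka am] ax; case: ifP => ama; last exact: lspan0.
apply: lspanZ; rewrite -tE; apply: lspan_gen; apply: (@pair_plow x y a (m - a)%N) => //; rewrite /m in am ama *; lia.
Qed.

Lemma tmon_ed (a b : nat) : tmon ([:: a], [:: b]) = gen a ** dgen b.
Proof. by rewrite /tmon /= emon1 dprod_cons /dprod /= ext_1mul. Qed.

Lemma tmon_dd (a b : nat) : tmon ([::], [:: a; b]) = dgen a ** dgen b.
Proof. by rewrite /tmon /= ext_mul1 !dprod_cons /dprod /= ext_1mul. Qed.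

(** The bounds are asymmetric because e_x delta(e_(x+3)) is still lowered, to e_(x+3) delta(e_x),
    whose distinguished part is smaller; the latter monomial stays, with x as leading part of a
    block. *)
Lemma straighten_ed (e d : nat) : (0 < k)%N -> (k <= e)%N -> (k <= d)%N ->
  (e <= d + 2)%N -> (d <= e + 3)%N ->
  lspan (plow^~ ([:: e], [:: d])) tmon (tmon ([:: e], [:: d])).
Proof.
move=> k0 ke kd ed de; have [dk|kd2] := leqP d k.*2.
  by rewrite (@tmon_small _ _ d) ?inE //; apply: lspan0.
pose m := (e + d)%N; pose c := m./2.
have [b mb] : exists b : bool, (e + d = c.*2 + b)%N.
  by exists (odd m); rewrite [RHS]addnC; exact: esym (odd_double_half m).
have eC : [|| e == c.-1, e == c | e == c.+1] by case: b mb => /= mb; lia.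
have c1 : (1 < c)%N by lia.
(* The three indices e, s1, s2 are c - 1, c, c + 1, hence distinct mod 3; their sum 3c differs from
   m because c > 1 while m is 2c or 2c + 1. *)
have [s1 [s2 [hs h1 h2 h3 h4]]] : exists s1 s2, [/\ (e + s1 + s2 != m)%N,
    e != s1 %[mod 3], e != s2 %[mod 3], s1 != s2 %[mod 3]
  & forall a, a != e -> a != s1 -> a != s2 -> (a + 2 <= c)%N || (c + 2 <= a)%N].
  have hm : (3 * c != m)%N by rewrite /m mb; case: (b); lia.
  case/or3P: eC => /eqP ee; [exists c, c.+1 | exists c.-1, c.+1 | exists c.-1, c]; split;
    try (by apply: contra hm => /eqP <-; apply/eqP; lia); try lia.
have [p [cp p0 p1 p2]] := @cyclic_ed_ex L m e s1 s2 hs h1 h2 h3.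
have R := rel_ed A k cp.
have -> : tmon ([:: e], [:: d]) = gen_ge A k e ** dgen (m - e).
  by rewrite tmon_ed /gen_ge ke /m addKn.
apply: (lspan_solve R _ p0); first by rewrite /m; lia.
move=> a am ae pa.
have as1 : a != s1 by apply: contra pa => /eqP ->; rewrite p1.
have as2 : a != s2 by apply: contra pa => /eqP ->; rewrite p2.
have {h4} ac := h4 a ae as1 as2; clear h1 h2 h3 hs as1 as2 R cp p0 p1 p2 pa.
rewrite /gen_ge; case: ifP => ka; last by rewrite emul0l; apply: lspan0.
have [km|mk] := leqP k (m - a); last first.
  by rewrite dgen_eq0 ?emul0r; [apply: lspan0 | lia].
rewrite -tmon_ed; apply: lspan_gen.
(* The one surviving index that does not lower the minimum is the exchange of e and d = e + 3, which
   is lower lexicographically. *)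
have [[ea ec]|nea] : (a = d /\ e = c.-1 /\ d = c.+2 /\ b) \/ (minn a (m - a) < minn e d)%N.
- by rewrite /m in am *; case: b mb => /= mb; lia.
- rewrite (_ : m - a = e)%N ?ea; last by rewrite /m addnK.
  split=> /=; first by rewrite ke kd.
    by rewrite !addn0 addnC.
  constructor 2; split=> //=; first by rewrite -[[:: d; e]]cat1s perm_catC.
  by exists e, d, [::]; split=> //; lia.
- by apply: (@pair_plow e d a (m - a)) => //; rewrite /m in am *; lia.
Qed.

Lemma straighten_dd (s t : nat) : (0 < k)%N -> (k <= s)%N -> (s <= t)%N -> (t <= s + 3)%N ->
  lspan (plow^~ ([::], [:: s; t])) tmon (tmon ([::], [:: s; t])).
Proof.
move=> k0 ks st ts; have [sk|k2s] := leqP s k.*2.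
  by rewrite (@tmon_small _ _ s) ?inE ?eqxx //; apply: lspan0.
pose m := (s + t)%N; pose c := m./2.
have [b mb] : exists b : bool, (s + t = c.*2 + b)%N.
  by exists (odd m); rewrite [RHS]addnC; exact: esym (odd_double_half m).
(* As t - s <= 3, the index s is c or c - 1; s' is the other of the two. *)
have [s' [t' [h1 h2 h3 h4 [h5 h6 h7]]]] : exists s' t', [/\ (s' + t' = m)%N, s' != s, s' != t,
     s != s' %[mod 3] & [/\ t != s' %[mod 3], (minn s' t' + 1 >= c)%N &
     forall a, (a <= m)%N -> a != s -> a != t -> a != s' -> a != t' ->
       (minn a (m - a) < minn s t)%N]].
  have [es|es] : s = c \/ s = c.-1 by case: b mb => /=; lia.
    by exists c.-1, (m - c.-1)%N; rewrite /m; case: b mb => /= mb; do ?split; lia.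
  by exists c, (m - c)%N; rewrite /m; case: b mb => /= mb; do ?split; lia.
have [q [cq q0 qt [qs' qt']]] := @cyclic_dd_ex L m s t s' t' erefl h1 h2 h3 h4 h5.
have R := rel_dd A k cq.
have -> : tmon ([::], [:: s; t]) = dgen s ** dgen (m - s) by rewrite tmon_dd /m addKn.
have oth a : (a < m.+1)%N -> a != s -> a != t -> q a != 0 ->
    lspan (plow^~ ([::], [:: s; t])) tmon (dgen a ** dgen (m - a)).
  move=> am as_ at_ qa.
  have as' : a != s' by apply: contra qa => /eqP ->; rewrite qs'.
  have at' : a != t' by apply: contra qa => /eqP ->; rewrite qt'.
  have [ka|ak] := leqP k a; last by rewrite dgen_eq0 ?emul0l; [apply: lspan0 | lia].
  have [km|mk] := leqP k (m - a); last by rewrite (@dgen_eq0 (m - a)) ?emul0r; [apply: lspan0 | lia].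
  have lt := h7 a am as_ at_ as' at'; rewrite -tmon_dd.
  apply: lspan_gen; apply: (@pair_plow s t a (m - a)) => //.
  by clear -am; rewrite /m in am *; lia.
have [est|nst] := eqVneq s t.
  apply: (lspan_solve R _ q0); first by rewrite /m; lia.
  by move=> a am as_; apply: oth => //; rewrite -est.
have Xst : dgen s ** dgen (m - s) = dgen t ** dgen (m - t).
  by rewrite /m addKn addnK; apply/comm_dgen/dgen_comm.
(* The terms at s and t coincide, so the second is moved onto the first: the coefficient at s
   doubles and the one at t becomes 0. *)
pose q' a := q a + (if a == s then q s else 0) - (if a == t then q t else 0).
have ind r u : (u < m.+1)%N ->
    \sum_(0 <= a < m.+1) (if a == u then r else 0) *: (dgen a ** dgen (m - a)) =
    r *: (dgen u ** dgen (m - u)).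
  move=> um; rewrite (bigD1_seq u) ?iota_uniq ?mem_index_iota //= eqxx big1 ?addr0 //.
  by move=> a /negbTE ->; rewrite scale0r.
have R' : \sum_(0 <= a < m.+1) q' a *: (dgen a ** dgen (m - a)) = 0.
  under eq_bigr => a _ do rewrite scalerBl scalerDl.
  rewrite sumrB big_split /= R !ind; try by rewrite /m; lia.
  by rewrite qt Xst add0r subrr.
apply: (lspan_solve R'); first by rewrite /m; lia.
  by rewrite /q' eqxx (negbTE nst) subr0 -mulr2n mulrn_eq0.
move=> a am as_; rewrite /q' (negbTE as_) addr0; have [->|at_] := eqVneq a t.
  by rewrite subrr eqxx.
by rewrite subr0; apply: oth.
Qed.

End Straightening.

(** * Symmetric arrays *)

Section ShiftedVectors.

Lemma sumn_iotaS n : sumn (iota 0 n.+1) = (sumn (iota 0 n) + n)%N.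
Proof. by rewrite -addn1 iotaD sumn_cat /= !addn0. Qed.

Lemma sumn_iota_leq s : uniq s -> (sumn (iota 0 (size s)) <= sumn s)%N.
Proof.
move: {2}(size s) (erefl (size s)) => n; elim: n s => [|n IH] s sn us; first by rewrite sn.
have [x xs nx] : exists2 x, x \in s & (n <= x)%N.
  apply/hasP; apply: contraT => /hasPn h; have := @uniq_leq_size _ s (iota 0 n) us.
  rewrite size_iota sn ltnn; apply => x /h; rewrite mem_iota -ltnNge; lia.
rewrite (perm_sumn (perm_to_rem xs)) /= sn sumn_iotaS.
have sr : size (rem x s) = n by rewrite size_rem // sn.
by have := IH _ sr (rem_uniq _ us); rewrite sr; lia.
Qed.

Definition shifted (m : seq nat) (tau : nat -> nat) : seq int :=
  [seq (nth 0%N m i)%:Z + i%:Z - (tau i)%:Z | i <- iota 0 (size m)].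

(** The first l values of tau are distinct, so their sum is at least 0 + 1 + ... + (l - 1), and
    passing from m_i to m_i + i - tau(i) can only lower the partial sums. *)
Lemma shifted_lower m tau : {in gtn (size m) &, injective tau} ->
  (exists2 x, x \in shifted m tau & x < 0) \/
  exists w, [/\ shifted m tau = map Posz w, size w = size m, pdom w m,
    (sumn w + sumn (map tau (iota 0 (size m))) = sumn m + sumn (iota 0 (size m)))%N
  & w = m -> forall i, (i < size m)%N -> tau i = i].
Proof.
move=> tinj; have [pos|] := boolP (all (fun x : int => 0 <= x) (shifted m tau)); last first.
  by case/allPn => x xs; rewrite -ltNge; left; exists x.
right; pose w := [seq `|x|%N | x <- shifted m tau]; exists w.
have we : shifted m tau = map Posz w.
  rewrite -map_comp -[LHS]map_id; apply/eq_in_map => x /(allP pos) x0 /=.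
  by rewrite gez0_abs.
have sw : size w = size m by rewrite !size_map size_iota.
have wi i : (i < size m)%N -> (nth 0%N w i + tau i = nth 0%N m i + i)%N.
  move=> im; have : nth 0 (shifted m tau) i = (nth 0%N w i)%:Z.
    by rewrite we (nth_map 0%N) // sw.
  rewrite /shifted (nth_map 0%N) ?size_iota // nth_iota // add0n; lia.
have sumE l : (l <= size m)%N ->
    (sumn (take l w) + sumn (map tau (iota 0 l)) = sumn (take l m) + sumn (iota 0 l))%N.
  elim: l => [|l IH] lm; first by rewrite !take0.
  rewrite sumn_iotaS -addn1 iotaD map_cat sumn_cat /= addn1 add0n.
  rewrite !(take_nth 0%N) ?sw // -!cats1 !sumn_cat /=.
  by have := IH (ltnW lm); have := wi l lm; lia.
split=> //.
- move=> l; wlog lm : l / (l <= size m)%N.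
    move=> W; have [/W //|ml] := leqP l (size m).
    rewrite (take_oversize (ltnW ml)) take_oversize ?sw ?(ltnW ml) //.
    by have := W _ (leqnn _); rewrite -{1}sw !take_size.
  have ut : uniq (map tau (iota 0 l)).
    rewrite map_inj_in_uniq ?iota_uniq // => i j; rewrite !mem_iota => il jl.
    by apply: tinj; rewrite inE; lia.
  by have := sumn_iota_leq ut; have := sumE l lm; rewrite size_map size_iota; lia.
- by have := sumE _ (leqnn _); rewrite -{1}sw !take_size.
- by move=> wm i im; have := wi i im; rewrite wm; lia.
Qed.

End ShiftedVectors.

Section SymmetricArray.
Variables (V : lmodType rat) (S : seq int -> V) (L : lie_algebra).
Hypothesis S_perm : forall u v, perm_eq u v -> S u = S v.
Hypothesis S_neg : forall u x, x \in u -> x < 0 -> S u = 0.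

(* What [delta e] contributes once the antisymmetrisation [jtdet] is applied. *)
Definition Ef (j : int) (v : seq int) : V :=
  if j is Posz n then 2%:R^-1 *:
    \sum_(0 <= x < n.+1) chi L (x%:Z - (n - x)%N%:Z) *: S [:: x%:Z, (n - x)%N%:Z & v]
  else 0.

Arguments Ef : simpl never.

Lemma Ef_perm j u v : perm_eq u v -> Ef j u = Ef j v.
Proof.
case: j => // n uv; congr (_ *: _); apply: eq_bigr => x _; congr (_ *: _).
by apply: S_perm; rewrite !perm_cons.
Qed.

Lemma Ef_neg j v x : x \in v -> x < 0 -> Ef j v = 0.
Proof.
case: j => // n xv x0; rewrite /Ef big1 ?scaler0 // => y _.
by rewrite (S_neg _ x0) ?scaler0 // !inE xv !orbT.
Qed.

(* The weight making the cyclic sum of [rho * chi] over x + y + z = n vanish. *)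
Definition rho (n x : nat) : rat :=
  if L is W then 2%:R * n%:R - 3%:R * x%:R
  else if (3 %| n)%N then 2%:R * n%:R - 3%:R * x%:R else 1.

Lemma rho_cyclic n z x y : (z + x + y)%N = n ->
  rho n (x + y) * chi L (x%:Z - y%:Z) + rho n (y + z) * chi L (y%:Z - z%:Z)
  + rho n (z + x) * chi L (z%:Z - x%:Z) = 0.
Proof.
move=> <-; rewrite /rho /chi; case: L => /=.
  rewrite !(rmorphD, rmorphN, natrD) /= -!pmulrn; ring.
rewrite (_ : (3 %| z + x + y)%N = ((z + x + y)%N%:R == 0 :> 'F_3)); last first.
  by rewrite -[RHS](eqF3 _ 0) mod0n.
rewrite !eps_F3 !(rmorphD, rmorphN, natrD) /= -!pmulrn.
elim/F3_ind: (z%:R : 'F_3); elim/F3_ind: (x%:R : 'F_3); elim/F3_ind: (y%:R : 'F_3) => /=;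
  eps3_compute; ring.
Qed.

Lemma row_rel v n : \sum_(0 <= j < n.+1) rho n j *: Ef j%:Z ((n - j)%N%:Z :: v) = 0.
Proof.
rewrite big_nat_rev /= add0n.
pose c (z x y : nat) := rho n (x + y) * chi L (x%:Z - y%:Z).
pose G (z x y : nat) := S [:: z%:Z, x%:Z, y%:Z & v].
have Gr x y z : G x y z = G y z x.
  by apply: S_perm; exact: permEl (perm_catCA [:: x%:Z] [:: y%:Z; z%:Z] v).
transitivity (2%:R^-1 *: \sum_(0 <= z < n.+1) \sum_(0 <= x < n.+1) \sum_(0 <= y < n.+1)
    (if (z + x + y == n)%N then c z x y *: G z x y else 0)); last first.
  by rewrite cyclic_sum0 ?scaler0 // => z x y zxy; apply: rho_cyclic.
rewrite scaler_sumr; apply: eq_big_nat => z /andP[_ zn].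
rewrite [RHS](_ : _ = 2%:R^-1 *: \sum_(0 <= x < (n - z).+1) \sum_(0 <= y < n.+1)
    (if (z + x + y == n)%N then c z x y *: G z x y else 0)); last first.
  congr (_ *: _); apply: big_nat_support => [|x]; first by rewrite ltnS leq_subr.
  by rewrite ltn0 /= => zx; rewrite big1 // => y _; case: eqP => // e; lia.
rewrite subSS (_ : n - (n - z) = z)%N; last by lia.
rewrite /Ef scalerA mulrC -scalerA; congr (_ *: _); rewrite scaler_sumr.
apply: eq_big_nat => x /andP[_ xz]; rewrite (bigD1_seq (n - z - x)%N) ?iota_uniq //=; last first.
  by rewrite mem_index_iota; lia.
rewrite (_ : z + x + (n - z - x) == n)%N; last by lia.
rewrite big1 ?addr0 => [|y yn]; last by case: eqP => // e; move: yn; rewrite (_ : y = n - z - x)%N ?eqxx; lia.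
rewrite scalerA /c (_ : x + (n - z - x) = n - z)%N; last by lia.
congr (_ *: _); apply: S_perm.
exact: permEl (perm_catCA [:: x%:Z; (n - z - x)%N%:Z] [:: z%:Z] v).
Qed.

(** The added terms have a negative entry and vanish. A common range for j, independent of the row,
    allows the sums over j and over permutations to be exchanged in [Ef_det]. *)
Lemma row_rel_wide v (n J : nat) : (n < J)%N ->
  \sum_(0 <= j < J) rho n j *: Ef j%:Z (n%:Z - j%:Z :: v) = 0.
Proof.
move=> nJ; rewrite (@big_nat_support _ 0 n) //; last first.
  move=> j; rewrite ltn0 orFb => nj; rewrite (@Ef_neg _ _ (n%:Z - j%:Z)) ?scaler0 ?mem_head //.
  by rewrite subr_lt0 ltz_nat.
rewrite -[RHS](row_rel v n); apply: eq_big_nat => j /andP[_ jn].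
by rewrite subzn.
Qed.

Definition Efs (p : nat * seq nat) : V := Ef p.1%:Z (map Posz p.2).

(** The number c is the offset between the index b of delta(e_b) and the first argument of [Ef]; n
    is the total degree before the staircase shift. *)
Definition Efs_low (m : seq nat) (c n : nat) (p : nat * seq nat) : Prop :=
  [/\ sorted leq p.2, size p.2 = size m, pdom p.2 m, p.2 <> m
    & (sumn p.2 + p.1 + c = n)%N].

Lemma Ef_shifted_low m c n j (tau : nat -> nat) : {in gtn (size m) &, injective tau} ->
  (exists2 i, (i < size m)%N & tau i <> i) ->
  (forall x, x + sumn (map tau (iota 0 (size m))) = sumn m + sumn (iota 0 (size m)) ->
     x + j + c = n)%N ->
  lspan (Efs_low m c n) Efs (Ef j%:Z (shifted m tau)).
Proof.
move=> tinj [i im ti] e; case: (shifted_lower tinj) => [[x xs x0]|[w [we sw dw sumE wm]]].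
  by rewrite (Ef_neg _ xs x0); apply: lspan0.
have -> : Ef j%:Z (shifted m tau) = Efs (j, sort leq w).
  by apply: Ef_perm; rewrite we; apply: perm_map; rewrite perm_sym perm_sort.
apply: lspan_gen; split=> /=.
- exact: sort_sorted leq_total _.
- by rewrite size_sort.
- exact: pdom_trans (pdom_sort w) dw.
- move=> swm; apply: ti; apply: wm im; apply: pdom_antisym => //.
  by rewrite -{1}swm; apply: pdom_sort.
- by rewrite (perm_sumn (_ : perm_eq (sort leq w) w)) ?perm_sort //; apply: e.
Qed.

Section RowDeterminant.
Variables (m : seq nat) (t : nat).
Hypothesis tm : (t < size m)%N.

Let o := (size m - t.+1)%N.
Let M l := (nth 0%N m (o + l) + l)%N.

(** The last t + 1 rows of m are expanded as a determinant with columns 0, ..., t - 1 and j: s is a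
    permutation of 0, ..., t whose value t is read as j. *)
Let tj (s : 'S_t.+1) (j l : nat) : nat :=
  if s (inord l) == ord_max then j else s (inord l).

Let tf (s : 'S_t.+1) (j i : nat) : nat := if (i < o)%N then i else (o + tj s j (i - o))%N.

Let D j (s : 'S_t.+1) : V := (\prod_(l < t.+1) rho (M l) (tj s j l)) *: Ef j%:Z (shifted m (tf s j)).

(** Only the row that s sends to t depends on j, and for that row the sum over j is the row
    relation. *)
Let sum_D (s : 'S_t.+1) J : (forall l, l <= t -> M l < J)%N -> \sum_(0 <= j < J) D j s = 0.
Proof.
move=> MJ; pose i0 := (s^-1)%g ord_max.
have si0 : s i0 = ord_max by rewrite permKV.
have tji0 j : tj s j i0 = j by rewrite /tj inord_val si0 eqxx.
have tjl j (l : 'I_t.+1) : l != i0 -> tj s j l = s l.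
  by move=> li; rewrite /tj inord_val -si0 (inj_eq perm_inj) (negbTE li).
pose c := \prod_(l < t.+1 | l != i0) rho (M l) (s l).
pose R := [seq (nth 0%N m i)%:Z + i%:Z - (tf s 0 i)%:Z | i <- rem (o + i0)%N (iota 0 (size m))].
have oi0 : (o + i0)%N \in iota 0 (size m).
  by rewrite mem_iota /=; have := ltn_ord i0; rewrite /o; lia.
transitivity (c *: \sum_(0 <= j < J) rho (M i0) j *: Ef j%:Z ((M i0)%:Z - j%:Z :: R)); last first.
  rewrite row_rel_wide ?scaler0 //; apply: MJ; rewrite -ltnS; exact: ltn_ord.
rewrite scaler_sumr; apply: eq_bigr => j _; rewrite /D (bigD1 i0) //= tji0 mulrC -scalerA.
have -> : \prod_(l < t.+1 | l != i0) rho (M l) (tj s j l) = c.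
  by apply: eq_bigr => l li; rewrite tjl.
congr (_ *: (_ *: _)); apply: Ef_perm.
apply: (perm_trans (perm_map _ (perm_to_rem oi0))) => /=.
have -> : (nth 0%N m (o + i0))%:Z + (o + i0)%N%:Z - (tf s j (o + i0))%:Z = (M i0)%:Z - j%:Z.
  by rewrite /tf ltnNge leq_addr /= addKn tji0 /M !PoszD; ring.
rewrite perm_cons; have -> : [seq (nth 0%N m i)%:Z + i%:Z - (tf s j i)%:Z | i <- rem (o + i0)%N (iota 0 (size m))] = R; last by [].
apply/eq_in_map => i; rewrite mem_rem_uniq ?iota_uniq // inE mem_iota /= => /andP[ioi im].
congr (_ - Posz _); rewrite /tf; case: ltnP => // oi; congr (_ + _)%N; rewrite /tj.
case: eqP => // /(congr1 (s^-1)%g); rewrite permK -/i0 => e; case/eqP: ioi.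
by rewrite -e inordK ?subnKC // ltn_subLR // /o; lia.
Qed.

(** For j < t the column j occurs twice, and exchanging its two occurrences changes only the
    sign. *)
Let sum_D0 j : (j < t)%N -> \sum_(s : 'S_t.+1) (-1) ^+ s *: D j s = 0.
Proof.
move=> jt; have jt' : (j < t.+1)%N by apply: ltnW.
pose p := tperm (ord_max : 'I_t.+1) (Ordinal jt').
have tjp s l : tj (s * p)%g j l = tj s j l.
  rewrite /tj permM; case: (eqVneq (s (inord l)) ord_max) => [->|ne].
    by rewrite tpermL -val_eqE /= ltn_eqF.
  case: (eqVneq (s (inord l)) (Ordinal jt')) => [->|nj]; first by rewrite tpermR eqxx.
  by rewrite tpermD ?(negbTE ne) // eq_sym.
have Dp s : D j (s * p)%g = D j s.
  rewrite /D; congr (_ *: Ef _ _); first by apply: eq_bigr => l _; rewrite tjp.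
  by apply: eq_map => i; rewrite /tf tjp.
set T := \sum_(s : 'S_t.+1) _.
suff TN : T = - T.
  by move/eqP: TN; rewrite -subr_eq0 opprK -mulr2n -scaler_nat scaler_eq0 => /orP[] // /eqP.
rewrite {1}/T (reindex_inj (mulIg p)) -sumrN; apply: eq_bigr => s _ /=.
rewrite Dp odd_permM odd_tperm -val_eqE /= gtn_eqF //= addbT -scaleNr.
by case: (odd_perm s); rewrite ?expr0 ?expr1 ?opprK.
Qed.

Let tjE (s : 'S_t.+1) j (l : 'I_t.+1) : tj s j l = if s l == ord_max then j else s l.
Proof. by rewrite /tj inord_val. Qed.

Let sum_tj (s : 'S_t.+1) j : (t + \sum_(l < t.+1) tj s j l = j + \sum_(l < t.+1) l)%N.
Proof.
pose i0 := (s^-1)%g ord_max; have si0 : s i0 = ord_max by rewrite permKV.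
have -> : (\sum_(l < t.+1) l = \sum_(l < t.+1) s l)%N by rewrite (reindex_inj (@perm_inj _ s)).
rewrite (bigD1 i0) //= [in RHS](bigD1 i0) //= tjE si0 eqxx /= addnCA; congr (_ + (_ + _))%N.
apply: eq_bigr => l li; rewrite tjE -si0 (inj_eq perm_inj) (negbTE li) //.
Qed.

Let sum_tf (s : 'S_t.+1) j :
  (j + sumn (iota 0 (size m)) = t + sumn (map (tf s j) (iota 0 (size m))))%N.
Proof.
have oN : (size m = o + t.+1)%N by rewrite /o subnK.
have iE (f : nat -> nat) : sumn (map f (iota o t.+1)) = (\sum_(l < t.+1) f (o + l))%N.
  rewrite sumnE big_map -[o in iota o _]addn0 iotaDl big_map.
  by rewrite -(big_mkord predT (fun l => f (o + l)%N)) /index_iota subn0.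
rewrite oN iotaD add0n map_cat !sumn_cat.
have -> : map (tf s j) (iota 0 o) = iota 0 o.
  by rewrite -[RHS]map_id; apply/eq_in_map => i; rewrite mem_iota /tf => /andP[_ ->].
have -> : sumn (iota o t.+1) = (\sum_(l < t.+1) (o + l))%N by rewrite -(iE id) map_id.
rewrite iE.
have -> : (\sum_(l < t.+1) tf s j (o + l) = \sum_(l < t.+1) (o + tj s j l))%N.
  by apply: eq_bigr => l _; rewrite /tf ltnNge leq_addr /= addKn.
rewrite !big_split /= addnCA [RHS]addnCA; congr (_ + _)%N.
by rewrite addnCA [RHS]addnCA sum_tj.
Qed.

(** In the signed sum over j and s, the columns j < t cancel. The term j = t, s = 1 is Ef(t, m)
    times the product of the diagonal entries. In all other terms some row leaves its own column,
    which lowers the array by [Ef_shifted_low]. *)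
Lemma Ef_det d : (forall l, (l <= t)%N -> rho (M l) l != 0) ->
  lspan (Efs_low m d (sumn m + t + d)%N) Efs (Efs (t, m)).
Proof.
move=> rM; pose J := (sumn m + size m + t).+1.
have MJ l : (l <= t -> M l < J)%N.
  move=> lt; have : (nth 0 m (o + l) <= sumn m)%N.
    have := mem_nth 0%N (_ : o + l < size m)%N => /(_ (ltac:(rewrite /o; lia))).
    by move/perm_to_rem/perm_sumn => -> /=; rewrite leq_addr.
  by rewrite /M /J; lia.
have tinj s j : (t <= j)%N -> {in gtn (size m) &, injective (tf s j)}.
  move=> tj' a b; rewrite !inE => am bm; rewrite /tf.
  have tjE' l : tj s j l = if s (inord l) == ord_max then j else s (inord l) by [].
  have lt l : (s (inord l) != ord_max -> s (inord l) < t)%N.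
    by move=> h; rewrite ltn_neqAle -ltnS ltn_ord andbT -[t]/(nat_of_ord (@ord_max t)) val_eqE.
  case: ltnP => ao; case: ltnP => bo //; try lia.
  move=> /addnI; have [al bl] : (a - o < t.+1)%N /\ (b - o < t.+1)%N by rewrite /o; lia.
  have inj : inord (a - o) = inord (b - o) :> 'I_t.+1 -> a = b.
    by move/(congr1 (@nat_of_ord _)); rewrite !inordK //; lia.
  rewrite !tjE'; case: eqP => [ea|/eqP ea]; case: eqP => [eb|/eqP eb].
  - by move=> _; apply: inj; apply: (@perm_inj _ s); rewrite ea eb.
  - by move: (lt _ eb) => ? e; move: tj'; rewrite e; lia.
  - by move: (lt _ ea) => ? e; move: tj'; rewrite -e; lia.
  - by move/val_inj/perm_inj/inj.
have : \sum_(0 <= j < J) \sum_(s : 'S_t.+1) (-1) ^+ s *: D j s = 0.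
  rewrite exchange_big big1 // => s _; by rewrite -scaler_sumr sum_D ?scaler0.
rewrite (bigD1_seq t) ?iota_uniq ?mem_index_iota //=; last by rewrite /J; lia.
rewrite (bigD1 1%g) //= odd_perm1 expr0 scale1r -addrA => /eqP; rewrite addr_eq0 => /eqP e.
pose c := \prod_(l < t.+1) rho (M l) l.
have c0 : c != 0 by apply/prodf_neq0 => l _; apply: rM; rewrite -ltnS.
have D1 : D t 1%g = c *: Efs (t, m).
  rewrite /D; congr (_ *: _).
    apply: eq_bigr => l _; rewrite tjE perm1; case: eqP => // ->; by [].
  congr (Ef _ _); rewrite /shifted /=.
  rewrite -[m in RHS](mkseq_nth 0%N) /mkseq -map_comp; apply/eq_in_map => i; rewrite mem_iota => /= im.
  have -> : tf 1%g t i = i; last by rewrite addrK.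
  rewrite /tf; case: ltnP => // oi; rewrite /tj perm1 -val_eqE /= !inordK; last by rewrite /o in oi *; lia.
  by case: eqP => [<-|_]; rewrite subnKC.
rewrite -[Efs _](scalerK c0) -D1 {}e; apply/lspanZ/lspanN/lspanD.
  apply: lspan_sum => s s1; do 2!apply: lspanZ; apply: Ef_shifted_low.
  - exact: tinj.
  - have [l sl] : exists l, s l != l.
      apply/existsP; apply: contraR s1; rewrite negb_exists => /forallP h.
      by apply/eqP/permP => l; rewrite perm1; apply/eqP; have := h l; rewrite negbK.
    exists (o + l)%N; first by have := ltn_ord l; rewrite /o; lia.
    rewrite /tf ltnNge leq_addr /= addKn tjE => /addnI.
    have -> : (if s l == ord_max then t else s l : nat) = s l by case: eqP => // ->.
    by move/val_inj/eqP; apply/negP.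
  - by move=> x; have := sum_tf s t; lia.
rewrite big_seq_cond; apply: lspan_sum => j /andP[_ jt].
have [{}jt|tj'] := ltnP j t; first by rewrite sum_D0 //; apply: lspan0.
apply: lspan_sum => s _; do 2!apply: lspanZ; apply: Ef_shifted_low.
- exact: tinj.
- pose i0 := (s^-1)%g ord_max; have si0 : s i0 = ord_max by rewrite permKV.
  exists (o + i0)%N; first by have := ltn_ord i0; rewrite /o; lia.
  rewrite /tf ltnNge leq_addr /= addKn tjE si0 eqxx => /addnI; have := ltn_ord i0; lia.
- by move=> x; have := sum_tf s j; lia.
Qed.

End RowDeterminant.

End SymmetricArray.

(** * The Jacobi-Trudi map and its leading terms *)

Section JacobiTrudi.
Variables (V : lmodType rat) (S : seq int -> V) (L : lie_algebra) (k : nat).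
Hypothesis S_perm : forall u v, perm_eq u v -> S u = S v.
Hypothesis S_neg : forall u x, x \in u -> x < 0 -> S u = 0.

Definition jtrow (n : nat) (s : seq nat) (f : nat -> nat) : seq int :=
  [seq (nth 0%N s i)%:Z - k%:Z - (f i)%:Z | i <- iota 0 n].

Definition pfun Q (p : 'S_Q.+1) (i : nat) : nat := p (inord i).

(* A Jacobi-Trudi determinant: it represents the exterior algebra on symmetric
   arrays, where leading terms of products e ... e (delta e) become visible. *)
Definition jtdet Q (s : seq nat) : V :=
  if size s == Q.+1 then \sum_(p : 'S_Q.+1) (-1) ^+ p *: S (jtrow Q.+1 s (pfun p)) else 0.

Lemma pfun_inj Q (p : 'S_Q.+1) : {in gtn Q.+1 &, injective (pfun p)}.
Proof.
move=> i j; rewrite !inE => iQ jQ /val_inj/perm_inj /(congr1 (@nat_of_ord _)).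
by rewrite !inordK.
Qed.

Lemma jtrow_ord Q s (f : nat -> nat) :
  jtrow Q.+1 s f = [seq (nth 0%N s i)%:Z - k%:Z - (f i)%:Z | i : 'I_Q.+1].
Proof. by rewrite /jtrow -val_enum_ord -map_comp. Qed.

Lemma jtdet_alternating Q : alternating (jtdet Q).
Proof.
move=> u x y v; rewrite /jtdet !size_cat /=; case: eqP => [sz|_]; last by rewrite oppr0.
have i0Q : (size u < Q.+1)%N by rewrite -sz; lia.
have i1Q : ((size u).+1 < Q.+1)%N by rewrite -sz; lia.
pose t := tperm (Ordinal i0Q) (Ordinal i1Q).
have ltnS_false : ((size u).+1 < size u)%N = false by rewrite ltnNge leqnSn.
have nthE (i : 'I_Q.+1) : nth 0%N (u ++ x :: y :: v) i = nth 0%N (u ++ y :: x :: v) (t i).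
  rewrite /t; case: tpermP => [->|->|/eqP n0 /eqP n1] /=.
  - by rewrite !nth_cat ltnn subnn ltnS_false subSnn.
  - by rewrite !nth_cat ltnn subnn ltnS_false subSnn.
  - rewrite !nth_cat; case: ltnP => // ui; move: n0 n1; rewrite -!val_eqE /= => n0 n1.
    by case E: (i - size u)%N => [|[|j]] //; lia.
rewrite (reindex_inj (mulgI t)) -sumrN; apply: eq_bigr => p _ /=.
rewrite odd_permM odd_tperm -val_eqE /= ltn_eqF //= -scaleNr.
have -> : (-1) ^+ (~~ odd_perm p) = - (-1) ^+ odd_perm p :> rat.
  by case: (odd_perm p); rewrite ?expr0 ?expr1 ?opprK.
congr (_ *: _); apply: S_perm; rewrite !jtrow_ord.
have te : perm_eq (map t (enum 'I_Q.+1)) (enum 'I_Q.+1).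
  apply: uniq_perm; [by rewrite map_inj_uniq ?enum_uniq //; exact: perm_inj | exact: enum_uniq |].
  by move=> i; rewrite mem_enum; apply/mapP; exists (t i); rewrite ?mem_enum // tpermK.
apply: perm_trans (perm_map _ te); rewrite -map_comp; set l1 := (X in perm_eq X _); set l2 := (X in perm_eq _ X).
suff -> : l1 = l2 by [].
by apply: eq_map => i /=; rewrite nthE /pfun !inord_val permM.
Qed.

Lemma jtdet_small Q s x : x \in s -> (x < k)%N -> jtdet Q s = 0.
Proof.
move=> xs xk; rewrite /jtdet; case: eqP => // sz; apply: big1 => p _.
have ix : (index x s < Q.+1)%N by rewrite -sz index_mem.
rewrite (S_neg (x := x%:Z - k%:Z - (pfun p (index x s))%:Z)) ?scaler0 //; last lia.
by apply/mapP; exists (index x s); rewrite ?mem_iota // nth_index.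
Qed.

(** After the shift by k + c and k + c' the terms x and n - x have the same array, and [mu_chi] adds
    their coefficients to mu(c' - c) chi. The cutoff at k takes care of itself, because arrays with
    a negative entry vanish. *)
Lemma pair_sum (v : seq int) (M b : nat) (c c' : nat) : (b < M)%N ->
  \sum_(0 <= x < M) \sum_(0 <= y < M | (x + y == b)%N)
    mu L (y%:Z - x%:Z) *: S [:: x%:Z - k%:Z - c%:Z, y%:Z - k%:Z - c'%:Z & v] =
  mu L (c'%:Z - c%:Z) *: Ef S L (b%:Z - (k.*2)%:Z - c%:Z - c'%:Z) v.
Proof.
move=> bM; pose F x := mu L ((b - x)%N%:Z - x%:Z) *:
  S [:: x%:Z - k%:Z - c%:Z, (b - x)%N%:Z - k%:Z - c'%:Z & v].
transitivity (\sum_(0 <= x < b.+1) F x).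
  rewrite (@big_nat_support _ 0 b) //; last first.
    move=> x; rewrite ltn0 orFb => bx; rewrite big_mkcond big1 // => y _.
    by case: eqP => // e; lia.
  apply: eq_big_nat => x /andP[_ xb]; rewrite big_mkcond (bigD1_seq (b - x)%N) ?iota_uniq //=; last first.
    by rewrite mem_index_iota; lia.
  rewrite (_ : x + (b - x) == b)%N; last by lia.
  rewrite big1 ?addr0 // => y /eqP yb; case: eqP => // e.
  by case: yb; lia.
have F0 x : (x < k + c)%N || (b < x + k + c')%N -> (x <= b)%N -> F x = 0.
  move=> h xb; rewrite /F; have [xk|kx] := ltnP x (k + c).
    by rewrite (S_neg (x := x%:Z - k%:Z - c%:Z)) ?scaler0 ?mem_head //; lia.
  rewrite (S_neg (x := (b - x)%N%:Z - k%:Z - c'%:Z)) ?scaler0 // ?inE ?eqxx ?orbT //; lia.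
have [neg|pos] := ltnP b (k.*2 + c + c').
  rewrite [RHS](_ : _ = 0); last first.
    case E: (b%:Z - _ - _ - _) => [n|n]; [lia | exact: scaler0].
  by rewrite big_nat big1 // => x /andP[_ xb]; apply: F0; lia.
pose n := (b - (k.*2 + c + c'))%N.
have -> : b%:Z - (k.*2)%:Z - c%:Z - c'%:Z = n%:Z by rewrite /n; lia.
have -> : \sum_(0 <= x < b.+1) F x = \sum_(0 <= x < n.+1) F (x + (k + c))%N.
  rewrite (@big_cat_nat _ _ _ (k + c)) //=; last by lia.
  rewrite big_nat big1 ?add0r; last by move=> x /andP[_ xk]; apply: F0; lia.
  rewrite (@big_cat_nat _ _ _ (n.+1 + (k + c))) //=; [|lia|rewrite /n; lia].
  rewrite [X in _ + X]big_nat [X in _ + X]big1 ?addr0; last first.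
    by move=> x /andP[xn xb]; apply: F0; rewrite /n in xn *; lia.
  by rewrite -{1}[(k + c)%N]add0n big_addn addnK.
pose G (x y : nat) := S [:: x%:Z, y%:Z & v].
have GC x y : G x y = G y x.
  by apply: S_perm; exact: permEl (perm_catCA [:: x%:Z] [:: y%:Z] v).
pose g := c'%:Z - c%:Z.
have -> : \sum_(0 <= x < n.+1) F (x + (k + c))%N =
    \sum_(0 <= x < n.+1) mu L ((n - x)%N%:Z - x%:Z + g) *: G x (n - x)%N.
  apply: eq_big_nat => x /andP[_ xn]; rewrite /F /G /g.
  by congr (mu L _ *: S [:: _, _ & v]); rewrite /n in xn *; lia.
apply: (scalerI (_ : 2%:R != 0 :> rat)) => //.
rewrite [LHS]scaler_nat mulr2n {2}big_nat_rev /= add0n -big_split /= /Ef.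
rewrite [RHS]scalerA [RHS]scalerA [X in X *: _](_ : _ = mu L g); last by rewrite mulrC mulKf.
rewrite scaler_sumr.
apply: eq_big_nat => x /andP[_ xn]; rewrite subSS subKn // GC -scalerDl scalerA -mu_chi.
congr (_ *: _); last by rewrite GC.
by rewrite [RHS]addrC; congr (mu L _ + mu L _); lia.
Qed.

Lemma jtrow_cat2 (a : seq nat) (x y : nat) f :
  jtrow (size a).+2 (a ++ [:: x; y]) f =
  jtrow (size a) a f ++ [:: x%:Z - k%:Z - (f (size a))%:Z; y%:Z - k%:Z - (f (size a).+1)%:Z].
Proof.
rewrite /jtrow -addn2 iotaD map_cat add0n /= !nth_cat ltnn subnn ltnNge leqnSn subSnn /=.
congr (_ ++ _); apply/eq_in_map => i; rewrite mem_iota => /andP[_ ia].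
by rewrite nth_cat ia.
Qed.

Variables (A : exterior) (phi : {linear A -> V}) (N : nat).
Hypothesis phiE : forall s, phi (emon A s) = jtdet N.+1 s.

Lemma phi_gen_ge2 (a : seq nat) (x y : nat) :
  phi (ext_mul (emon A a) (ext_mul (gen_ge A k x) (gen_ge A k y))) = jtdet N.+1 (a ++ [:: x; y]).
Proof.
rewrite /gen_ge; case: leqP => kx; last first.
  rewrite emul0l emul0r linear0 (@jtdet_small _ _ x) //.
  by rewrite mem_cat mem_head orbT.
case: leqP => ky; last first.
  rewrite emul0r emul0r linear0 (@jtdet_small _ _ y) //.
  by rewrite mem_cat !inE eqxx !orbT.
by rewrite -phiE emon_cat emon_cons emon1.
Qed.

Lemma phi_ed (a : seq nat) (b : nat) : size a = N -> phi (tmon A L k (a, [:: b])) =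
  2%:R^-1 *: \sum_(p : 'S_N.+2) (-1) ^+ p *:
    (mu L ((pfun p N.+1)%:Z - (pfun p N)%:Z) *:
      Ef S L (b%:Z - (k.*2)%:Z - (pfun p N)%:Z - (pfun p N.+1)%:Z) (jtrow N a (pfun p))).
Proof.
move=> aN; rewrite /tmon /= dprod_cons /dprod /= ext_1mul (@dgenE A L k b b.+1) //.
rewrite emulZr linearZ; congr (_ *: _); rewrite emul_sumr linear_sum.
under [RHS]eq_bigr => p _ do rewrite -(pair_sum _ _ _ (ltnSn b)) scaler_sumr.
rewrite [RHS]exchange_big; apply: eq_bigr => x _.
under [RHS]eq_bigr => p _ do rewrite scaler_sumr.
rewrite [RHS]exchange_big emul_sumr linear_sum; apply: eq_bigr => y _.
rewrite emulZr linearZ phi_gen_ge2 /jtdet size_cat aN addn2 eqxx.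
rewrite /= scaler_sumr; apply: eq_bigr => p _; rewrite !scalerA [in RHS]mulrC.
congr (_ *: _); apply: S_perm; have := jtrow_cat2 a x y (pfun p); rewrite aN => ->.
by rewrite perm_catC.
Qed.

(** The staircase shift turns weakly increasing arrays into strictly increasing parts at least k and
    preserves dominance; the diagonal term of the determinant of [shift m] is m. *)
Definition shift (m : seq nat) : seq nat := [seq (nth 0 m i + i + k)%N | i <- iota 0 (size m)].

Lemma size_shift m : size (shift m) = size m.
Proof. by rewrite size_map size_iota. Qed.

Lemma nth_shift m i : (i < size m)%N -> nth 0%N (shift m) i = (nth 0 m i + i + k)%N.
Proof. by move=> im; rewrite (nth_map 0%N) ?size_iota // nth_iota. Qed.

Lemma jtrow_shift m f : jtrow (size m) (shift m) f = shifted m f.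
Proof.
apply/eq_in_map => i; rewrite mem_iota => /andP[_ im].
by rewrite nth_shift // !PoszD addrK.
Qed.

Lemma sumn_pfun2 (p : 'S_N.+2) :
  (sumn (map (pfun p) (iota 0 N)) + pfun p N + pfun p N.+1 = sumn (iota 0 N) + N.*2.+1)%N.
Proof.
have e : sumn (map (pfun p) (iota 0 N.+2)) = sumn (iota 0 N.+2).
  have sE f : sumn (map f (iota 0 N.+2)) = (\sum_(i < N.+2) f i)%N.
    by rewrite sumnE big_map -(big_mkord predT f) /index_iota subn0.
  rewrite sE -[iota 0 N.+2]map_id sE [RHS](reindex_inj (@perm_inj _ p)).
  by apply: eq_bigr => i _; rewrite /pfun inord_val.
have i2 : iota 0 N.+2 = iota 0 N ++ [:: N; N.+1] by rewrite -addn2 iotaD.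
by move: e; rewrite i2 map_cat !sumn_cat /= !addn0; lia.
Qed.

(** A permutation that moves one of the first N rows lowers the array. The other two are the
    identity and the exchange of N and N + 1; their terms agree, as mu(-1) = -1 offsets the sign,
    and together they cancel the factor 1/2. The offset 2N + 1 + 2k is N + (N + 1) plus one k for
    each of the two parts of delta(e_b). *)
Lemma phi_ed_lead (m : seq nat) (b : nat) : size m = N ->
  lspan (Efs_low m (N.*2.+1 + k.*2) (sumn m + b)) (Efs S L)
   (phi (tmon A L k (shift m, [:: b])) - Ef S L (b%:Z - (N.*2.+1 + k.*2)%N%:Z) (map Posz m)).
Proof.
move=> mN; rewrite phi_ed ?size_shift //.
pose F (p : 'S_N.+2) := (-1) ^+ p *: (mu L ((pfun p N.+1)%:Z - (pfun p N)%:Z) *: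
      Ef S L (b%:Z - (k.*2)%:Z - (pfun p N)%:Z - (pfun p N.+1)%:Z) (shifted m (pfun p))).
rewrite (eq_bigr F); last by move=> p _; rewrite /F -jtrow_shift mN.
pose C (p : 'S_N.+2) := all (fun i => pfun p i == i) (iota 0 N).
rewrite (bigID C) /= scalerDr addrAC; apply: lspanD; last first.
  apply/lspanZ/lspan_sum => p /allPn[i]; rewrite mem_iota /= => iN /eqP pi.
  do 2!apply: lspanZ; case E: (b%:Z - _ - _ - _) => [j|j]; last exact: lspan0.
  apply: Ef_shifted_low => //.
  - by rewrite mN; apply: sub_in2 (@pfun_inj _ p) => x; rewrite !inE; lia.
  - by exists i; rewrite ?mN.
  - by rewrite mN => x ex; have := sumn_pfun2 p; lia.
suff -> : \sum_(p | C p) F p = 2%:R *: Ef S L (b%:Z - (N.*2.+1 + k.*2)%N%:Z) (map Posz m).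
  by rewrite scalerA mulVf // scale1r subrr; apply: lspan0.
have i0 : inord N = Ordinal (ltnW (ltnSn N.+1)) :> 'I_N.+2 by apply/val_inj; rewrite /= inordK.
have i1 : inord N.+1 = ord_max :> 'I_N.+2 by apply/val_inj; rewrite /= inordK.
set o0 := Ordinal _ in i0; pose t := tperm o0 (ord_max : 'I_N.+2).
have Fid (p : 'S_N.+2) : C p -> shifted m (pfun p) = map Posz m.
  move=> /allP Cp; rewrite -[m in RHS](mkseq_nth 0%N) /mkseq -map_comp.
  apply/eq_in_map => i; rewrite mem_iota mN /= => iN.
  have /eqP -> : pfun p i == i by apply: Cp; rewrite mem_iota.
  by rewrite addrK.
have C1 : C 1%g.
  by apply/allP => i; rewrite mem_iota /pfun perm1 => iN; rewrite inordK //; lia.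
have Ct : C t.
  apply/allP => i; rewrite mem_iota /= => iN; rewrite /pfun tpermD ?inordK //; try lia.
    by rewrite -val_eqE /= inordK; lia.
  by rewrite -val_eqE /= inordK; lia.
have F1 : F 1%g = Ef S L (b%:Z - (N.*2.+1 + k.*2)%N%:Z) (map Posz m).
  rewrite /F Fid // odd_perm1 expr0 scale1r /pfun i0 i1 !perm1 /=.
  rewrite (_ : N.+1%:Z - N%:Z = 1); last by lia.
  rewrite (_ : mu L 1 = 1); last by case: (L).
  by rewrite scale1r; congr (Ef _ _ _ _); lia.
have Ft : F t = Ef S L (b%:Z - (N.*2.+1 + k.*2)%N%:Z) (map Posz m).
  rewrite /F Fid // odd_tperm -val_eqE /= (ltn_eqF (ltnSn N)) /= expr1 /pfun i0 i1.
  rewrite /t tpermL tpermR /= (_ : N%:Z - N.+1%:Z = - 1); last by lia.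
  rewrite (_ : mu L (- 1) = - 1); last by case: (L).
  by rewrite !scaleN1r opprK; congr (Ef _ _ _ _); lia.
rewrite (bigD1 1%g) //= (bigD1 t) ?Ct //=; last first.
  by apply/eqP => /permP /(_ o0); rewrite perm1 tpermL => /(congr1 (@nat_of_ord _)) /=; lia.
rewrite big1 ?addr0 ?F1 ?Ft; first by rewrite -mulr2n scaler_nat.
move=> p /andP[/andP[/allP Cp p1] pt]; exfalso.
have fixp (i : 'I_N.+2) : (i < N)%N -> p i = i.
  move=> iN; apply/val_inj; have /eqP : pfun p i == i by apply: Cp; rewrite mem_iota.
  by rewrite /pfun inord_val.
have pge (i : 'I_N.+2) : (N <= i)%N -> (N <= p i)%N.
  rewrite leqNgt => iN; rewrite leqNgt; apply: contra iN => piN.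
  by have := perm_inj (fixp _ piN) => <-.
have two (i : 'I_N.+2) : (N <= i)%N -> i = o0 \/ i = ord_max.
  move=> Ni; have := ltn_ord i; rewrite ltnS leq_eqVlt => /orP[/eqP e|e].
    by right; apply/val_inj.
  by left; apply/val_inj => /=; lia.
have [p0|p0] := two _ (pge o0 (leqnn _)).
  case/eqP: p1; apply/permP => i; rewrite perm1.
  have [iN|iN] := ltnP i N; first exact: fixp.
  have [->//|->] := two i iN; have [pm|//] := two _ (pge ord_max (leqnSn N)).
  by have := @perm_inj _ p ord_max o0; rewrite pm p0 => /(_ erefl) /(congr1 (@nat_of_ord _)) /=; lia.
case/eqP: pt; apply/permP => i; have [iN|iN] := ltnP i N.
  by rewrite fixp // tpermD //; rewrite -val_eqE /=; lia.
have [->|->] := two i iN; first by rewrite tpermL.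
have [pm|pm] := two _ (pge ord_max (leqnSn N)); first by rewrite tpermR.
by have := @perm_inj _ p ord_max o0; rewrite pm p0 => /(_ erefl) /(congr1 (@nat_of_ord _)) /=; lia.
Qed.

Lemma sumn_mapD (f g : nat -> nat) l :
  sumn [seq (f i + g i)%N | i <- l] = (sumn (map f l) + sumn (map g l))%N.
Proof. by elim: l => //= i l ->; lia. Qed.

Lemma take_shift m l : take l (shift m) = [seq (nth 0 m i + (i + k))%N | i <- iota 0 (minn l (size m))].
Proof. by rewrite /shift -map_take take_iota; apply: eq_map => i; rewrite addnA. Qed.

Lemma take_nthE (m : seq nat) l : take l m = map (nth 0%N m) (iota 0 (minn l (size m))).
Proof. by rewrite -take_iota map_take map_nth_iota0 // take_size. Qed.

Lemma sumn_take_shift m l : sumn (take l (shift m)) =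
  (sumn (take l m) + sumn [seq (i + k)%N | i <- iota 0 (minn l (size m))])%N.
Proof. by rewrite take_shift sumn_mapD take_nthE. Qed.

Lemma sumn_shift m :
  sumn (shift m) = (sumn m + sumn [seq (i + k)%N | i <- iota 0 (size m)])%N.
Proof.
by have := sumn_take_shift m (size m); rewrite -{1}(size_shift m) !take_size minnn.
Qed.

Lemma pdom_shift m m' : size m = size m' -> pdom (shift m) (shift m') <-> pdom m m'.
Proof. by move=> e; split=> h l; have := h l; rewrite !sumn_take_shift e leq_add2r. Qed.

Lemma sorted_shift m : sorted leq m -> sorted ltn (shift m).
Proof.
move=> sm; apply/(sortedP 0%N) => i; rewrite size_shift => im.
rewrite !nth_shift //; last exact: ltnW.
have := sorted_leq_nth leq_trans leqnn 0%N sm i i.+1; rewrite !inE im (ltnW im) leqnSn => /(_ isT isT isT).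
by rewrite /=; lia.
Qed.

(** The index b' is left free: for b' <= 2k the monomial is zero. *)
Definition edspan (a : seq nat) (s : nat) (p : seq nat * seq nat) : Prop :=
  exists a' b', [/\ p = (a', [:: b']), sorted ltn a', size a' = size a, all (leq k) a'
    & pdom a' a /\ (sumn a' + b')%N = s].

(** This inverts the triangular expansion [phi_ed_lead], by induction on the weight of m. *)
Lemma Ef_span (m : seq nat) (n : nat) : sorted leq m -> size m = N ->
  lspan (edspan (shift m) (sumn (shift m) + (n + (N.*2.+1 + k.*2)))%N)
    (fun p => phi (tmon A L k p)) (Efs S L (n, m)).
Proof.
move: {2}(weight m) (erefl (weight m)) => w; elim/ltn_ind: w m n => w IH m n wm sm mN.
pose b := (n + (N.*2.+1 + k.*2))%N.
have := phi_ed_lead b mN; rewrite (_ : b%:Z - _ = n%:Z); last by rewrite /b; lia.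
move=> low; rewrite -[Efs S L _](subKr (phi (tmon A L k (shift m, [:: b])))).
apply: lspanD.
  apply: (@lspan_gen _ _ _ (fun p => phi (tmon A L k p))); exists (shift m), b; split=> //.
  - exact: sorted_shift.
  - by apply/allP => x /mapP[i _ ->]; rewrite leq_addl.
  - by split; [exact: pdom_refl | rewrite /b].
apply: lspanN; apply: lspan_trans low => -[n' m'] [/= sm' m'm dm nm e].
have wlt : (weight m' < w)%N by rewrite -wm; apply: pdom_weight.
have := IH _ wlt m' n' erefl sm' (etrans m'm mN); apply: lspan_sub.
move=> p [a' [b' [-> sa sz ka [da e']]]]; exists a', b'; split=> //.
  by rewrite sz !size_shift.
split; first by apply: pdom_trans da _; apply/pdom_shift.
by rewrite e' !sumn_shift m'm; rewrite /b in e; lia.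
Qed.

Lemma rho_neq0 n x : (3 * x < 2 * n)%N -> rho L n x != 0.
Proof.
move=> xn; rewrite /rho; have h : 2%:R * n%:R - 3%:R * x%:R != 0 :> rat.
  by rewrite subr_eq0 -!natrM eqr_nat gtn_eqF.
by case: (L) => //; case: ifP.
Qed.

Lemma phi_main (a : seq nat) (b : nat) : size a = N -> (0 < N)%N ->
  sorted (fun x y => x + 3 <= y)%N a -> all (leq k) a -> (b <= k.*2 + 3 * N)%N ->
  (k < nth 0 a 0)%N \/ (b < k.*2 + 3 * N)%N ->
  lspan (fun p => edspan a (sumn a + b) p /\ p.1 <> a)
    (fun p => phi (tmon A L k p)) (phi (tmon A L k (a, [:: b]))).
Proof.
move=> aN N0 ga ka bN kb.
have an i : (i < N)%N -> (nth 0 a 0 + 3 * i <= nth 0 a i)%N.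
  elim: i => [|i IH] iN; first by rewrite muln0 addn0.
  have := (sortedP 0%N ga) i; rewrite aN => /(_ iN); have := IH (ltnW iN); lia.
have k0 : (k <= nth 0 a 0)%N by apply: (allP ka); rewrite mem_nth ?aN.
pose m := [seq (nth 0 a i - i - k)%N | i <- iota 0 N].
have mN : size m = N by rewrite size_map size_iota.
have nm i : (i < N)%N -> nth 0%N m i = (nth 0 a i - i - k)%N.
  by move=> iN; rewrite (nth_map 0%N) ?size_iota // nth_iota.
have am : a = shift m.
  apply: (eq_from_nth (x0 := 0%N)); rewrite ?size_shift ?mN // => i; rewrite aN => iN.
  by rewrite nth_shift ?mN // nm //; have := an i iN; lia.
have sm : sorted leq m.
  apply/(sortedP 0%N) => i; rewrite mN => iN; rewrite !nm //; last exact: ltnW.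
  by have := (sortedP 0%N ga) i; rewrite aN => /(_ iN); lia.
have := phi_ed_lead b mN; rewrite -am; set c := (N.*2.+1 + k.*2)%N.
move=> low; rewrite -[phi _](subrK (Ef S L (b%:Z - c%:Z) [seq Posz i | i <- m])).
have {}low : lspan (Efs_low m c (sumn m + b)) (Efs S L) (phi (tmon A L k (a, [:: b])) -
      Ef S L (b%:Z - c%:Z) [seq Posz i | i <- m] +
      Ef S L (b%:Z - c%:Z) [seq Posz i | i <- m]).
  (* For b < c the first argument of the leading [Ef] is negative and the term is already 0. *)
  apply: lspanD => //; have [bs|sb] := ltnP b c.
    case E: (b%:Z - _) => [j|j]; [lia | exact: lspan0].
  pose t := (b - c)%N.
  rewrite (_ : b%:Z - _ = t%:Z); last by rewrite /t; lia.
  have -> : (sumn m + b = sumn m + t + c)%N by rewrite /t; lia.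
  have tN : (t < size m)%N by rewrite mN /t /c; lia.
  apply: (Ef_det S_perm S_neg tN) => l lt; apply: rho_neq0.
  have lN : (N - t.+1 + l < N)%N by rewrite mN in tN; lia.
  (* What is required is l < 2 m_i for i = N - t - 1 + l; this follows from m_i >= a_0 - k + 2i,
     except for l = 0, t = N - 1, where [kb] gives a_0 > k. *)
  rewrite mN nm //; have := an _ lN; rewrite mN /t /c in tN lt *; lia.
apply: lspan_trans low => -[n' m'] [/= sm' m'm dm nmm e].
apply: lspan_sub (Ef_span n' sm' (etrans m'm mN)) => p [a' [b' [-> sa sz ka' [da e']]]].
have da' : pdom a' a by rewrite am; apply: pdom_trans da _; apply/pdom_shift.
split; last first.
  move=> /= ea; apply: nmm; apply: pdom_antisym => //; apply/pdom_shift => //.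
  by rewrite -am -ea.
exists a', b'; split=> //; first by rewrite sz am !size_shift.
split=> //; rewrite e' am !sumn_shift m'm; rewrite /c in e; lia.
Qed.

End JacobiTrudi.

(** * The main relation *)

(** The free module on sorted arrays, with the coordinates [cf] needed to prove the Jacobi-Trudi map
    injective. *)
Lemma symmetric_array_model : exists (V : lmodType rat) (S : seq int -> V) (cf : seq nat -> V -> rat),
  [/\ forall u v, perm_eq u v -> S u = S v,
      forall u x, x \in u -> x < 0 -> S u = 0,
      forall w (a : rat) x y, cf w (a *: x + y) = a * cf w x + cf w y
    & forall w u, cf w (S (map Posz u)) = (sort leq u == w)%:R].
Proof.
pose S (u : seq int) : {malg rat[seq nat]} :=
  if all (fun x : int => 0 <= x) u then << sort leq (map absz u) >> else 0.
exists {malg rat[seq nat]}, S, (fun w x => x@_w); split.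
- move=> u v uv; rewrite /S (perm_all _ uv); case: ifP => // _.
  have -> : sort leq (map absz u) = sort leq (map absz v); last exact: erefl.
  by apply/(perm_sortP leq_total leq_trans anti_leq)/perm_map.
- move=> u x xu x0; rewrite /S ifF //; apply/negP => /allP /(_ _ xu).
  by rewrite leNgt x0.
- by move=> w a x y; rewrite mcoeffD mcoeffZ.
move=> w u; rewrite /S ifT; last by apply/allP => x /mapP[i _ ->].
have -> : map absz (map Posz u) = u by rewrite -map_comp map_id.
by rewrite mcoeffU.
Qed.

Lemma seq_max (T : eqType) (f : T -> nat) (s : seq T) x : x \in s ->
  exists2 y, y \in s & forall z, z \in s -> (f z <= f y)%N.
Proof.
elim: s x => // a s IH x _; case: s IH => [_|b s IH].
  by exists a; rewrite ?mem_head // => z; rewrite inE => /eqP ->.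
have [y ys my] := IH b (mem_head _ _); have [fay|fya] := leqP (f a) (f y).
  exists y; first by rewrite inE ys orbT.
  by move=> z; rewrite inE => /predU1P[->|/my].
exists a; rewrite ?mem_head // => z; rewrite inE => /predU1P[->//|/my zy].
exact: leq_trans zy (ltnW fya).
Qed.

Lemma strict_shift k s : sorted ltn s -> all (leq k) s -> exists2 m, sorted leq m & s = shift k m.
Proof.
move=> ss ks; have sn i : (i < size s)%N -> (k + i <= nth 0 s i)%N.
  elim: i => [|i IH] im; first by rewrite addn0; apply: (allP ks); rewrite mem_nth.
  by have := (sortedP 0%N ss) i im; have := IH (ltnW im); lia.
exists [seq (nth 0 s i - i - k)%N | i <- iota 0 (size s)].
  apply/(sortedP 0%N) => i; rewrite size_map size_iota => im.
  rewrite !(nth_map 0%N) ?size_iota ?(ltnW im) // !nth_iota ?(ltnW im) // !add0n.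
  by have := (sortedP 0%N ss) i im; lia.
apply: (eq_from_nth (x0 := 0%N)); rewrite ?size_shift ?size_map ?size_iota // => i im.
rewrite nth_shift ?size_map ?size_iota // (nth_map 0%N) ?size_iota // nth_iota // add0n.
by have := sn i im; lia.
Qed.

Section MainRelation.
Variables (A : exterior) (L : lie_algebra) (k : nat).

Section Injectivity.
Variables (V : lmodType rat) (S : seq int -> V) (cf : seq nat -> V -> rat).
Hypothesis S_perm : forall u v, perm_eq u v -> S u = S v.
Hypothesis S_neg : forall u x, x \in u -> x < 0 -> S u = 0.
Hypothesis cfD : forall w (a : rat) x y, cf w (a *: x + y) = a * cf w x + cf w y.
Hypothesis cfS : forall w u, cf w (S (map Posz u)) = (sort leq u == w)%:R.

Let cf0 w : cf w 0 = 0.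
Proof. by have := cfD w 1 0 0; rewrite scaler0 addr0 mul1r => /eqP; rewrite eq_sym addrC -subr_eq0 addrK => /eqP. Qed.

Let cf_sum w (I : Type) (r : seq I) (c : I -> rat) (F : I -> V) :
  cf w (\sum_(i <- r) c i *: F i) = \sum_(i <- r) c i * cf w (F i).
Proof. by elim: r => [|i r IH]; rewrite ?big_nil ?cf0 // !big_cons cfD IH. Qed.

(** Among the monomials with nonzero coefficient take s0 = shift m0 of maximal weight. The array m0
    can arise from another monomial only if that one strictly dominates s0, and from s0 only by the
    identity permutation; so its coefficient in phi x is that of s0. *)
Lemma phi_inj Q (phi : {linear A -> V}) x :
  (forall s, phi (emon A s) = jtdet S k Q s) ->
  lspan (fun s => [/\ sorted ltn s, size s = Q.+1 & all (leq k) s]) (emon A) x ->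
  phi x = 0 -> x = 0.
Proof.
move=> phiE [X [c [XP ->]]]; rewrite linear_sum => phi0.
have {phi0} phi0 : \sum_(s <- X) c s *: jtdet S k Q s = 0.
  by rewrite -[RHS]phi0; apply: eq_bigr => s _; rewrite linearZ /= phiE.
suff c0 s : s \in X -> c s = 0.
  by rewrite big_seq big1 // => s /c0 ->; rewrite scale0r.
move=> sX; apply/eqP; apply: contraT => cs; exfalso.
have := @seq_max _ weight [seq s <- X | c s != 0] s; rewrite mem_filter cs sX => /(_ isT).
case=> s0; rewrite mem_filter => /andP[cs0 s0X] max0.
have [ss0 sz0 ks0] := XP _ s0X; have [m0 sm0 e0] := strict_shift ss0 ks0.
have szm0 : size m0 = Q.+1 by rewrite -sz0 e0 size_shift.
have := congr1 (cf m0) phi0; rewrite cf_sum cf0 (bigD1_seq s0) ?fset_uniq //= => h.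
case/eqP: cs0; rewrite -{}h.
have term s1 m1 (p : 'S_Q.+1) : s1 = shift k m1 -> size m1 = Q.+1 ->
    cf m0 (S (jtrow k Q.+1 s1 (pfun p))) != 0 ->
    [/\ pdom m0 m1 & m0 = m1 -> p = 1%g].
  move=> -> szm1; have := jtrow_shift k m1 (pfun p); rewrite szm1 => ->.
  have pinj : {in gtn (size m1) &, injective (pfun p)} by rewrite szm1; exact: pfun_inj.
  case: (shifted_lower pinj) => [[y ys y0]|[w [-> sw dw _ wm]]].
    by rewrite (S_neg ys y0) cf0 eqxx.
  rewrite cfS; have [e _|] := eqVneq (sort leq w) m0; last by rewrite eqxx.
  have dm0 : pdom m0 w by rewrite -e; apply: pdom_sort.
  split; first exact: pdom_trans dw.
  move=> m01; have {}wm := wm (pdom_antisym sw dw (_ : pdom m1 w)).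
  apply/permP => i; rewrite perm1; apply/val_inj.
  by rewrite -[RHS](wm _ i) -?m01 // ?szm0 // /pfun inord_val.
rewrite [X in _ + X]big1_seq ?addr0; last first.
  move=> s1 /andP[s10 s1X]; have [->|cs1] := eqVneq (c s1) 0; first by rewrite mul0r.
  have [ss1 sz1 ks1] := XP _ s1X; have [m1 sm1 e1] := strict_shift ss1 ks1.
  rewrite /jtdet sz1 eqxx cf_sum big1 ?mulr0 // => p _.
  apply/eqP; rewrite mulf_eq0; apply/orP; right; apply/negPn/negP => h.
  have szm1 : size m1 = Q.+1 by rewrite -sz1 e1 size_shift.
  have [d01 _] := term s1 m1 p e1 szm1 h.
  have := max0 s1; rewrite mem_filter cs1 s1X => /(_ isT); rewrite leqNgt; apply/negP/negPn.
  apply: pdom_weight; rewrite ?sz0 ?sz1 //; last by apply/nesym/eqP.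
  by rewrite e0 e1; apply/pdom_shift; rewrite ?szm0 ?szm1.
rewrite /jtdet sz0 eqxx cf_sum (bigD1 1%g) //= odd_perm1 expr0 mul1r big1 ?addr0 //; last first.
  move=> p p1; apply/eqP; rewrite mulf_eq0; apply/orP; right; apply/negPn/negP => h.
  by have [_ /(_ erefl) e] := term s0 m0 p e0 szm0 h; rewrite e eqxx in p1.
have -> : jtrow k Q.+1 s0 (pfun (1%g : 'S_Q.+1)) = map Posz m0.
  have jt (p : 'S_Q.+1) : jtrow k Q.+1 s0 (pfun p) = shifted m0 (pfun p).
    by rewrite e0; have := jtrow_shift k m0 (pfun p); rewrite szm0.
  rewrite jt.
  rewrite -[m0 in RHS](mkseq_nth 0%N) /mkseq -map_comp.
  apply/eq_in_map => i; rewrite mem_iota /= szm0 => iQ.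
  by rewrite /pfun perm1 inordK // addrK.
by rewrite cfS sorted_sort ?eqxx ?mulr1 //; exact: leq_trans.
Qed.

End Injectivity.

Lemma lspan_emon_gen (P : seq nat -> Prop) x K : lspan P (emon A) x ->
  lspan (fun s => exists2 t, P t & s = K ++ t) (emon A) (ext_mul (emon A K) x).
Proof.
apply: (lspan_map (h := mulr (emon A K))) => t Pt.
by rewrite /= /mulr -emon_cat; apply: lspan_gen; exists t.
Qed.

Lemma lspan_dgen d :
  lspan (fun s => [/\ size s = 2, all (leq k) s & sumn s = d]) (emon A) (dgen A L k d).
Proof.
rewrite dgen_half big_seq_cond; apply: lspan_sum => a /andP[].
rewrite mem_index_iota => /andP[ka ad] aa; apply: lspanZ.
rewrite -(emon1 A (d - a)) -emon_cons; apply: lspan_gen; split=> //=.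
  by rewrite ka /= andbT; lia.
by rewrite addn0 subnKC; lia.
Qed.

Lemma lspan_emon_strict (P : seq nat -> Prop) x : (forall s t, perm_eq s t -> P s -> P t) ->
  lspan P (emon A) x -> lspan (fun s => sorted ltn s /\ P s) (emon A) x.
Proof.
move=> Pp; apply: lspan_trans => s Ps; have [us|nus] := boolP (uniq s); last first.
  by rewrite (alternating_nuniq (@emon_alternating A) nus); apply: lspan0.
have pe : perm_eq s (sort leq s) by rewrite perm_sym perm_sort.
have [b ->] := alternating_swap (@emon_alternating A) pe.
apply/lspanZ/lspan_gen; split; last exact: Pp Ps.
by rewrite ltn_sorted_uniq_leq sort_uniq us sort_sorted //; exact: leq_total.
Qed.

Lemma lspan_ed a b : all (leq k) a ->
  lspan (fun s => [/\ sorted ltn s, size s = (size a).+2 & all (leq k) s]) (emon A)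
    (tmon A L k (a, [:: b])).
Proof.
move=> ka; rewrite /tmon /= dprod_cons /dprod /= ext_1mul.
have h := lspan_emon_gen a (lspan_dgen b).
have h' : lspan (fun s => size s = (size a).+2 /\ all (leq k) s) (emon A)
    (ext_mul (emon A a) (dgen A L k b)).
  apply: lspan_sub h => s [t [st kt _] ->].
  by rewrite size_cat st addn2 all_cat ka kt.
have pe s t : perm_eq s t -> size s = (size a).+2 /\ all (leq k) s ->
    size t = (size a).+2 /\ all (leq k) t.
  by move=> st [<- ks]; rewrite (perm_size st) -(perm_all _ st).
by apply: lspan_sub (lspan_emon_strict pe h') => s [ss [sz ks]].
Qed.

(** Both sides lie in the span of strict monomials of length [size a] + 2, where the map is
    injective, so the relation found among images holds in the algebra. *)
Lemma rel_main (a : seq nat) (b : nat) : (0 < size a)%N ->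
  sorted (fun x y => x + 3 <= y)%N a -> all (leq k) a -> (b <= k.*2 + 3 * size a)%N ->
  (k < nth 0 a 0)%N \/ (b < k.*2 + 3 * size a)%N ->
  lspan (fun p => edspan k a (sumn a + b) p /\ p.1 <> a)
    (tmon A L k) (tmon A L k (a, [:: b])).
Proof.
move=> a0 ga ka bN kb.
have [V [S [cf [S_perm S_neg cfD cfS]]]] := symmetric_array_model.
have [phi phiE] := @ext_univ A V _ (jtdet_alternating k S_perm (size a).+1).
have [X [c [XP Xe]]] := @phi_main V S L k S_perm S_neg A phi (size a) phiE a b erefl a0 ga ka bN kb.
exists X, c; split=> //; apply/eqP; rewrite -subr_eq0; apply/eqP.
apply: (phi_inj S_neg cfD cfS phiE); last first.
  rewrite linearB Xe linear_sum; apply/eqP; rewrite subr_eq0; apply/eqP.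
  by apply: eq_bigr => p _; rewrite linearZ.
apply: lspanD; first exact: lspan_ed.
apply/lspanN; rewrite big_seq; apply: lspan_sum => p /XP[[a' [b' [-> _ sz ka' _]]] _].
by apply: lspanZ; rewrite -sz; apply: lspan_ed.
Qed.

Lemma straighten_main (a : seq nat) (b : nat) : (0 < size a)%N ->
  sorted (fun x y => x + 3 <= y)%N a -> all (leq k) a -> all (leq^~ b) a ->
  (b <= k.*2 + 3 * size a)%N -> (k < nth 0 a 0)%N \/ (b < k.*2 + 3 * size a)%N ->
  lspan (pdlow k ^~ (a, [:: b])) (tmon A L k) (tmon A L k (a, [:: b])).
Proof.
move=> a0 ga ka ba bN kb; apply: lspan_trans (rel_main a0 ga ka bN kb) => p.
case=> -[a' [b' [-> sa' sz ka' [da e]]]] /= na.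
have sa : sorted ltn a by apply: sub_sorted ga => x y /=; lia.
have [bk|kb'] := leqP b' k.*2; first by rewrite (@tmon_small _ _ _ _ _ b') ?mem_head //; apply: lspan0.
apply: lspan_gen; split=> //=.
- by rewrite all_cat ka' /= andbT; lia.
- by rewrite !sumn_cat /= !addn0.
have da' : (sumn a' <= sumn a)%N by have := da (size a); rewrite -{1}sz !take_size.
have sl (s : seq nat) : sorted ltn s -> sorted leq s by apply: sub_sorted => x y /ltnW.
split.
  apply: perm_wdom (wdom_cons_max (sl _ sa) ba sz da (_ : b' + sumn a' = b + sumn a)%N).
  - by rewrite -cat1s perm_catC.
  - by rewrite -cat1s perm_catC.
  - by rewrite addnC e addnC.
(* Dominance gives b' >= b, whereas b' is one of the parts of a and b, all at most b. So b' = b, and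
   then a' = a, which is excluded. *)
apply/negP => pe; have := perm_mem pe b'; rewrite !mem_cat mem_seq1 eqxx orbT => /esym.
have bb : (b <= b')%N by lia.
rewrite mem_seq1 => h; have {h} b'b : b' = b.
  by case/orP: h => [/(allP ba)|/eqP //]; lia.
move: pe; rewrite b'b perm_cat2r => pe; apply: na.
by apply: (sorted_eq leq_trans anti_leq) pe; apply: sl.
Qed.

End MainRelation.

Local Open Scope nat_scope.

(** * Pairs of part lists, distinguished partitions and termination *)

Section NormalPairs.
Implicit Types (I J K : seq nat) (p : seq nat * seq nat) (d : seq nat * seq nat).

(** It passes from the pairs (I \ J, J) of the computations back to (I; J); [dsplit] is its inverse
    up to reordering. *)
Definition dnorm p : seq nat * seq nat := (sort leq (p.1 ++ p.2), sort leq p.2).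

Definition dsplit d : seq nat * seq nat := (mdiff d.1 d.2, d.2).

Lemma perm_mdiff I J K : perm_eq I (K ++ J) -> perm_eq (mdiff I J) K.
Proof.
elim: J I => [|j J IH] I; first by rewrite cats0.
move=> pe; apply: IH; have jI : j \in I by rewrite (perm_mem pe) mem_cat mem_head orbT.
rewrite -(perm_cons j) -(permPl (perm_to_rem jI)) (permPl pe).
by rewrite -cat1s perm_catCA.
Qed.

Lemma mdiff_subseq I J : subseq (mdiff I J) I.
Proof.
elim: J I => [|j J IH] I; first exact: subseq_refl.
exact: subseq_trans (IH _) (rem_subseq _ _).
Qed.

Lemma perm_sort_leq I : perm_eq (sort leq I) I.
Proof. by rewrite perm_sort. Qed.

Lemma eq_sort_leq I J : perm_eq I J -> sort leq I = sort leq J.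
Proof. by move=> pe; apply/(perm_sortP leq_total leq_trans anti_leq). Qed.

Lemma dsplit_dnorm p : perm_eq (dsplit (dnorm p)).1 p.1 /\ perm_eq (dsplit (dnorm p)).2 p.2.
Proof.
split; last exact: perm_sort_leq.
apply: perm_mdiff; apply: perm_trans (perm_sort_leq _) _.
by rewrite perm_cat2l perm_sym perm_sort_leq.
Qed.

Lemma subseq_perm_mdiff I J : subseq J I -> perm_eq (mdiff I J ++ J) I.
Proof.
move=> sJI; have [K pe] := perm_to_subseq sJI; rewrite perm_sym (permPl pe) perm_catC perm_cat2r.
by rewrite perm_sym; apply: perm_mdiff; rewrite (permPl pe) perm_catC.
Qed.

Lemma dnorm_D k n p : uniq p.1 -> all (leq k) (p.1 ++ p.2) -> sumn (p.1 ++ p.2) = n ->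
  D k n (dnorm p).
Proof.
move=> up kp sp; rewrite /D /distinguished /k_partition /dnorm /=.
rewrite !(sort_sorted leq_total) (perm_all _ (perm_sort_leq _)) kp.
rewrite (perm_sumn (perm_sort_leq _)) sp eqxx andbT /=.
rewrite (subseq_sort leq_total leq_trans) ?suffix_subseq //= /strict ltn_sorted_uniq_leq.
rewrite (perm_uniq (proj1 (dsplit_dnorm p))) up /=.
apply: (subseq_sorted leq_trans (mdiff_subseq _ _)); exact: sort_sorted leq_total _.
Qed.

(** Each alternative of [plow] lowers one component and keeps the earlier ones: merging lowers the
    number of parts, dominance the weight, and a lexicographic step the sum of the distinguished
    parts. *)
Definition dmeasure d : nat * nat * nat := (size d.1, weight d.1, sumn d.2).

Definition dmeasure_lt d' d : bool :=
  let: (a', b', c') := dmeasure d' in let: (a, b, c) := dmeasure d in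
  (a' < a) || ((a' == a) && ((b' < b) || ((b' == b) && (c' < c)))).

Lemma dmeasure_ind (P : seq nat * seq nat -> Prop) :
  (forall d, (forall d', dmeasure_lt d' d -> P d') -> P d) -> forall d, P d.
Proof.
move=> IH; suff h a b c d : dmeasure d = (a, b, c) -> P d by move=> d; apply: h.
elim/ltn_ind: a b c d => a IHa b; elim/ltn_ind: b => b IHb c; elim/ltn_ind: c => c IHc d e.
apply: IH => d'; rewrite /dmeasure_lt e; case E: (dmeasure d') => [[a' b'] c'].
case/orP => [h|/andP[/eqP ea /orP[h|/andP[/eqP eb h]]]].
- exact: IHa h _ _ _ E.
- by apply: IHb h _ _ _; rewrite E ea.
- by apply: IHc h _ _; rewrite E ea eb.
Qed.

Lemma plow_order_gen k n p' p : uniq p'.1 -> uniq p.1 -> all (leq k) (p.1 ++ p.2) ->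
  sumn (p.1 ++ p.2) = n -> plow k p' p ->
  order_gen k n (dnorm p') (dnorm p) /\ dmeasure_lt (dnorm p') (dnorm p).
Proof.
case: p' p => [K' J'] [K J] /= uK' uK kp sp [/= kp' sp' h].
have Dp' : D k n (dnorm (K', J')) by apply: dnorm_D; rewrite ?sp'.
have Dp : D k n (dnorm (K, J)) by apply: dnorm_D.
rewrite /order_gen /dmeasure_lt /dmeasure /ddim /= !size_sort !size_cat.
case: h => [[sK sJ dom npe]|[sK peKJ [x [y [s [px py xy]]]]]|[x [y [s [pxy xy ps pm]]]]].
- have sz : size (sort leq (K' ++ J')) = size (sort leq (K ++ J)).
    by rewrite !size_sort !size_cat sK sJ.
  have pd : pdom (sort leq (K' ++ J')) (sort leq (K ++ J)).
    apply: wdom_pdom => //; first exact: sort_sorted leq_total _.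
    by apply: perm_wdom dom; rewrite perm_sym perm_sort_leq.
  have ne : sort leq (K' ++ J') <> sort leq (K ++ J).
    by move/(perm_sortP leq_total leq_trans anti_leq); apply/negP.
  rewrite sK sJ eqxx ltnn /= (pdom_weight sz pd ne); split=> //; split=> //.
  by constructor 2; split=> // r _; apply: pd.
- have e := eq_sort_leq peKJ; have sJ : size J' = size J.
    by rewrite (perm_size px) (perm_size py).
  rewrite e sK sJ !eqxx !ltnn /= (perm_sumn (perm_sort_leq _)) (perm_sumn px).
  rewrite (perm_sumn (perm_sort_leq _)) (perm_sumn py) /= ltn_add2r xy; split=> //; split=> //.
  by constructor 1; split=> //; rewrite (eq_sort_leq px) (eq_sort_leq py) lexi_sort_cons.
have sz : size K' + size J' < size K + size J.
  by rewrite (perm_size ps) (perm_size pm) (perm_size pxy) /=; lia.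
rewrite sz; split=> //; split=> //.
  by rewrite (perm_size ps) (perm_size pm) (perm_size pxy) /=; lia.
constructor 3; split=> //; apply: rt_step.
have [pK pJ] := dsplit_dnorm (K, J).
have merge u v : perm_eq K [:: u, v & s] -> u < v -> u + v = x + y ->
    merge_step (dnorm (K, J)) (dnorm (K', J')).
  move=> puv uv e; exists u, v; rewrite !(perm_mem pK) !(perm_mem puv) !inE !eqxx orbT.
  split=> //; rewrite /dnorm /=.
  have -> : sort leq J' = sort leq (u + v :: sort leq J).
    apply: eq_sort_leq; apply: (perm_trans pm); rewrite e perm_cons perm_sym; exact: perm_sort_leq.
  congr pair; apply: eq_sort_leq.
  have puvI : perm_eq (sort leq (K ++ J)) [:: u, v & s ++ J].
    by apply: perm_trans (perm_sort_leq _) _; rewrite -!cat_cons perm_cat2r.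
  have uI : u \in sort leq (K ++ J) by rewrite (perm_mem puvI) mem_head.
  have pu : perm_eq (rem u (sort leq (K ++ J))) (v :: s ++ J).
    by rewrite -(perm_cons u) -(permPl (perm_to_rem uI)).
  have vI : v \in rem u (sort leq (K ++ J)) by rewrite (perm_mem pu) mem_head.
  have rr : perm_eq (rem v (rem u (sort leq (K ++ J)))) (s ++ J).
    by rewrite -(perm_cons v) -(permPl (perm_to_rem vI)).
  apply: (@perm_trans _ (s ++ (x + y :: J))); first by apply: perm_cat.
  by rewrite -cat1s perm_catCA e perm_cons perm_sym.
have [lt|lt|//] := ltngtP x y; first by apply: merge pxy lt _.
apply: (merge y x) => //; last exact: addnC.
by apply: (perm_trans pxy); exact: permEl (perm_catCA [:: x] [:: y] s).
Qed.

End NormalPairs.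

(** * Straightening singular monomials *)

Lemma perm_cat_pair (K J r : seq nat) (x y : nat) : perm_eq (K ++ J) [:: x, y & r] ->
  [\/ exists s, perm_eq K [:: x, y & s],
      exists s t, perm_eq K (x :: s) /\ perm_eq J (y :: t),
      exists s t, perm_eq K (y :: s) /\ perm_eq J (x :: t)
    | exists t, perm_eq J [:: x, y & t]].
Proof.
move=> pe; have: x \in K ++ J by rewrite (perm_mem pe) mem_head.
rewrite mem_cat => /orP[] xs; have px := perm_to_rem xs.
  have pe1 : perm_eq (rem x K ++ J) (y :: r).
    by rewrite -(perm_cons x) -cat_cons; apply: perm_trans pe; rewrite perm_cat2r perm_sym.
  have: y \in rem x K ++ J by rewrite (perm_mem pe1) mem_head.
  rewrite mem_cat => /orP[] ys; have py := perm_to_rem ys.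
    by constructor 1; exists (rem y (rem x K)); apply: (perm_trans px); rewrite perm_cons.
  by constructor 2; exists (rem x K), (rem y J).
have pe1 : perm_eq (K ++ rem x J) (y :: r).
  rewrite -(perm_cons x); apply: perm_trans pe; rewrite perm_sym -cat1s perm_sym perm_catCA.
  by rewrite perm_cat2l perm_sym.
have: y \in K ++ rem x J by rewrite (perm_mem pe1) mem_head.
rewrite mem_cat => /orP[] ys; have py := perm_to_rem ys.
  by constructor 3; exists (rem y K), (rem x J).
by constructor 4; exists (rem y (rem x J)); apply: (perm_trans px); rewrite perm_cons.
Qed.

Lemma sorted_adjacent (T : eqType) (r : rel T) (I : seq T) :
  (forall I1 x y I2, I = I1 ++ [:: x, y & I2] -> r x y) -> sorted r I.
Proof.
elim: I => //= x [|y I] IH h //=; rewrite (h [::] x y I) //=.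
by apply: IH => I1 u v I2 e; apply: (h (x :: I1) u v I2); rewrite e.
Qed.

Lemma block_head (I : seq nat) (j : nat) :
  j \in I -> j \notin [seq head 0 b | b <- blocks I] -> exists2 y, y \in I & y + 3 = j.
Proof.
elim: I => //= i I IH.
case E: (blocks I) => [|[|x b] bs] /=; rewrite ?E /= in IH.
- have := flatten_blocks I; rewrite E => /= <-.
  by rewrite !inE => /eqP ->; rewrite eqxx.
- by rewrite !inE => /orP[/eqP ->|jI]; rewrite ?eqxx // => /norP[_ /(IH jI)[y yI <-]];
  exists y => //; rewrite inE yI orbT.
case: eqP => [xi|_] /=; rewrite !inE => /orP[/eqP ->|jI]; rewrite ?eqxx //.
  case/norP=> _ jbs; have [->|jx] := eqVneq j x; first by exists i; rewrite ?mem_head.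
  have [|y yI <-] := IH jI; first by rewrite inE negb_or jx.
  by exists y; rewrite ?inE ?yI ?orbT.
move=> /norP[_ /(IH jI)[y yI <-]].
by exists y; rewrite ?inE ?yI ?orbT.
Qed.

Lemma gapped_nth (I : seq nat) (r s : nat) : sorted (fun a b => a + 3 <= b) I ->
  r <= s -> s < size I -> nth 0 I r + 3 * (s - r) <= nth 0 I s.
Proof.
move=> gI rs; elim: s rs => [|s IH] rs sI; first by move: rs; rewrite leqn0 => /eqP ->; rewrite addn0.
have [->|rs'] := eqVneq r s.+1; first by rewrite subnn addn0.
have {}rs' : r <= s by rewrite -ltnS ltn_neqAle rs' rs.
have h := IH rs' (ltnW sI); have := elimT (sortedP 0) gI s sI; lia.
Qed.

Section Singular.
Variables (A : exterior) (L : lie_algebra) (k : nat).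
Hypothesis k_gt0 : 0 < k.
Implicit Types (I J K : seq nat) (p : seq nat * seq nat).
Local Notation tmon := (tmon A L k).

Lemma plow_permr p' p q : perm_eq p.1 q.1 -> perm_eq p.2 q.2 -> plow k p' p -> plow k p' q.
Proof.
move=> p1 p2; have p12 : perm_eq (p.1 ++ p.2) (q.1 ++ q.2) by apply: perm_cat.
case=> kp sp h; split=> //; first by rewrite sp (perm_sumn p12).
case: h => [[sK sJ dKJ npe]|[sK peKJ [x [y [s [px py xy]]]]]|[x [y [s [pxy xy ps pm]]]]].
- constructor 1; rewrite -(perm_size p1) -(perm_size p2) -(permPr p12); split=> //.
  exact: perm_wdom dKJ.
- constructor 2; rewrite -(perm_size p1) -(permPr p12); split=> //.
  by exists x, y, s; rewrite -(permPl p2).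
- constructor 3; exists x, y, s; rewrite -(permPl p1); split=> //.
  by apply: (perm_trans pm); rewrite perm_cons.
Qed.

Lemma straighten_part p K' J' K J : perm_eq K (p.1 ++ K') -> perm_eq J (p.2 ++ J') ->
  all (leq k) (K ++ J) -> lspan (plow k ^~ p) tmon (tmon p) ->
  lspan (plow k ^~ (K, J)) tmon (tmon (K, J)).
Proof.
move=> pK pJ kKJ h; rewrite perm_sym in pK; rewrite perm_sym in pJ.
apply: (lspan_perm_tmon (p := (p.1 ++ K', p.2 ++ J'))) => //.
apply: lspan_sub (lspan_tmon_cat _ h); last first.
  by move: kKJ; rewrite !all_cat -(perm_all _ pK) -(perm_all _ pJ) !all_cat
    => /andP[/andP[_ ->] /andP[_ ->]].
by move=> p' ; apply: plow_permr.
Qed.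

(** By contradiction: if no rule lowers (K, J), then the failure of each rule yields a distance
    inequality, and together these make (K, J) nonsingular. *)
Lemma straighten K J : uniq K -> all (leq k) (K ++ J) -> ~~ nonsingular k (dnorm (K, J)) ->
  lspan (plow k ^~ (K, J)) tmon (tmon (K, J)).
Proof.
move=> uK kKJ sing; apply: NNPP => nl; move/negP: sing; apply.
have part p K' J' : perm_eq K (p.1 ++ K') -> perm_eq J (p.2 ++ J') ->
    ~ lspan (plow k ^~ p) tmon (tmon p).
  by move=> pK pJ h; apply: nl; apply: straighten_part pK pJ kKJ h.
have kK x : x \in K -> k <= x by move=> xK; apply: (allP kKJ); rewrite mem_cat xK.
have kJ x : x \in J -> k <= x by move=> xJ; apply: (allP kKJ); rewrite mem_cat xJ orbT.
have hKK x y s : perm_eq K [:: x, y & s] -> x < y -> x + 3 <= y.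
  move=> pe xy; rewrite leqNgt; apply/negP => yx.
  apply: (part ([:: x; y], [::]) s J pe (perm_refl _)); apply: straighten_ee => //; last by lia.
  by apply: kK; rewrite (perm_mem pe) mem_head.
have hJJ x y s : perm_eq J [:: x, y & s] -> x <= y -> x + 4 <= y.
  move=> pe xy; rewrite leqNgt; apply/negP => yx.
  apply: (part ([::], [:: x; y]) K s (perm_refl _) pe); apply: straighten_dd => //; last by lia.
  by apply: kJ; rewrite (perm_mem pe) mem_head.
have hKJ x y : x \in K -> y \in J -> (y + 3 <= x) || (x + 4 <= y).
  move=> xK yJ; apply/contraT; rewrite negb_or -!ltnNge => /andP[h1 h2].
  case: (part ([:: x], [:: y]) (rem x K) (rem y J) (perm_to_rem xK) (perm_to_rem yJ)).
  by apply: straighten_ed => //; [apply: kK | apply: kJ | lia | lia].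
have J2 y : y \in J -> k.*2 < y.
  move=> yJ; rewrite ltnNge; apply/negP => yk; apply: nl.
  by rewrite (tmon_small _ _ _ yJ yk); apply: lspan0.
pose I := sort leq (K ++ J).
have pI : perm_eq I (K ++ J) by apply: perm_sort_leq.
have sI : sorted leq I by apply: sort_sorted leq_total _.
have gI : sorted (fun a b => a + 3 <= b) I.
  apply: sorted_adjacent => I1 x y I2 eI.
  have xy : x <= y by move: sI; rewrite eI => /cat_sorted2[_ /= /andP[]].
  have : perm_eq (K ++ J) [:: x, y & I1 ++ I2].
    by rewrite -(permPl pI) eI; exact: permEl (perm_catCA I1 [:: x; y] I2).
  case/perm_cat_pair => [[s pK]|[s [t [pK pJ]]]|[s [t [pK pJ]]]|[s pJ]].
  - apply: (hKK _ _ _ pK); rewrite ltn_neqAle xy andbT; apply: contraTneq uK => e.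
    by rewrite (perm_uniq pK) e /= mem_head.
  - have /hKJ : x \in K by rewrite (perm_mem pK) mem_head.
    by move/(_ y); rewrite (perm_mem pJ) mem_head => /(_ isT); lia.
  - have /hKJ : y \in K by rewrite (perm_mem pK) mem_head.
    by move/(_ x); rewrite (perm_mem pJ) mem_head => /(_ isT); lia.
  - by have := hJJ _ _ _ pJ xy; lia.
have nsI : nonsingular_part k I.
  by rewrite /nonsingular_part /k_partition sI gI (perm_all _ pI) kKJ.
have Dd : D k (sumn (K ++ J)) (dnorm (K, J)) by apply: dnorm_D.
rewrite /nonsingular; have /andP[-> _] := Dd; rewrite /= -/I nsI /=.
rewrite (perm_all _ (perm_sort_leq _)); apply/allP => j jJ /=.
have uI : uniq I by apply: sorted_uniq gI; [move=> a b c; lia | move=> a; lia].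
have jI : j \in I by rewrite (perm_mem pI) mem_cat jJ orbT.
set m := main_dim k I.
have /andP[nsm mm] := main_dimP k I; rewrite -/m in nsm mm.
have [jm|njm] := boolP (j \in take m I); last first.
  have jd : j \in drop m I by move: jI; rewrite -{1}(cat_take_drop m I) mem_cat (negbTE njm).
  (* Beyond the main segment, a distinguished j that is not leading would have j - 3 as a part, too
     close to j whether ordinary or distinguished. *)
  apply: contraT => /(block_head jd)[y yI e].
  have : y \in K ++ J by rewrite -(perm_mem pI) (mem_drop yI).
  rewrite mem_cat => /orP[yK|yJ]; first by have := hKJ _ _ yK jJ; clear -e; lia.
  have jJ' : j \in rem y J by move: jJ; rewrite (perm_mem (perm_to_rem yJ)) inE => /orP[/eqP|//]; clear -e; lia.
  have pJ : perm_eq J [:: y, j & rem j (rem y J)].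
    by rewrite (permPl (perm_to_rem yJ)) perm_cons perm_to_rem.
  by have := hJJ _ _ _ pJ; clear -e; lia.
exfalso.
(* The first distinguished part also lies in the main segment, and the r parts before it are
   ordinary, as [straighten_main] requires. *)
pose r := find (mem J) I.
have hr : has (mem J) I by apply/hasP; exists j.
have rI : r < size I by rewrite -has_find.
have rJ : nth 0 I r \in J by have := nth_find 0 hr.
have rm : r < m.
  rewrite ltnNge; apply/negP => mr; have [i im e] := nthP 0 jm.
  have im' : i < m by apply: leq_trans im _; rewrite size_take; case: ltnP.
  have := @before_find _ 0 (mem J) I i; rewrite -/r (leq_trans im' mr) => /(_ isT) /=.
  by rewrite -(nth_take _ im') e jJ.
have mI : m <= size I by apply: main_dim_leq.
(* The bound on the last main part is carried down to position r by the gaps of at least 3; the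
   boolean summand encodes the strict inequality in the case i_1 = k. For r = 0 it contradicts
   [J2]. *)
have bound : nth 0 I r + (nth 0 I 0 == k) <= k.*2 + 3 * r.
  have m_gt0 : 0 < m by apply: leq_trans rm.
  have rm1 : r <= m.-1 by rewrite -ltnS prednK.
  have m1 : m.-1 < size I by rewrite prednK.
  have := gapped_nth gI rm1 m1.
  move: mm; have : last 0 (take m I) = nth 0 I m.-1.
    by rewrite -nth_last size_takel // nth_take // prednK.
  have : size (take m I) = m by rewrite size_takel.
  have : nth 0 (take m I) 0 = nth 0 I 0 by rewrite nth_take.
  case: (take m I) => [_ em|i1 t /= <- em <-]; first by move: m_gt0; rewrite -em.
  rewrite -mul2n; move: (nth 0 I r) em rm rm1 => x em rm rm1; clear -em m_gt0 rm rm1.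
  by case: eqP => _; lia.
have aK : {subset take r I <= K}.
  move=> x xr; have [i ir e] := nthP 0 xr.
  have ir' : i < r by apply: leq_trans ir _; rewrite size_take; case: ltnP.
  have := @before_find _ 0 (mem J) I i ir' => /= /negbT; rewrite -(nth_take _ ir') e => nJ.
  by have := mem_take xr; rewrite (perm_mem pI) mem_cat (negbTE nJ) orbF.
have ua : uniq (take r I) by apply: take_uniq.
have pK : perm_eq K (take r I ++ [seq x <- K | x \notin take r I]).
  rewrite -(perm_filterC (mem (take r I)) K) perm_sym perm_cat2r.
  apply: uniq_perm => //; first by apply: filter_uniq.
  by move=> x; rewrite mem_filter /= andb_idr //; apply: aK.
have [r0|r_gt0] := posnP r.
  by have := J2 _ rJ; move: bound; rewrite r0; clear; lia.
apply: (part (take r I, [:: nth 0 I r]) _ _ pK (perm_to_rem rJ)).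
have sr : size (take r I) = r by rewrite size_takel // ltnW.
apply: (lspan_sub (@pdlow_plow k ^~ _)); apply: straighten_main; rewrite ?sr //.
- exact: take_sorted.
- by apply/allP => x /aK; apply: kK.
- apply/allP => x xr; have [i ir e] := nthP 0 xr; rewrite sr in ir.
  rewrite -e nth_take //; apply: leq_trans (gapped_nth gI (ltnW ir) rI); exact: leq_addr.
- by move: bound; clear; lia.
- rewrite nth_take //; move: bound; case: eqP => e b; [by right; move: b; clear; lia|left].
  have : k <= nth 0 I 0 by apply: (allP kKJ); rewrite -(perm_mem pI) mem_nth // (leq_ltn_trans _ rI).
  by move: e; clear; lia.
Qed.

End Singular.

Local Open Scope ring_scope.

(** * Expansions in nonsingular monomials *)

Section Families.
Variables (A : exterior) (L : lie_algebra) (k : nat).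
Hypothesis k_gt0 : (0 < k)%N.
Implicit Types (I J K b : seq nat) (d p : seq nat * seq nat).
Local Notation tmon := (tmon A L k).
Local Notation "x ** y" := (@ext_mul A x y) (at level 40, left associativity).
Local Notation gen := (@ext_gen A).
Local Notation dgen := (@dgen A L k).
Local Notation emon := (@emon A).
Local Notation eprod := (@eprod A).

Definition taud d : A := tmon (dsplit d).

Lemma taud_dnorm p : exists b : bool, tmon p = (-1) ^+ b *: taud (dnorm p).
Proof.
case: p => K J; have [pK pJ] := dsplit_dnorm (K, J).
rewrite perm_sym in pK; rewrite perm_sym in pJ.
by have [b hb] := perm_tmon A L k pK pJ; exists b; rewrite hb.
Qed.

Lemma distinguishedP d : distinguished k d ->
  [/\ uniq (dsplit d).1, all (leq k) ((dsplit d).1 ++ (dsplit d).2),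
      perm_eq ((dsplit d).1 ++ (dsplit d).2) d.1 & dnorm (dsplit d) = d].
Proof.
case: d => I J /and4P[/andP[/= sI kI] /= sJ sub st].
have pe := subseq_perm_mdiff sub; split=> //=.
- by apply: sorted_uniq st; [apply: ltn_trans | move=> x; apply: ltnn].
- by rewrite (perm_all _ pe).
- by rewrite /dnorm /= (eq_sort_leq pe) !sorted_sort //; apply: leq_trans.
Qed.

(* If each nonsingular [taud d] is a multiple of [f d] up to lower terms, then
   straightening and induction on the order express every [taud d] through [f]. *)
Lemma span_nonsingular (f : seq nat * seq nat -> A) n :
  (forall d, D k n d -> nonsingular k d -> exists c r,
     taud d = c *: f d + r /\ lspan (plow k ^~ (dsplit d)) tmon r) ->
  forall d, D k n d ->
    lspan (fun d' => [/\ D k n d', nonsingular k d' & dle k n d' d]) f (taud d).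
Proof.
move=> hf; elim/dmeasure_ind => d IH Dd.
have /andP[dd /eqP sd] := Dd; have [u kd pe nd] := distinguishedP dd.
have lower x : lspan (plow k ^~ (dsplit d)) tmon x ->
    lspan (fun d' => [/\ D k n d', nonsingular k d' & dle k n d' d]) f x.
  move/lspan_tmon_uniq; apply: lspan_trans => p [pl up].
  have [b ->] := taud_dnorm p; apply: lspanZ.
  have sn : sumn ((dsplit d).1 ++ (dsplit d).2) = n by rewrite (perm_sumn pe).
  have := plow_order_gen up u kd sn pl; rewrite nd => -[og ml].
  have [Dp _ _ _] := og; apply: lspan_sub (IH _ ml Dp) => d' [Dd' nsd' le]; split=> //.
  by left; case: le => [lt|->]; [apply: t_trans lt _; apply: t_step | apply: t_step].
have [ns|sing] := boolP (nonsingular k d).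
  have [c [r [-> hr]]] := hf d Dd ns; apply: lspanD; last exact: lower.
  by apply/lspanZ/lspan_gen; split=> //; right.
apply: lower; rewrite /taud; move: u kd nd; case: (dsplit d) => K J /= u kd nd.
by apply: straighten; rewrite ?nd.
Qed.

(* The positive sign prevents cancellation when the leading terms contributed by
   the parts of a dense block are added. *)
Definition tri p (x : A) : Prop :=
  exists c r, [/\ 0 < c :> rat, x = c *: tmon p + r & lspan (pdlow k ^~ p) tmon r].

Lemma tri_tmon p : tri p (tmon p).
Proof. by exists 1, 0; split=> //; [rewrite scale1r addr0 | apply: lspan0]. Qed.

Lemma lspan_pdlow_mulr p K J x : all (leq k) (K ++ J) -> lspan (pdlow k ^~ p) tmon x ->
  lspan (pdlow k ^~ (p.1 ++ K, p.2 ++ J)) tmon (x ** tmon (K, J)).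
Proof.
move=> kKJ; apply: (lspan_map (h := mull (tmon (K, J)))) => -[K' J'] pl.
by rewrite /= /mull -tmon_cat; apply: lspan_gen; apply: (pdlow_cat kKJ pl).
Qed.

Lemma pdlow_perm p' p q' q : perm_eq (p'.1 ++ p'.2) (q'.1 ++ q'.2) -> size p'.1 = size q'.1 ->
  perm_eq (p.1 ++ p.2) (q.1 ++ q.2) -> size p.1 = size q.1 ->
  pdlow k p' p -> pdlow k q' q.
Proof.
move=> p1 s1 p2 s2 [kp sp z1 z2 [dd npe]].
have e1 : size p'.2 = size q'.2 by have := perm_size p1; rewrite !size_cat s1 => /addnI.
have e2 : size p.2 = size q.2 by have := perm_size p2; rewrite !size_cat s2 => /addnI.
split; rewrite -?(perm_all _ p1) -?(perm_sumn p1) -?(perm_sumn p2) -?s1 -?s2 -?e1 -?e2 //.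
by split; [exact: perm_wdom dd | rewrite -(permPl p1) -(permPr p2)].
Qed.

Lemma lspan_pdlow_mull p K J x : all (leq k) (K ++ J) -> lspan (pdlow k ^~ p) tmon x ->
  lspan (pdlow k ^~ (K ++ p.1, J ++ p.2)) tmon (tmon (K, J) ** x).
Proof.
move=> kKJ; apply: (lspan_map (h := mulr (tmon (K, J)))) => -[K' J'] pl.
rewrite /= /mulr -tmon_cat; apply: lspan_gen.
have cc (X Y U V : seq nat) : perm_eq ((X ++ U) ++ Y ++ V) ((U ++ X) ++ V ++ Y).
  by apply: perm_cat; rewrite perm_catC.
apply: pdlow_perm (pdlow_cat kKJ pl); rewrite /= ?size_cat; try exact: cc; exact: addnC.
Qed.

Lemma pdlow_trans p q r : pdlow k p q -> pdlow k q r -> pdlow k p r.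
Proof.
move=> [kp sp z1 z2 [dd npe]] [kq sq z3 z4 [dd' npe']].
split; rewrite ?sp ?z1 ?z2 //; split; first exact: wdom_trans dd dd'.
apply/negP => pe; case/negP: npe.
have sz : size (sort leq (p.1 ++ p.2)) = size (sort leq (q.1 ++ q.2)).
  by rewrite !size_sort !size_cat z1 z2.
have srt s t : wdom s t -> wdom (sort leq s) (sort leq t).
  by apply: perm_wdom; rewrite perm_sym perm_sort_leq.
apply/(perm_sortP leq_total leq_trans anti_leq); apply: pdom_antisym => //.
  exact: wdom_pdom (sort_sorted leq_total _) sz (srt _ _ dd).
apply: wdom_pdom (sort_sorted leq_total _) (esym sz) (srt _ _ _).
by apply: perm_wdom dd' => //; rewrite perm_sym.
Qed.

Lemma tri_mul p q x y : all (leq k) (p.1 ++ p.2) -> all (leq k) (q.1 ++ q.2) ->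
  tri p x -> tri q y -> tri (p.1 ++ q.1, p.2 ++ q.2) (x ** y).
Proof.
case: p q => [K J] [K' J'] kp kq [c [r [c0 -> hr]]] [c' [r' [c'0 -> hr']]].
exists (c * c'), (c *: (tmon (K, J) ** r') + (c' *: (r ** tmon (K', J')) + r ** r')); split.
- exact: mulr_gt0.
- by rewrite tmon_cat emulDl !emulDr !emulZl !emulZr scalerA -addrA.
apply: lspanD; first by apply/lspanZ/lspan_pdlow_mull.
apply: lspanD; first by apply/lspanZ/lspan_pdlow_mulr.
apply: (lspan_map (h := mull r')) hr => -[a b] pl; rewrite /= /mull.
have [kab _ _ _ _] := pl.
apply: lspan_sub (lspan_pdlow_mull kab hr') => p' pl'.
exact: pdlow_trans pl' (pdlow_cat kq pl).
Qed.

Lemma tri_add p x y : tri p x -> tri p y -> tri p (x + y).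
Proof.
move=> [c [r [c0 -> hr]]] [c' [r' [c'0 -> hr']]]; exists (c + c'), (r + r'); split.
- exact: addr_gt0.
- by rewrite scalerDl addrACA.
- exact: lspanD.
Qed.

Lemma tri_scale p x (a : rat) : 0 < a -> tri p x -> tri p (a *: x).
Proof.
move=> a0 [c [r [c0 -> hr]]]; exists (a * c), (a *: r); split; last exact: lspanZ.
  exact: mulr_gt0.
by rewrite scalerDr scalerA.
Qed.

Lemma tri_lower p x y : tri p x -> lspan (pdlow k ^~ p) tmon y -> tri p (x + y).
Proof.
move=> [c [r [c0 -> hr]]] hy; exists c, (r + y); split=> //; last exact: lspanD.
by rewrite addrA.
Qed.

(** In the relation of total 2x + 3 the weights vanish at x + 1 and x + 2, so only the indices x and
    x + 3, with positive weights, and lower terms remain. *)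
Lemma tri_pair x : (k.*2 < x)%N -> tri ([:: (x + 3)%N], [:: x]) (- (gen x ** dgen (x + 3))).
Proof.
move=> kx; pose c := x.+1; have c1 : (1 < c)%N by rewrite /c; lia.
have [p [cp p0 p1 p2 p3]] := cyclic_ed_block L c1.
have R := rel_ed A k cp.
have tE (a b : nat) : tmon ([:: a], [:: b]) = gen a ** dgen b := tmon_ed A L k a b.
have px : p x != 0 by rewrite -[x]/(c.-1) gt_eqF.
have [y hy e] : exists2 y, lspan (pdlow k ^~ ([:: (x + 3)%N], [:: x])) tmon y &
    p x *: (gen x ** dgen (x + 3)) + p (x + 3)%N *: (gen (x + 3) ** dgen x) + y = 0.
  move: R; rewrite (bigD1_seq x) ?iota_uniq ?mem_index_iota //=; last by rewrite /c; lia.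
  have x3 : (x + 3 != x)%N by lia.
  rewrite big_mkcond (bigD1_seq (x + 3)%N) ?iota_uniq ?mem_index_iota //=; last by rewrite /c; lia.
  rewrite x3 (_ : c.*2.+1 - x = x + 3)%N; last by rewrite /c; lia.
  rewrite (_ : c.*2.+1 - (x + 3) = x)%N; last by rewrite /c; lia.
  rewrite /gen_ge (_ : k <= x)%N; last by lia.
  rewrite (_ : k <= x + 3)%N; last by lia.
  rewrite addrA => R; eexists; last exact: R.
  rewrite big_seq_cond; apply: lspan_sum => a /andP[]; rewrite mem_index_iota => /andP[_ am] ax3.
  case: ifP => ax; last exact: lspan0.
  have [ac|ac] := eqVneq a c; first by rewrite ac p0 scale0r; apply: lspan0.
  have [ac1|ac1] := eqVneq a c.+1; first by rewrite ac1 p1 scale0r; apply: lspan0.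
  apply: lspanZ; rewrite /gen_ge; case: ifP => ka; last by rewrite emul0l; apply: lspan0.
  have [km|mk] := leqP k (c.*2.+1 - a); last first.
    by rewrite (@dgen_eq0 A L k (_ - _)) ?emul0r; [apply: lspan0 | lia].
  rewrite -tE; apply: lspan_gen; apply: (@pair_pdlow k (x + 3) x a (c.*2.+1 - a)) => //.
    by clear -am; rewrite /c in am *; lia.
  by clear -am ax ax3 ac ac1; rewrite /c in am ac ac1 *; lia.
exists (p (x + 3)%N / p x), ((p x)^-1 *: y); split; last exact: lspanZ.
  by apply: divr_gt0; [rewrite addn3 | ].
move: e; rewrite -addrA => /eqP; rewrite addr_eq0 => /eqP e.
by rewrite -[gen x ** _](scalerK px) e scalerN opprK scalerDr scalerA mulrC tE.
Qed.

(** The antiderivation delta on e_b, with the Leibniz rule applied to the first factor; see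
    [delta_monE]. *)
Fixpoint bder b : A :=
  if b is i :: b' then dgen i ** emon b' - gen i ** bder b' else 0.

(** By induction delta of the tail is a positive multiple of delta(e_(i+3)) times the remaining
    factors. Multiplying by - e_i and applying [tri_pair] gives a positive multiple of the same
    monomial as delta(e_i) times the tail, so the two contributions add. *)
Lemma tri_block i b : (k.*2 < i)%N -> path (fun x y => y == x + 3)%N i b ->
  tri (b, [:: i]) (bder (i :: b)).
Proof.
elim: b i => [|j b IH] i ki /=.
  move=> _; rewrite emul0r subr0; have -> : dgen i ** emon [::] = tmon ([::], [:: i]).
    by rewrite /tmon /= comm_emon; [rewrite dprod_cons /dprod /= ext_1mul|apply: dgen_comm].
  exact: tri_tmon.
case/andP=> /eqP -> pb; have kj : (k.*2 < i + 3)%N by rewrite ltn_addr.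
have [c [r [c0 e hr]]] := IH _ kj pb; rewrite /= in e.
have t1 : tri ((i + 3)%N :: b, [:: i]) (dgen i ** emon ((i + 3)%N :: b)).
  have -> : dgen i ** emon ((i + 3)%N :: b) = tmon ((i + 3)%N :: b, [:: i]).
    by rewrite /tmon /= dprod_cons /dprod /= ext_1mul comm_emon //; apply: dgen_comm.
  exact: tri_tmon.
rewrite e emulDr emulZr opprD addrA; apply: tri_lower; last first.
  apply: lspanN; have k1 : all (leq k) ([:: i] ++ [::]) by rewrite /= andbT; lia.
  have := lspan_pdlow_mull k1 hr; rewrite /tmon /= emon1 ext_1mul.
  apply: lspan_sub => p'; apply: pdlow_perm => //=.
  by rewrite -cat_cons perm_catC /= perm_cons -cat1s perm_catC.
apply: tri_add => //; rewrite -scalerN; apply: tri_scale => //.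
have kb : all (leq k) (b ++ [::]).
  rewrite cats0; apply: sub_all (_ : all (leq (i + 3)) b); first by move=> x; lia.
  apply: order_path_min; first by move=> x y z; apply: leq_trans.
  by apply: sub_path pb => x y /eqP ->; apply: leq_addr.
have ki2 : all (leq k) ([:: (i + 3)%N] ++ [:: i]) by rewrite /= andbT; apply/andP; split; lia.
have -> : gen i ** tmon (b, [:: (i + 3)%N]) = gen i ** dgen (i + 3) ** tmon (b, [::]).
  rewrite /tmon /= !dprod_cons /dprod /= !ext_1mul -ext_mulA comm_emon //; exact: dgen_comm.
rewrite -emulNl.
by have := @tri_mul (_, _) (_, _) _ _ ki2 kb (tri_pair ki) (tri_tmon (b, [::])); rewrite /= .
Qed.

Definition xid d : A :=
  let: (I0, Is) := normal_form k d.1 in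
  emon I0 ** eprod [seq if head 0%N b \in d.2 then bder b else emon b | b <- Is].

(** Reordering costs a sign, so positivity weakens to c != 0; it has served its purpose inside the
    blocks. *)
Lemma tri_perm p q x : perm_eq p.1 q.1 -> perm_eq p.2 q.2 -> tri p x ->
  exists c r, [/\ c != 0, x = c *: tmon q + r & lspan (pdlow k ^~ q) tmon r].
Proof.
case: p q => [K J] [K' J'] /= pK pJ [c [r [c0 -> hr]]].
have [b ->] := perm_tmon A L k pK pJ; exists (c * (-1) ^+ b), r; split.
- by rewrite mulf_neq0 ?signr_eq0 // gt_eqF.
- by rewrite scalerA.
apply: lspan_sub hr => p'; apply: pdlow_perm => //=; first exact: perm_cat.
exact: perm_size.
Qed.

Lemma tri_blocks J bs : all (dense_part k) bs -> all (leq k) (flatten bs) ->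
  let K' := flatten [seq if head 0%N b \in J then behead b else b | b <- bs] in
  let J' := [seq i <- [seq head 0%N b | b <- bs] | i \in J] in
  perm_eq (flatten bs) (K' ++ J') /\
  tri (K', J') (eprod [seq if head 0%N b \in J then bder b else emon b | b <- bs]).
Proof.
elim: bs => [|[|i b] bs IH] //=.
  by move=> _ _; split=> //; have := tri_tmon ([::], [::]); rewrite /tmon /= ext_mul1.
case/andP=> /andP[ki pb] /IH{}IH; rewrite all_cat => /and3P[ki' kb kf].
have [pe t] := IH kf; rewrite /=.
have kKJ : all (leq k) (flatten [seq if head 0%N b \in J then behead b else b | b <- bs] ++
   [seq i <- [seq head 0%N b | b <- bs] | i \in J]) by rewrite -(perm_all _ pe).
rewrite /eprod /= -/eprod; case: ifP => iJ /=.
  split.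
    apply/seq.permP => a; rewrite /= !count_cat (seq.permP pe a) count_cat.
    by rewrite -(addnA (count a b)) !(addnCA (nat_of_bool _)).
  have kib : all (leq k) (b ++ [:: i]) by rewrite all_cat kb /= ki'.
  apply: (@tri_mul (_, _) (_, _) _ _ kib kKJ _ t); apply: tri_block => //.
  by rewrite -mul2n.
split; first by rewrite -cat_cons -catA perm_cat2l.
have kib : all (leq k) ((i :: b) ++ [::]) by rewrite cats0 /= ki'.
apply: (@tri_mul (i :: b, [::]) (_, _) _ _ kib kKJ _ t).
by have := tri_tmon (i :: b, [::]); rewrite /tmon /= ext_1mul.
Qed.

Lemma uniq_heads bs : all (dense_part k) bs -> uniq (flatten bs) ->
  uniq [seq head 0%N b | b <- bs].
Proof.
move=> db; apply: subseq_uniq; elim: bs db => [|[|i b] bs IH] //= /andP[_ /IH h].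
by rewrite eqxx; apply: subseq_trans h _; apply: suffix_subseq.
Qed.

Lemma xid_triangular d : nonsingular k d -> exists c r,
  [/\ c != 0, xid d = c *: taud d + r & lspan (pdlow k ^~ (dsplit d)) tmon r].
Proof.
case: d => I J /and3P[dd]; rewrite [(I, J).1]/= [(I, J).2]/= => nsI /allP lead.
have := normal_formP k_gt0 nsI; rewrite /leading_parts /= in lead; rewrite /xid /=.
move: (take _ I) (blocks _) lead => I0 Is lead [eI _ _ dI _].
have /and4P[/andP[/= sI kI] _ subJ _] := dd.
have gI : sorted (fun x y : nat => x + 3 <= y)%N I by case/andP: nsI.
have uI : uniq I by apply: sorted_uniq gI; [move=> x y z; lia | move=> x; lia].
have [kI0 kIs] : all (leq k) I0 /\ all (leq k) (flatten Is).
  by apply/andP; rewrite -all_cat -eI.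
have [pe t] := tri_blocks J dI kIs.
set K' := flatten [seq _ | _ <- _] in pe t; set J' := filter _ _ in pe t.
have pJ : perm_eq J' J.
  apply: uniq_perm; first by rewrite filter_uniq // uniq_heads //; move: uI; rewrite eI cat_uniq => /and3P[].
    exact: subseq_uniq subJ uI.
  by move=> x; rewrite mem_filter andb_idr //; apply: lead.
have pK : perm_eq (I0 ++ K') (mdiff I J).
  rewrite perm_sym; apply: perm_mdiff; rewrite eI -catA perm_cat2l (permPl pe).
  by rewrite perm_cat2l.
have kK' : all (leq k) (K' ++ J') by rewrite -(perm_all _ pe).
have k0 : all (leq k) (I0 ++ [::]) by rewrite cats0.
have t0 : tri (I0, [::]) (emon I0) by have := tri_tmon (I0, [::]); rewrite /tmon /= ext_1mul.
have := tri_mul (p := (I0, [::])) (q := (K', J')) k0 kK' t0 t.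
exact: (tri_perm (q := dsplit (I, J))).
Qed.

Lemma taud_xid d : nonsingular k d -> exists c r,
  taud d = c *: xid d + r /\ lspan (plow k ^~ (dsplit d)) tmon r.
Proof.
case/xid_triangular => c [r [c0 -> hr]]; exists c^-1, (- (c^-1 *: r)); split.
  by rewrite scalerDr scalerK // addrK.
by apply/lspanN/lspanZ/(lspan_sub _ hr) => p; apply: pdlow_plow.
Qed.

Lemma span_taud n d : D k n d ->
  lspan (fun d' => [/\ D k n d', nonsingular k d' & dle k n d' d]) taud (taud d).
Proof.
apply: span_nonsingular => {}d _ _; exists 1, 0; rewrite scale1r addr0; split=> //.
exact: lspan0.
Qed.

Lemma span_xid n d : D k n d ->
  lspan (fun d' => [/\ D k n d', nonsingular k d' & dle k n d' d]) xid (taud d).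
Proof. by apply: span_nonsingular => {}d _ ns; apply: taud_xid. Qed.

Lemma lspan_tmon_deg K J : all (leq k) K ->
  lspan (fun s => all (leq k) s /\ sumn s = sumn (K ++ J)) emon (tmon (K, J)).
Proof.
move=> kK; elim: J => [|j J IH].
  by rewrite /tmon /= ext_1mul cats0; apply: lspan_gen.
have -> : tmon (K, j :: J) = dgen j ** tmon (K, J).
  by rewrite /tmon /= dprod_cons ext_mulA -comm_emon ?ext_mulA //; apply: dgen_comm.
apply: (lspan_map (h := mulr (dgen j))) IH => s [ks ss] /=.
rewrite /mulr comm_emon; last exact: dgen_comm.
apply: lspan_sub (lspan_emon_gen s (lspan_dgen A L k j)) => _ [t [_ kt st] ->].
rewrite all_cat ks kt sumn_cat ss st !sumn_cat /=; split=> //; ring.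
Qed.

Lemma lspan_tmon_strict n p : all (leq k) p.1 -> sumn (p.1 ++ p.2) = n ->
  lspan (fun s => [&& k_partition k s, strict s & sumn s == n]) emon (tmon p).
Proof.
case: p => K J /= kK sKJ.
have pe s t : perm_eq s t -> all (leq k) s /\ sumn s = sumn (K ++ J) ->
    all (leq k) t /\ sumn t = sumn (K ++ J).
  by move=> pe; rewrite (perm_all _ pe) (perm_sumn pe).
apply: lspan_sub (lspan_emon_strict pe (lspan_tmon_deg J kK)) => s [ss [ks e]].
by rewrite /k_partition /strict ss ks e sKJ eqxx (sub_sorted ltnW).
Qed.

Lemma taud_deg n d : D k n d ->
  lspan (fun s => [&& k_partition k s, strict s & sumn s == n]) emon (taud d).
Proof.
case/andP=> /distinguishedP[_ kd pe _] /eqP sd; apply: lspan_tmon_strict.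
  by move: kd; rewrite all_cat => /andP[].
by rewrite (perm_sumn pe).
Qed.

Lemma xid_deg n d : D k n d -> nonsingular k d ->
  lspan (fun s => [&& k_partition k s, strict s & sumn s == n]) emon (xid d).
Proof.
move=> Dd /xid_triangular[c [r [_ -> hr]]]; apply: lspanD; first exact/lspanZ/taud_deg.
have /andP[/distinguishedP[_ _ pe _] /eqP sd] := Dd.
apply: lspan_trans hr => p [kp sp _ _ _]; apply: lspan_tmon_strict.
  by move: kp; rewrite all_cat => /andP[].
by rewrite sp (perm_sumn pe).
Qed.

End Families.

Local Open Scope nat_scope.

(** * Nonsingular partitions inject into strict partitions *)

Section Encoding.
Implicit Types (C V I J : seq nat) (k f : nat).

(** The degree of the nonsingular partition with parts c_s + 3s, s from 0. *)
Definition cdeg C : nat := sumn C + 3 * 'C(size C, 2).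

(** The last clause is the lower bound on leading parts in terms of coordinates, with the exception
    for i_1 = k; it is kept as an invariant while k grows. *)
Definition admissible k C V : Prop :=
  [/\ all (leq k) C, uniq V, {subset V <= C}
    & forall v, v \in V -> k.*2 - (k \in C) < v].

(* One part of the strict partition is decided at each step; [C] lists the
   numbers i_s - 3 s of a nonsingular partition and [V] marks its distinguished
   parts. *)
Fixpoint encode f k C V : seq nat :=
  if f isn't f'.+1 then [::] else
  if k \in C then k :: encode f' k.+1 (map (addn 3) (rem k C)) (map (addn 3) V)
  else if k.*2.+1 \in V then
    k :: encode f' k.+1 (k.+1 :: rem k.*2.+1 C) (rem k.*2.+1 V)
  else if (k.*2.+2 \in V) && (k.+1 \notin C) then
    k :: encode f' k.+1 (k.+2 :: rem k.*2.+2 C) (rem k.*2.+2 V)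
  else encode f' k.+1 C V.

Lemma all_succ k C : all (leq k) C -> k \notin C -> all (leq k.+1) C.
Proof.
by move=> kC nk; apply/allP => x xC; rewrite ltn_neqAle (allP kC) // andbT; apply: contraNneq nk => ->.
Qed.

Lemma all_rem (P : pred nat) x C : all P C -> all P (rem x C).
Proof. by move/allP => h; apply/allP => y /mem_rem; apply: h. Qed.

Lemma admissible_in k C V : 0 < k -> k \in C -> admissible k C V ->
  admissible k.+1 (map (addn 3) (rem k C)) (map (addn 3) V).
Proof.
move=> k0 kC [aC uV sVC hV]; rewrite kC in hV; split.
- by rewrite all_map; apply/allP => x /mem_rem/(allP aC) /=; lia.
- by rewrite map_inj_uniq //; apply: addnI.
- move=> _ /mapP[v vV ->]; apply: map_f; have := sVC _ vV; rewrite (perm_mem (perm_to_rem kC)) inE.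
  by case/orP=> // /eqP vk; have := hV _ vV; lia.
- move=> _ /mapP[v vV ->]; have := hV _ vV; lia.
Qed.

Lemma admissible_mark k C V v w : w + k = v -> uniq V -> {subset V <= C} -> all (leq k.+1) C ->
  v \in V -> k < w -> (forall u, u \in V -> u != v -> k.+1.*2 - (k.+1 \in w :: rem v C) < u) ->
  admissible k.+1 (w :: rem v C) (rem v V).
Proof.
move=> ew uV sVC aC vV kv hV; split.
- by rewrite /= all_rem // andbT; lia.
- exact: rem_uniq.
- move=> u; rewrite mem_rem_uniq // inE => /andP[uv uVV].
  by have := sVC _ uVV; rewrite (perm_mem (perm_to_rem (sVC _ vV))) !inE (negbTE uv) /= => ->; rewrite orbT.
- by move=> u; rewrite mem_rem_uniq // inE => /andP[uv uV']; apply: hV.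
Qed.

(** A marked number v is traded for the emitted part k and the unmarked number v - k, as e_k e_(v-k)
    occurs in delta(e_v). The invariant 2k < v makes v = 2k + 1 due at once. The mark 2k + 2 is also
    due, unless k + 1 is in C: then the weaker bound at the next step still admits it. *)
Variant encode_step k C V : seq nat -> seq nat -> bool -> Prop :=
| EncodeIn of k \in C : encode_step k C V (map (addn 3) (rem k C)) (map (addn 3) V) true
| EncodeOdd of k \notin C & k.*2.+1 \in V :
    encode_step k C V (k.+1 :: rem k.*2.+1 C) (rem k.*2.+1 V) true
| EncodeEven of k \notin C & k.+1 \notin C & k.*2.+2 \in V :
    encode_step k C V (k.+2 :: rem k.*2.+2 C) (rem k.*2.+2 V) true
| EncodeOut of k \notin C : encode_step k C V C V false.

Lemma encodeP f k C V : 0 < k -> admissible k C V -> exists C' V' b,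
  [/\ encode_step k C V C' V' b, admissible k.+1 C' V', cdeg C = cdeg C' + (if b then k else 0)
    & encode f.+1 k C V = if b then k :: encode f k.+1 C' V' else encode f k.+1 C' V'].
Proof.
move=> k0 ad; have [aC uV sVC hV] := ad.
have degrem v w : w + k = v -> v \in V -> cdeg C = cdeg (w :: rem v C) + k.
  move=> ew /sVC vC; have pe := perm_to_rem vC.
  rewrite /cdeg (perm_sumn pe) (perm_size pe) -[size (w :: _)]/(size (v :: rem v C)).
  by move: 'C(_, 2) => B; move: (rem v C) => X; clear -ew; rewrite /=; lia.
rewrite /=; case: ifP => kC.
  exists (map (addn 3) (rem k C)), (map (addn 3) V), true; split=> //; try by constructor.
    exact: admissible_in.
  rewrite /cdeg (perm_sumn (perm_to_rem kC)) (perm_size (perm_to_rem kC)) size_map.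
  move: (rem k C) => X; rewrite [size (_ :: _)]/= [sumn (_ :: _)]/= binS bin1.
  have -> : sumn (map (addn 3) X) = sumn X + 3 * size X by elim: X => //= x s ->; lia.
  by move: 'C(_, 2) (sumn X) => B S; move: (size X) => Q; clear; lia.
have {}kC : k \notin C by rewrite kC.
have aC' := all_succ aC kC; rewrite (negbTE kC) subn0 in hV.
case: ifP => oV.
  exists (k.+1 :: rem k.*2.+1 C), (rem k.*2.+1 V), true.
  have e : k.+1 + k = k.*2.+1 by lia.
  split=> //; try by constructor.
    apply: admissible_mark e _ _ _ _ _ _ => // u uV' uo.
    by rewrite mem_head; have := hV _ uV'; lia.
  exact: degrem.
case: ifP => [/andP[eV k1C]|oe].
  exists (k.+2 :: rem k.*2.+2 C), (rem k.*2.+2 V), true.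
  have e : k.+2 + k = k.*2.+2 by lia.
  split=> //; try by constructor.
    apply: admissible_mark e _ _ _ _ _ _ => // u uV' uo.
    have := hV _ uV'; have : u != k.*2.+1 by apply: contraFneq oV => <-.
    by lia.
  exact: degrem.
exists C, V, false; split=> //; [by constructor| | by rewrite addn0].
split=> // u uV'; have := hV _ uV'; have uo : u != k.*2.+1 by apply: contraFneq oV => <-.
have [k1C|k1C] := boolP (k.+1 \in C); first by lia.
have ue : u != k.*2.+2 by apply: contraFneq oe => <-; rewrite uV'.
by lia.
Qed.

(** The emission of an ordinary k leaves only numbers at least k + 3. Hence k + 1 in the new C
    betrays the mark 2k + 1, and k + 2 without k + 1 the mark 2k + 2. *)
Definition decode k C V (b : bool) : seq nat * seq nat :=
  if ~~ b then (C, V)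
  else if k.+1 \in C then (k.*2.+1 :: rem k.+1 C, k.*2.+1 :: V)
  else if k.+2 \in C then (k.*2.+2 :: rem k.+2 C, k.*2.+2 :: V)
  else (k :: map (subn^~ 3) C, map (subn^~ 3) V).

Lemma perm_decode k b C V C' V' : perm_eq C C' -> perm_eq V V' ->
  perm_eq (decode k C V b).1 (decode k C' V' b).1 /\
  perm_eq (decode k C V b).2 (decode k C' V' b).2.
Proof.
have prem x (s s' : seq nat) : x \in s -> perm_eq s s' -> perm_eq (rem x s) (rem x s').
  move=> xs pe; have xs' : x \in s' by rewrite -(perm_mem pe).
  by rewrite -(perm_cons x) -(permPl (perm_to_rem xs)) -(permPr (perm_to_rem xs')).
move=> pC pV; rewrite /decode -!(perm_mem pC); case: b => //=.
case: ifP => [kC|_] /=; first by rewrite !perm_cons pV prem.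
case: ifP => [kC|_] /=; first by rewrite !perm_cons pV prem.
by rewrite perm_cons !perm_map.
Qed.

Lemma decodeP k C V C' V' b : 0 < k -> admissible k C V -> encode_step k C V C' V' b ->
  perm_eq (decode k C' V' b).1 C /\ perm_eq (decode k C' V' b).2 V.
Proof.
move=> k0 [aC _ sVC _] st; rewrite /decode; case: st => [kC|kC vV|kC k1C vV|kC] //=.
- have no3 j : j < k + 3 -> j \in map (addn 3) (rem k C) = false.
    by move=> jk; apply/negP => /mapP[x /mem_rem/(allP aC) kx]; move: jk; clear -kx; lia.
  rewrite !no3; try by clear; lia.
  have sub3 s : map (subn^~ 3) (map (addn 3) s) = s.
    by rewrite -map_comp map_id_in // => x _ /=; rewrite addKn.
  by rewrite !sub3 perm_sym perm_to_rem.
- by rewrite mem_head /= eqxx !(perm_sym (_ :: _)) !perm_to_rem ?sVC.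
- have k21 : (k.+1 == k.+2) = false by clear; lia.
  rewrite inE k21 /= (contraNF (@mem_rem _ _ _ _)) // mem_head eqxx.
  by rewrite !(perm_sym (_ :: _)) !perm_to_rem ?sVC.
Qed.

Lemma cdeg_fuel0 k C V : 0 < k -> admissible k C V -> cdeg C < k + 0 -> C = [::] /\ V = [::].
Proof.
move=> k0 [aC _ sVC _]; case: C aC sVC => [|c C] /=.
  by move=> _; case: V => // v V /(_ v (mem_head _ _)).
by case/andP=> kc _ _; rewrite /cdeg /=; lia.
Qed.

Lemma encode_strict f k C V : 0 < k -> admissible k C V -> cdeg C < k + f ->
  [/\ all (leq k) (encode f k C V), sorted ltn (encode f k C V) & sumn (encode f k C V) = cdeg C].
Proof.
elim: f k C V => [|f IH] k C V k0 ad cf; first by have [-> _] := cdeg_fuel0 k0 ad cf.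
have [C' [V' [b [_ ad' ed ->]]]] := encodeP f k0 ad.
have [|a s e] := IH _ _ _ (ltn0Sn k) ad'; first by rewrite addSnnS; case: b ed; lia.
have a' : all (leq k) (encode f k.+1 C' V') by apply: sub_all a => x; apply: ltnW.
case: b ed => ed /=; last by rewrite e ed addn0.
by rewrite leqnn a' (path_sortedE ltn_trans) a s e ed addnC.
Qed.

Lemma encode_inj f k C V C' V' : 0 < k -> admissible k C V -> admissible k C' V' ->
  cdeg C < k + f -> cdeg C' < k + f -> encode f k C V = encode f k C' V' ->
  perm_eq C C' /\ perm_eq V V'.
Proof.
elim: f k C V C' V' => [|f IH] k C V C' V' k0 ad ad' cf cf' e.
  have [-> ->] := cdeg_fuel0 k0 ad cf; have [-> ->] := cdeg_fuel0 k0 ad' cf'; by [].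
move: e; have [C1 [V1 [b [st ad1 ed ->]]]] := encodeP f k0 ad.
have [C1' [V1' [b' [st' ad1' ed' ->]]]] := encodeP f k0 ad' => e.
have cf1 : cdeg C1 < k.+1 + f by case: (b) ed; lia.
have cf1' : cdeg C1' < k.+1 + f by case: (b') ed'; lia.
have [a _ _] := encode_strict (ltn0Sn k) ad1 cf1.
have [a' _ _] := encode_strict (ltn0Sn k) ad1' cf1'.
have eb : b = b'.
  case: (b) (b') e a a' => -[] //; first by move=> <- /= _; rewrite ltnn.
  by move=> -> /=; rewrite ltnn.
subst b'; have {e} e : encode f k.+1 C1 V1 = encode f k.+1 C1' V1' by case: (b) e => [[]|].
have [pC pV] := IH _ _ _ _ _ (ltn0Sn k) ad1 ad1' cf1 cf1' e.
have [p1 p2] := decodeP k0 ad st; have [p1' p2'] := decodeP k0 ad' st'.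
have [q1 q2] := perm_decode k b pC pV.
by split; [rewrite -(permPl p1) (permPl q1) | rewrite -(permPl p2) (permPl q2)].
Qed.

End Encoding.

Definition gapped : seq nat -> bool := sorted (fun x y => x + 3 <= y).

Lemma gapped_uniq I : gapped I -> uniq I.
Proof. by apply: sorted_uniq; [move=> x y z; lia | move=> x; lia]. Qed.

Lemma blocks_nonempty I : [::] \notin blocks I.
Proof.
by elim: I => //= i I; case: (blocks I) => [|[|j b] bs] //=; case: ifP => _; rewrite !inE.
Qed.

Lemma sub_heads (bs : seq (seq nat)) : [::] \notin bs ->
  {subset [seq head 0 b | b <- bs] <= flatten bs}.
Proof.
elim: bs => [|b bs IH] //=; rewrite inE negb_or => /andP[b0 /IH{}IH] z.
rewrite inE mem_cat => /orP[/eqP ->|/IH ->]; last by rewrite orbT.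
by case: b b0 => // x b _; rewrite mem_head.
Qed.

Lemma gapped_path_ge i X x : path (fun x y => x + 3 <= y) i X -> x \in X -> i + 3 <= x.
Proof.
elim: X i => //= z X IH i /andP[iz /IH h]; rewrite inE => /orP[/eqP ->//|/h].
by apply: leq_trans; apply: leq_trans iz (leq_addr _ _).
Qed.

(** If j = y + 3, then y immediately precedes j and belongs to the same block. *)
Lemma gapped_head_pred I (y j : nat) : gapped I -> y \in I ->
  j \in [seq head 0 b | b <- blocks I] -> y + 3 != j.
Proof.
elim: I => //= i I IH pI yI; have gI : gapped I := path_sorted pI.
have yi : i <= y.
  by move: yI; rewrite inE => /orP[/eqP ->//|/(gapped_path_ge pI)]; apply: leq_trans (leq_addr _ _).
have yni : y + 3 != i by move: yi; clear; lia.
have := blocks_nonempty I; have := flatten_blocks I.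
case E: (blocks I) => [|[|x b] bs] //= eI nb; rewrite ?E /= in IH.
  by rewrite inE => /eqP ->.
have hI : {subset [seq head 0 b | b <- bs] <= b ++ flatten bs}.
  move=> z zb; rewrite mem_cat (sub_heads _ zb) ?orbT //.
have gx : path (fun x y => x + 3 <= y) x (b ++ flatten bs) by move: gI; rewrite -eI.
have ix : i + 3 <= x by apply: (gapped_path_ge pI); rewrite -eI mem_head.
have tl : j \in [seq head 0 b | b <- bs] -> y + 3 != j.
  move=> jb; move: yI; rewrite inE => /orP[/eqP ->|yI]; last by apply: IH => //; rewrite inE jb orbT.
  by have := gapped_path_ge gx (hI _ jb); lia.
case: ifP => /eqP exi /=; rewrite !inE; first by case/orP=> [/eqP ->|/tl].
case/or3P=> [/eqP -> //|/eqP ej|/tl //].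
move: yI; rewrite inE => /orP[/eqP ->|yI]; first by rewrite ej eq_sym; apply/eqP.
by apply: IH => //; rewrite ej mem_head.
Qed.

(** * Coordinates of nonsingular partitions *)

Section Coordinates.
Variable k : nat.
Hypothesis k_gt0 : 0 < k.
Implicit Types (I J : seq nat).

Definition coords I : seq nat := mkseq (fun s => nth 0 I s - 3 * s) (size I).

Definition cval I j : nat := j - 3 * index j I.

Lemma gapped_ge I s : gapped I -> s < size I -> 3 * s <= nth 0 I s.
Proof.
move=> gI sI; have := gapped_nth gI (leq0n s) sI; rewrite subn0.
by apply: leq_trans; apply: leq_addl.
Qed.

Lemma coords_leq I s t : gapped I -> s <= t -> t < size I ->
  nth 0 (coords I) s <= nth 0 (coords I) t.
Proof.
move=> gI st tI; rewrite !nth_mkseq ?(leq_ltn_trans st tI) //.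
have := gapped_nth gI st tI; have := gapped_ge gI (leq_ltn_trans st tI); have := gapped_ge gI tI.
by move: (nth 0 I s) (nth 0 I t) => x y; clear -st; lia.
Qed.

Lemma coords_geq I : gapped I -> all (leq k) I -> all (leq k) (coords I).
Proof.
move=> gI kI; apply/(all_nthP 0) => s; rewrite size_mkseq => sI.
apply: leq_trans (coords_leq gI (leq0n s) sI).
have I0 : 0 < size I by apply: leq_ltn_trans sI.
by rewrite nth_mkseq // muln0 subn0; apply: (allP kI); apply: mem_nth.
Qed.

Lemma cdeg_coords I : gapped I -> cdeg (coords I) = sumn I.
Proof.
move=> gI; rewrite /cdeg size_mkseq -bin2_sum big_distrr /=.
have -> : sumn (coords I) = \sum_(0 <= s < size I) (nth 0 I s - 3 * s).
  by rewrite sumnE big_map /index_iota subn0.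
rewrite -big_split /=.
rewrite sumnE [RHS](big_nth 0); apply: eq_big_nat => s /andP[_ sI].
by rewrite subnK // gapped_ge.
Qed.

Lemma cval_coords I j : j \in I -> cval I j = nth 0 (coords I) (index j I).
Proof. by move=> jI; rewrite nth_mkseq ?index_mem // nth_index. Qed.

Lemma mem_coords I : gapped I -> all (leq k) I -> 0 < size I ->
  (k \in coords I) = (nth 0 I 0 == k).
Proof.
move=> gI kI I0; have c0 : nth 0 (coords I) 0 = nth 0 I 0 by rewrite nth_mkseq // muln0 subn0.
apply/idP/eqP => [/(nthP 0)[s]|<-]; last by rewrite -c0 mem_nth // size_mkseq.
rewrite size_mkseq => sI e; apply/eqP; rewrite eqn_leq -{1}e -{1}c0 coords_leq //=.
by apply: (allP kI); apply: mem_nth.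
Qed.

Lemma leading_index I j : nonsingular_part k I -> j \in leading_parts k I ->
  [/\ j \in I, main_dim k I <= index j I & j \in drop (main_dim k I) I].
Proof.
move=> nsI lj; have /andP[_ gI] := nsI; set m := main_dim k I.
have jm : j \in drop m I.
  rewrite -(flatten_blocks (drop m I)); exact: sub_heads (blocks_nonempty _) _ lj.
have jI := mem_drop jm; split=> //; rewrite leqNgt; apply/negP => lt.
have := gapped_uniq gI; rewrite -(cat_take_drop m I) cat_uniq => /and3P[_ /hasPn/(_ _ jm) /= /negP nj _].
apply: nj; rewrite -(nth_index 0 jI) -(nth_take 0 lt) mem_nth // size_takel //.
exact: main_dim_leq.
Qed.

(** The initial segment of length m + 1, m the main dimension, is not main, so its last part exceeds
    the bound and its coordinate exceeds 2k, or equals at least 2k when i_1 = k. Coordinates do not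
    decrease afterwards. *)
Lemma leading_cval I j : nonsingular_part k I -> j \in leading_parts k I ->
  k.*2 - (k \in coords I) < cval I j.
Proof.
move=> nsI lj; have [jI mj _] := leading_index nsI lj.
have /andP[/andP[sI kI] gI] := nsI.
have jI' : index j I < size I by rewrite index_mem.
have mI := leq_ltn_trans mj jI'; have I0 := leq_ltn_trans (leq0n _) mI.
rewrite cval_coords // mem_coords //; apply: leq_trans (coords_leq gI mj jI').
set m := main_dim k I in mj mI *; rewrite nth_mkseq //.
have : ~~ main_part k (take m.+1 I) by apply/negP => /(main_dim_max mI); rewrite ltnn.
rewrite /main_part.
have -> : nonsingular_part k (take m.+1 I).
  rewrite /nonsingular_part /k_partition !take_sorted // andbT /=.
  by apply/allP => i /mem_take; apply: (allP kI).
have : last 0 (take m.+1 I) = nth 0 I m by rewrite -nth_last size_takel // nth_take.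
have : size (take m.+1 I) = m.+1 by rewrite size_takel.
have : nth 0 (take m.+1 I) 0 = nth 0 I 0 by rewrite nth_take.
case: (take m.+1 I) => [|i1 t] //= <- -> <-; move: (last i1 t) => x; rewrite -mul2n.
by clear -k_gt0; case: eqP => _; lia.
Qed.

(** If an earlier leading part had the same coordinate as j, monotonicity would give that coordinate
    to the part just before j as well; this part would be j - 3, and j would not head a block. *)
Lemma leading_cval_inj I : nonsingular_part k I ->
  {in leading_parts k I &, injective (cval I)}.
Proof.
move=> nsI; have /andP[/andP[sI kI] gI] := nsI.
suff lt i j : i \in leading_parts k I -> j \in leading_parts k I -> index i I < index j I ->
    cval I i <> cval I j.
  move=> i j li lj e; have [lij|lij|ij] := ltngtP (index i I) (index j I).
  - by case: (lt _ _ li lj lij).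
  - by case: (lt _ _ lj li lij).
  - have [iI _ _] := leading_index nsI li; have [jI _ _] := leading_index nsI lj.
    by rewrite -(nth_index 0 iI) ij nth_index.
move=> li lj ij e; have [iI mi _] := leading_index nsI li; have [jI mj jm] := leading_index nsI lj.
have jI' : index j I < size I by rewrite index_mem.
pose s := (index j I).-1; have sj : s.+1 = index j I by rewrite prednK //; apply: leq_ltn_trans ij.
have is_ : index i I <= s by rewrite -ltnS sj.
have sI2 : s < size I by apply: leq_trans jI'; rewrite -sj.
have ys : nth 0 I s \in drop (main_dim k I) I.
  rewrite -(subnKC (leq_trans mi is_)) -nth_drop mem_nth // size_drop.
  by rewrite ltn_sub2r // (leq_ltn_trans (leq_trans mi is_)).
have gd : gapped (drop (main_dim k I) I) by apply: drop_sorted.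
have /negP := gapped_head_pred gd ys lj; apply.
have h1 := coords_leq gI is_ sI2; have h2 : nth 0 (coords I) s <= nth 0 (coords I) s.+1.
  by apply: coords_leq => //; rewrite sj.
move: h1 h2; rewrite -cval_coords // e sj -cval_coords // => h1 h2.
have := gapped_ge gI sI2; have := elimT (sortedP 0) gI s; rewrite sj jI' nth_index // => /(_ isT).
have {h1 h2} : nth 0 (coords I) s = cval I j by apply/eqP; rewrite eqn_leq h1 h2.
rewrite nth_mkseq // /cval -sj; move: (nth 0 I s) => x; clear; lia.
Qed.

Definition encode_part n (d : seq nat * seq nat) : seq nat :=
  encode n.+1 k (coords d.1) (map (cval d.1) d.2).

Lemma nonsingular_admissible d : nonsingular k d ->
  admissible k (coords d.1) (map (cval d.1) d.2).
Proof.
case: d => I J /and3P[/and4P[_ sJ subJ _] nsI /allP lead].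
have /andP[/andP[sI kI] gI] := nsI; split=> /=.
- exact: coords_geq.
- rewrite map_inj_in_uniq; first exact: subseq_uniq subJ (gapped_uniq gI).
  by move=> i j /lead li /lead lj; apply: leading_cval_inj.
- move=> _ /mapP[j jJ ->]; have jI := mem_subseq subJ jJ.
  by rewrite cval_coords // mem_nth // size_mkseq index_mem.
- by move=> _ /mapP[j /lead lj ->]; apply: leading_cval.
Qed.

Lemma encode_part_strict n d : D k n d -> nonsingular k d ->
  [&& k_partition k (encode_part n d), strict (encode_part n d) & sumn (encode_part n d) == n].
Proof.
case: d => I J /andP[_ /eqP sn] ns; have ad := nonsingular_admissible ns.
have gI : gapped I by case/and3P: ns => _ /andP[].
have [|a s e] := encode_strict (f := n.+1) k_gt0 ad.
  by rewrite /= cdeg_coords // sn; lia.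
rewrite /k_partition a /strict s e /= cdeg_coords // sn eqxx !andbT.
exact: sub_sorted ltnW _ s.
Qed.

Lemma encode_part_inj n d d' : D k n d -> nonsingular k d -> D k n d' -> nonsingular k d' ->
  encode_part n d = encode_part n d' -> d = d'.
Proof.
case: d d' => I J [I' J'] /andP[_ /= /eqP sn] ns /andP[_ /= /eqP sn'] ns' e.
have ad := nonsingular_admissible ns; have ad' := nonsingular_admissible ns'.
case/and3P: ns ns' => /= /and4P[_ /= sJ subJ _] nsI /allP lead /and3P[/= /and4P[_ /= sJ' subJ' _] nsI' /allP lead'].
have /andP[_ gI] := nsI; have /andP[_ gI'] := nsI'.
have [||pC pV] := encode_inj k_gt0 ad ad' _ _ e; rewrite ?cdeg_coords // ?sn ?sn'; try by lia.
have sc X : gapped X -> sorted leq (coords X).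
  move=> gX; apply/(sortedP 0) => s; rewrite size_mkseq => sX.
  by apply: coords_leq.
have eC : coords I = coords I' by apply: (sorted_eq leq_trans anti_leq (sc _ gI) (sc _ gI') pC).
have eI : I = I'.
  have sz : size I = size I' by have := congr1 size eC; rewrite !size_mkseq.
  apply: (@eq_from_nth _ 0) => // s sI; have sI' : s < size I' by rewrite -sz.
  have := congr1 (nth 0 ^~ s) eC; rewrite !nth_mkseq // => h.
  by rewrite -(subnK (gapped_ge gI sI)) -(subnK (gapped_ge gI' sI')) h.
subst I'; congr pair.
have mem j : j \in leading_parts k I -> (j \in J) = (cval I j \in map (cval I) J).
  move=> lj; apply/idP/mapP => [jJ|[i iJ e']]; first by exists j.
  by rewrite (leading_cval_inj nsI lj (lead _ iJ) e').
have mem' j : j \in leading_parts k I -> (j \in J') = (cval I j \in map (cval I) J').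
  move=> lj; apply/idP/mapP => [jJ|[i iJ e']]; first by exists j.
  by rewrite (leading_cval_inj nsI lj (lead' _ iJ) e').
apply: (sorted_eq leq_trans anti_leq sJ sJ'); apply: uniq_perm.
- exact: subseq_uniq subJ (gapped_uniq gI).
- exact: subseq_uniq subJ' (gapped_uniq gI).
move=> j; apply/idP/idP => jJ.
  by have lj := lead _ jJ; rewrite mem' // -(perm_mem pV) -mem.
by have lj := lead' _ jJ; rewrite mem // (perm_mem pV) -mem'.
Qed.

End Coordinates.

Local Open Scope ring_scope.

(** * Linear independence by counting *)

(** Finitely many expansions are brought to one finite support, so that their coefficients form a
    matrix. *)
Lemma lspan_fset_cover (V : lmodType rat) (T U : choiceType) (P : T -> Prop)
  (f : T -> V) (x : U -> V) (s0 : {fset T}) (r : seq U) :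
  (forall t, t \in s0 -> P t) -> (forall u, u \in r -> lspan P f (x u)) ->
  exists (s : {fset T}) (c : U -> T -> rat), [/\ (s0 `<=` s)%fset, forall t, t \in s -> P t &
    forall u, u \in r -> x u = \sum_(t <- s) c u t *: f t].
Proof.
move=> Ps0; elim: r => [|u r IH] hr.
  by exists s0, (fun _ _ => 0); split=> //; apply: fsubset_refl.
have [|s [c [s0s Ps hs]]] := IH; first by move=> v vr; apply: hr; rewrite inE vr orbT.
have [s' [c' [Ps' xu]]] := hr u (mem_head _ _).
have ext (s1 s2 : {fset T}) d : (s1 `<=` s2)%fset ->
    \sum_(t <- s1) d t *: f t = \sum_(t <- s2) (if t \in s1 then d t else 0) *: f t.
  move=> s12; rewrite (big_fsetID _ (mem s1) s2) /= [X in _ + X]big1_seq ?addr0; last first.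
    by move=> t; rewrite !inE /= => /andP[_ /negbTE ->]; rewrite scale0r.
  have -> : [fset t | t in s2 & t \in s1]%fset = s1.
    by apply/fsetP => t; rewrite !inE /= andb_idl //; apply: (fsubsetP s12).
  by apply: eq_big_seq => t ->.
exists (s `|` s')%fset, (fun v t => if v == u then if t \in s' then c' t else 0
                                    else if t \in s then c v t else 0); split.
- exact: fsubset_trans s0s (fsubsetUl _ _).
- by move=> t; rewrite inE => /orP[/Ps|/Ps'].
move=> v; rewrite inE; case: eqP => [-> _|_] /=; first by rewrite xu; apply: ext; apply: fsubsetUr.
by move=> /hs ->; apply: ext; apply: fsubsetUl.
Qed.

(* The matrices expressing two families through each other are inverse to each
   other, so a spanning family that is not larger than a basis is a basis. *)
Lemma lin_indep_card (V : lmodType rat) (T U : choiceType) (P : T -> Prop) (Q : pred U)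
    (f : T -> V) (e : U -> V) (us : seq U) (g : T -> U) :
  (forall u, Q u -> u \in us) -> lin_indep Q e ->
  (forall t, P t -> lspan Q e (f t)) -> (forall u, Q u -> lspan P f (e u)) ->
  (forall t, P t -> Q (g t)) -> (forall t t', P t -> P t' -> g t = g t' -> t = t') ->
  lin_indep P f.
Proof.
move=> fin ie fe ef gQ gi s0 c0 Ps0 S0.
pose S := [fset u in us | Q u]%fset.
have SQ u : (u \in S) = Q u by rewrite !inE /= andb_idl // => /fin.
have [|X [M [s0X PX hM]]] := @lspan_fset_cover V T U P f e s0 S Ps0.
  by move=> u; rewrite SQ; apply: ef.
have [||S' [N [SS' QS' hN]]] := @lspan_fset_cover V U T Q e f S X; last 1 first.
- have eS : S' = S by apply/eqP; rewrite eqEfsubset SS' andbT; apply/fsubsetP => u /QS'; rewrite SQ.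
  subst S'.
  have ef_sum (c : T -> rat) : \sum_(t <- X) c t *: f t =
      \sum_(u <- S) (\sum_(t <- X) c t * N t u) *: e u.
    transitivity (\sum_(t <- X) \sum_(u <- S) (c t * N t u) *: e u).
      by apply: eq_big_seq => t tX; rewrite hN // scaler_sumr; apply: eq_bigr => u _; rewrite scalerA.
    by rewrite exchange_big; apply: eq_bigr => u _; rewrite scaler_suml.
  have MN u v : u \in S -> v \in S -> \sum_(t <- X) M u t * N t v = (u == v)%:R.
    move=> uS vS; apply/eqP; rewrite -subr_eq0; apply/eqP.
    apply: (ie S (fun v => \sum_(t <- X) M u t * N t v - (u == v)%:R)) vS => [w|]; first by rewrite SQ.
    transitivity (\sum_(w <- S) (\sum_(t <- X) M u t * N t w) *: e w - \sum_(w <- S) (u == w)%:R *: e w).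
      by rewrite -sumrB; apply: eq_bigr => w _; rewrite scalerBl.
    rewrite -ef_sum -hM // (big_fsetD1 u uS) /= eqxx scale1r big1_seq ?addr0 ?subrr // => w.
    by rewrite in_fsetD1 => /andP[_ /andP[/negbTE wu _]]; rewrite eq_sym wu scale0r.
  pose A := \matrix_(i < #|` S|, j < #|` X|) M (tnth (in_tuple S) i) (tnth (in_tuple X) j).
  pose B := \matrix_(j < #|` X|, i < #|` S|) N (tnth (in_tuple X) j) (tnth (in_tuple S) i).
  have AB : A *m B = 1%:M.
    apply/matrixP => i i'; rewrite !mxE.
    have uS : uniq (in_tuple S) by apply: fset_uniq.
    rewrite -(inj_eq (elimT (tuple_uniqP _) uS)) -MN ?mem_tnth //.
    rewrite [RHS]big_tnth; apply: eq_bigr => j _; by rewrite !mxE.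
  have leXS : (#|` X| <= #|` S|)%N.
    have -> : #|` X| = #|` [fset g t | t in X]%fset| by rewrite card_in_imfset // => t t' /PX Pt /PX; apply: gi.
    by apply/fsubset_leq_card/fsubsetP => u /imfsetP[t /= /PX/gQ Qt ->]; rewrite SQ.
  (* From A B = 1 the rank of B is at least #S, and the injection g gives #X <= #S, so the rows of
     B, indexed by X, are independent. *)
  have fB : row_free B.
    rewrite /row_free eqn_leq rank_leq_row (leq_trans leXS) //.
    by have := mxrankM_maxr A B; rewrite AB mxrank1.
  pose c t := if t \in s0 then c0 t else 0.
  have cB : (\row_j c (tnth (in_tuple X) j)) *m B = 0.
    apply/rowP => i; rewrite !mxE; pose u := tnth (in_tuple S) i.
    have uS : u \in S by apply: mem_tnth.
    transitivity (\sum_(t <- X) c t * N t u).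
      by rewrite [RHS]big_tnth; apply: eq_bigr => j _; rewrite !mxE.
    apply: (ie S (fun v => \sum_(t <- X) c t * N t v)) uS => [w|]; first by rewrite SQ.
    rewrite -ef_sum -[RHS]S0 (big_fsetID _ (mem s0) X) /= [X in _ + X]big1_seq ?addr0; last first.
      by move=> t; rewrite !inE /= /c => /andP[_ /negbTE ->]; rewrite scale0r.
    have -> : [fset t | t in X & t \in s0]%fset = s0.
      by apply/fsetP => t; rewrite !inE /= andb_idl //; apply: (fsubsetP s0X).
    by apply: eq_big_seq => t ts0; rewrite /c ts0.
  move=> t ts0; have tX := fsubsetP s0X _ ts0.
  have /rowP : \row_j c (tnth (in_tuple X) j) = 0 by apply: (row_free_inj fB); rewrite mul0mx.
  have /tnthP[j ej] : t \in in_tuple X by [].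
  by move/(_ j); rewrite !mxE -ej /c ts0.
- by move=> u; rewrite SQ.
- by move=> t /PX; apply: fe.
Qed.

(** * The exterior algebra of chains *)

Lemma e_mon_alternating : alternating e_mon.
Proof.
move=> u x y v; rewrite !e_mon_cat !e_mon_cons (wedgeA (e_ x)) (wedge_eC x y).
by rewrite wedgeNl wedgeNr -wedgeA.
Qed.

Lemma sort_fset (s : seq nat) : uniq s -> sort leq [fset x in s]%fset = sort leq s.
Proof.
move=> us; apply/(perm_sortP leq_total leq_trans anti_leq).
by apply: uniq_perm => [|//|x]; rewrite ?fset_uniq // inE.
Qed.

Lemma wedge_seq_wprod s : wedge_seq s = foldr wprod vac s.
Proof. by rewrite /wedge_seq wprodE. Qed.

(** The map is prescribed by h on sorted lists. On other lists both sides acquire the same sorting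
    sign, and on lists with repetitions both vanish. *)
Lemma chain_univ (V : lmodType rat) (h : seq nat -> V) : alternating h ->
  exists f : {linear chain -> V}, forall s, f (foldr wprod vac [seq e_ i | i <- s]) = h s.
Proof.
move=> ah; exists (lin_ext (fun S : {fset nat} => h (sort leq S))) => s.
rewrite -wedge_seq_wprod -/(e_mon s); have [us|nus] := boolP (uniq s); last first.
  by rewrite (alternating_nuniq e_mon_alternating nus) (alternating_nuniq ah nus) linear0.
have [b hb] := alternating_sort s.
rewrite (hb _ _ e_mon_alternating) (hb _ _ ah) linearZ e_mon_strict; last first.
  by rewrite ltn_sorted_uniq_leq sort_uniq us (sort_sorted leq_total).
congr (_ *: _); rewrite [LHS]lin_extU sort_fset ?sort_uniq //.
by rewrite (sorted_sort leq_trans (sort_sorted leq_total s)).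
Qed.

Lemma wprod_linl y : linear (wprod^~ y).
Proof. by move=> a x z; rewrite wedgeDl wedgeZl. Qed.

Lemma wprod_linr x : linear (wprod x).
Proof. by move=> a y z; rewrite wedgeDr wedgeZr. Qed.

Definition chain_ext : exterior :=
  Exterior wprod_linl wprod_linr wedgeA wedge1l wedge1r wedge_eC chain_univ.

Local Notation CE := chain_ext.

Lemma eprod_chain s : @eprod CE s = wedge_seq s.
Proof. by rewrite wedge_seq_wprod. Qed.

Lemma emon_chain s : @emon CE s = e_mon s.
Proof. exact: eprod_chain. Qed.

Lemma dgen_chain L k i : dgen CE L k i = delta_gen L k i.
Proof. by rewrite /delta_gen wprodE. Qed.

Lemma delta_monE L k b : delta_mon L k b = bder CE L k b.
Proof.
elim: b => [|i b IH]; first by rewrite /delta_mon big_geq.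
rewrite /delta_mon [size _]/= big_nat_recl // expr0 scale1r.
have e3 x y z : wedge_seq [:: x; y; z] = wprod x (wprod y z).
  by rewrite !wedge_seq_cons wedge_seq_nil wedge1r.
transitivity (wprod (delta_gen L k i) (e_mon b) + - wprod (e_ i) (delta_mon L k b)).
  apply: (f_equal2 +%R).
    have e0 : e_mon [::] = vac := wedge_seq_nil.
    by rewrite e3 take0 drop1 e0 wedge1l.
  rewrite /delta_mon wedge_sumr -sumrN; apply: eq_bigr => s _.
  rewrite !e3 wedgeZr exprS mulN1r scaleNr.
  have -> : take s.+1 (i :: b) = i :: take s b by [].
  by rewrite e_mon_cons -wedgeA.
by rewrite IH -emon_chain -dgen_chain.
Qed.

Lemma delta_e_mon L k b : sorted ltn b -> delta L k (e_mon b) = bder CE L k b.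
Proof.
move=> sb; rewrite (e_mon_strict sb) -delta_monE [LHS](lin_extU (fun A : {fset nat} => delta_mon L k (sort leq A))).
move: sb; rewrite ltn_sorted_uniq_leq => /andP[ub sb].
rewrite (sort_fset ub) (sorted_sort leq_trans sb); exact: erefl.
Qed.

Lemma delta_e L k i : delta L k (e_ i) = dgen CE L k i.
Proof.
have -> : e_ i = e_mon [:: i] by rewrite e_mon1.
have s1 : sorted ltn [:: i] by [].
rewrite (delta_e_mon _ _ s1); rewrite /bder emul0r subr0; exact: (@ext_1mul CE (dgen CE L k i)).
Qed.

Lemma count_mem_rem (x y : nat) (s : seq nat) :
  count_mem x (rem y s) = (count_mem x s - ((y == x) && (y \in s)))%N.
Proof.
have [ys|ys] := boolP (y \in s); last by rewrite rem_id // andbF subn0.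
by rewrite (seq.permP (perm_to_rem ys)) /= andbT addKn.
Qed.

(** The factors delta(e_i), being even, move to the right of the ordinary ones without a sign. *)
Lemma tau_factorsP L k I J : (forall x, count_mem x J <= count_mem x I)%N ->
  exists K, [/\ subseq K I, perm_eq I (K ++ J)
    & wedge_seq (tau_factors L k I J) = tmon CE L k (K, J)].
Proof.
elim: I J => [|i I IH] J h.
  exists [::]; have -> : J = [::].
    by case: J h => // j J /(_ j) /=; rewrite eqxx.
  split=> //; exact: esym (@ext_1mul CE (ext_one CE)).
have ihJ : (i \notin J) -> exists K, [/\ subseq K (i :: I), perm_eq (i :: I) (K ++ J)
    & wprod (e_ i) (wedge_seq (tau_factors L k I J)) = tmon CE L k (K, J)].
  move=> iJ; have [|K [sK pK eK]] := IH J.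
    move=> x; have := h x; rewrite /=; have [<-|//] := eqVneq i x.
    by move: iJ; rewrite -has_pred1 has_count -eqn0Ngt => /eqP ->.
  exists (i :: K); split; [by rewrite /= eqxx | by rewrite /= perm_cons |].
  rewrite eK; exact: (@ext_mulA CE).
rewrite [tau_factors _ _ _ _]/=; case: ifP => [iJ|/negbT/ihJ[K [sK pK eK]]]; last first.
  by exists K; split=> //; rewrite wedge_seq_cons eK.
have [|K [sK pK eK]] := IH (rem i J).
  move=> x; rewrite count_mem_rem iJ andbT; have := h x; rewrite /=.
  by case: (i == x); rewrite /= ?subn0 ?add1n ?add0n // leq_subLR add1n.
exists K; split; first exact: subseq_trans sK (subseq_cons _ _).
  rewrite -cat1s; apply: perm_trans (_ : perm_eq _ (K ++ i :: rem i J)) _.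
    by rewrite -[i :: rem i J]cat1s perm_sym perm_catCA perm_sym /= perm_cons.
  by rewrite perm_cat2l perm_sym perm_to_rem.
rewrite wedge_seq_cons eK delta_e /tmon /= (perm_dprod _ _ _ (perm_to_rem iJ)) dprod_cons.
rewrite -[wprod]/(@ext_mul CE) ext_mulA comm_emon; last exact: dgen_comm.
by rewrite -ext_mulA.
Qed.

Lemma tau_mon_chain L k d : distinguished k d -> tau_mon L k d = taud CE L k d.
Proof.
case: d => I J dd; have [u kd pe _] := distinguishedP dd.
have /and4P[/andP[/= sI _] _ subJ sm] := dd.
have [|K [sK pK eK]] := @tau_factorsP L k I J.
  by move=> x; rewrite -(seq.permP pe) count_cat leq_addl.
suff eKm : K = mdiff I J by rewrite /tau_mon [LHS]eK eKm; exact: erefl.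
apply: (sorted_eq leq_trans anti_leq).
- by apply: (subseq_sorted leq_trans sK sI).
- by apply: (sub_sorted ltnW).
- by rewrite perm_sym; apply: perm_mdiff.
Qed.

Lemma xi_mon_chain L k d : (0 < k)%N -> nonsingular k d -> xi_mon L k d = xid CE L k d.
Proof.
move=> k0 /and3P[_ nsI _]; have := normal_formP k0 nsI.
rewrite /xi_mon /xid /normal_form; move: (take _ _) (blocks _) => I0 Is [_ _ _ dI _].
rewrite wedge_seq_cons -emon_chain -eprod_chain.
suff -> : [seq (if head 0%N b \in d.2 then delta L k (e_mon b) else e_mon b) | b <- Is] =
  [seq (if head 0%N b \in d.2 then bder CE L k b else emon CE b) | b <- Is] by exact: erefl.
apply/eq_in_map => b /(allP dI) db; rewrite emon_chain delta_e_mon //.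
case: b db => // i b /andP[_]; apply: sub_path => x y /eqP ->.
by rewrite /= addn3 ltnS leqW // leqW.
Qed.

Lemma lin_indep_e_mon (Q : pred (seq nat)) : (forall s, Q s -> sorted ltn s) ->
  lin_indep Q e_mon.
Proof.
move=> Qs S c QS S0 t tS.
have e1 (s : seq nat) : s \in S -> mcoeff [fset x in t]%fset (e_mon s) = (s == t)%:R.
  move=> sS; have [ss st] := (Qs _ (QS _ sS), Qs _ (QS _ tS)).
  rewrite e_mon_strict // mcoeffU; congr (_%:R); congr nat_of_bool.
  apply/eqP/eqP => [/fsetP e|-> //].
  apply: (irr_sorted_eq ltn_trans ltnn ss st) => x.
  by have := e x; rewrite !inE.
have := congr1 (mcoeff [fset x in t]%fset) S0; rewrite mcoeff0 raddf_sum /=.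
rewrite (big_fsetD1 t tS) /= mcoeffZ e1 // eqxx mulr1 big1_seq ?addr0 // => s.
by rewrite in_fsetD1 => /andP[_ /andP[/negbTE st sS]]; rewrite mcoeffZ e1 // st mulr0.
Qed.

(** A finite list that contains all strict partitions of n, so that the counting argument has a
    finite basis. *)
Definition small_seqs n : seq (seq nat) :=
  [seq mask m (iota 0 n.+1) | m : (n.+1).-tuple bool].

Lemma strict_small n s : sorted ltn s -> sumn s = n -> s \in small_seqs n.
Proof.
move=> ss sn; have le x : x \in s -> (x <= n)%N.
  by move=> xs; rewrite -sn (perm_sumn (perm_to_rem xs)) leq_addr.
have e : s = mask [seq x \in s | x <- iota 0 n.+1] (iota 0 n.+1).
  rewrite -filter_mask; apply: (irr_sorted_eq ltn_trans ltnn) => // [|x].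
    by apply: (sorted_filter ltn_trans); apply: iota_ltn_sorted.
  by rewrite mem_filter mem_iota /= ltnS; apply/idP/andP => [xs|[]//]; split=> //; apply: le.
have sz : size [seq x \in s | x <- iota 0 n.+1] == n.+1 by rewrite size_map size_iota.
by rewrite {1}e; apply/imageP; exists (Tuple sz).
Qed.

(** * Assembly of the two bases *)

Section Basis.
Variables (A : exterior) (L : lie_algebra) (k n : nat).
Hypothesis k_gt0 : (0 < k)%N.

Let Q (s : seq nat) := [&& k_partition k s, strict s & sumn s == n].
Let NS (d : seq nat * seq nat) : bool := D k n d && nonsingular k d.

(** A strict partition s is the distinguished partition with no distinguished parts, so the
    expansions of [taud] already give spanning; independence comes from [lin_indep_card] with the
    injection [encode_part]. *)
Lemma basis_family (f : seq nat * seq nat -> A) : lin_indep Q (@emon A) ->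
  (forall d, NS d -> lspan Q (@emon A) (f d)) ->
  (forall d, D k n d ->
    lspan (fun d' => [/\ D k n d', nonsingular k d' & dle k n d' d]) f (taud A L k d)) ->
  is_basis NS f (lspan Q (@emon A)).
Proof.
move=> indQ fQ span.
have eQ s : Q s -> lspan NS f (@emon A s).
  case/and3P=> ps ss /eqP sn; have [sl ks] := andP ps.
  have Dd : D k n (s, [::]).
    by rewrite /D /distinguished /= ps sub0seq /= ss sn eqxx.
  have -> : @emon A s = taud A L k (s, [::]) by rewrite /taud /tmon /= ext_1mul.
  by apply: lspan_sub (span _ Dd) => d' [Dd' ns' _]; rewrite /NS Dd'.
split=> //; last by move=> x; apply: lspan_trans.
apply: (lin_indep_card (us := small_seqs n) (g := encode_part k n) (Q := Q) (e := @emon A)) => //.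
- by move=> s /and3P[_ ss /eqP sn]; apply: strict_small.
- by move=> d /andP[Dd nsd]; apply: encode_part_strict.
- by move=> d d' /andP[Dd nsd] /andP[Dd' nsd']; apply: encode_part_inj.
Qed.

End Basis.

Lemma eq_lspan (V : lmodType rat) (T : choiceType) (P : T -> Prop) (f g : T -> V) x :
  (forall t, P t -> f t = g t) -> lspan P f x -> lspan P g x.
Proof. by move=> fg; apply: lspan_trans => t Pt; rewrite fg //; apply: lspan_gen. Qed.

Lemma eq_lin_indep (V : lmodType rat) (T : choiceType) (P : T -> Prop) (f g : T -> V) :
  (forall t, P t -> f t = g t) -> lin_indep P f -> lin_indep P g.
Proof.
move=> fg ind s c Ps e; apply: (ind s c Ps); rewrite -[RHS]e.
by apply: eq_big_seq => t ts; rewrite fg //; apply: Ps.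
Qed.

Lemma eq_is_basis (V : lmodType rat) (T : choiceType) (P : T -> Prop) (f g : T -> V)
    (S S' : V -> Prop) : (forall t, P t -> f t = g t) -> (forall x, S x <-> S' x) ->
  is_basis P f S -> is_basis P g S'.
Proof.
move=> fg SS' [fS ind span]; split.
- by move=> t Pt; rewrite -fg //; apply/SS'/fS.
- exact: eq_lin_indep fg ind.
- by move=> x /SS'/span; apply: eq_lspan.
Qed.

Theorem theorem1p1 (L : lie_algebra) (k n : nat) (hk : (1 <= k)%N) (hn : (k <= n)%N) :
  [/\ (forall d : dpart, D k n d ->
         lspan (fun d' : dpart => [/\ D k n d', nonsingular k d' & dle k n d' d])
               (tau_mon L k) (tau_mon L k d) /\
         lspan (fun d' : dpart => [/\ D k n d', nonsingular k d' & dle k n d' d])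
               (xi_mon L k) (tau_mon L k d)),
      is_basis (fun d : dpart => D k n d && nonsingular k d)
               (tau_mon L k) (cochain_deg k n)
    & is_basis (fun d : dpart => D k n d && nonsingular k d)
               (xi_mon L k) (cochain_deg k n)].
Proof.
have tauE d : nonsingular k d -> taud CE L k d = tau_mon L k d.
  by move=> /andP[dd _]; rewrite tau_mon_chain.
have xiE d : nonsingular k d -> xid CE L k d = xi_mon L k d.
  by move=> ns; rewrite xi_mon_chain.
pose Q (s : seq nat) := [&& k_partition k s, strict s & sumn s == n].
have ind : lin_indep Q (@emon CE).
  apply: (@eq_lin_indep CE _ Q e_mon) => [s _|]; first exact: esym (emon_chain s).
  by apply: lin_indep_e_mon => s /and3P[].
have SE (x : CE) : lspan Q (@emon CE) x <-> cochain_deg k n x.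
  by split; apply: eq_lspan => s _; [exact: emon_chain | exact: esym (emon_chain s)].
have tauB : is_basis (fun d : dpart => D k n d && nonsingular k d) (taud CE L k) (lspan Q (@emon CE)).
  apply: (basis_family hk ind) => [d /andP[Dd _]|d Dd]; first exact: taud_deg.
  exact: span_taud.
have xiB : is_basis (fun d : dpart => D k n d && nonsingular k d) (xid CE L k) (lspan Q (@emon CE)).
  apply: (basis_family hk ind) => [d /andP[Dd ns]|d Dd]; first exact: xid_deg.
  exact: span_xid.
split=> [d Dd||].
- have /andP[dd _] := Dd; rewrite (tau_mon_chain L dd); split.
    exact: (eq_lspan (fun t Pt => tauE t (let: And3 _ ns _ := Pt in ns)) (@span_taud CE L k hk n d Dd)).
  exact: (eq_lspan (fun t Pt => xiE t (let: And3 _ ns _ := Pt in ns)) (@span_xid CE L k hk n d Dd)).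
- exact: (@eq_is_basis CE _ _ _ _ _ _ (fun t Pt => tauE t (proj2 (andP Pt))) SE tauB).
- exact: (@eq_is_basis CE _ _ _ _ _ _ (fun t Pt => xiE t (proj2 (andP Pt))) SE xiB).
Qed.
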